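(* Let $n\ge 1$ be an integer, let $(\alpha,\beta)\subseteq\mathbb{R}$ be a bounded open interval and let $$P_{a(t)}(Z)=Z^n+\sum_{j=1}^n a_j(t)Z^{n-j},\quad t\in(\alpha,\beta),$$ be a monic polynomial with complex valued coefficients $a_j\in C^{n-1,1}([\alpha,\beta])$, $j=1,\ldots,n$. Let $\lambda\in C^0((\alpha,\beta))$ be a continuous root of $P_a$ on $(\alpha,\beta)$, i.e., $\lambda:(\alpha,\beta)\to\mathbb{C}$ is continuous and $P_{a(t)}(\lambda(t))=0$ for all $t\in(\alpha,\beta)$. Then $\lambda$ is absolutely continuous on $(\alpha,\beta)$ and belongs to the Sobolev space $W^{1,p}((\alpha,\beta))$ for every $1\le p<n/(n-1)$. The derivative $\lambda'$ satisfies $$\|\lambda'\|_{L^p((\alpha,\beta))}\le C(n,p)\,\max\{1,(\beta-\alpha)^{1/p}\}\,\max_{1\le j\le n}\|a_j\|_{C^{n-1,1}([\alpha,\beta])}^{1/j},$$ where the constant $C(n,p)$ depends only on $n$ and $p$.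
   Context: For a bounded open interval $\Omega=(\alpha,\beta)$, $C^{n-1,1}([\alpha,\beta])$ is the space of complex valued $C^{n-1}$-functions on $\Omega$ whose derivatives of order $\le n-1$ extend continuously to $[\alpha,\beta]$ and whose $(n-1)$-st derivative is Lipschitz. Its norm is $\|f\|_{C^{n-1,1}([\alpha,\beta])}=\sup_{0\le i\le n-1,\,t\in\Omega}|f^{(i)}(t)|+\mathrm{Lip}_\Omega(f^{(n-1)})$, where $\mathrm{Lip}_\Omega(g)=\sup_{x\ne y\in\Omega}|g(x)-g(y)|/|x-y|$. Convention: $n/(n-1)=\infty$ if $n=1$. *)

(* Defs.v *)
(* MathComp / MathComp-Analysis. *)
From HB Require Import structures.
From mathcomp Require Import all_boot all_order all_algebra.
From mathcomp Require Import all_classical all_reals all_analysis.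
From mathcomp Require Import complex.

Set Implicit Arguments.
Unset Strict Implicit.
Unset Printing Implicit Defensive.

Import Order.TTheory GRing.Theory Num.Theory.
Import numFieldNormedType.Exports.

Local Open Scope classical_set_scope.
Local Open Scope ring_scope.

(* The complex numbers are [Rcomplex R], i.e. R[i] seen as a field with an
   R-valued modulus, on which R acts by scaling.  Only the topology is missing
   to make it a normed module over R: it is the one of the modulus. *)
Section RcomplexNormedModule.
Variable R : realType.

Lemma Rcomplex_normrZ (k : R) (z : Rcomplex R) : `|k *: z| = `|k| * `|z|.
Proof.
case: z => x y; rewrite /Num.norm /= !exprMn -mulrDr sqrtrM ?sqr_ge0//.
by rewrite sqrtr_sqr.
Qed.

HB.instance Definition _ :=
  PseudoMetric.copy (Rcomplex R) (pseudoMetric_normed (Rcomplex R)).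
HB.instance Definition _ := isPointed.Build (Rcomplex R) 0.
HB.instance Definition _ :=
  NormedZmod_PseudoMetric_eq.Build R (Rcomplex R) erefl.
HB.instance Definition _ :=
  PseudoMetricNormedZmod_Lmodule_isNormedModule.Build R (Rcomplex R)
    Rcomplex_normrZ.

End RcomplexNormedModule.

Section Definitions.
Variable R : realType.
Local Notation C := (Rcomplex R).
Local Notation mu := (@lebesgue_measure R).

(* Functions on an interval are total functions on R; every definition below
   depends only on their values on the interval. *)

(* a_j is [a j] for 1 <= j <= n; the other values of [a] are irrelevant. *)
Definition monic_poly (n : nat) (a : nat -> R -> C) (t : R) : {poly C} :=
  'X^n + \sum_(1 <= j < n.+1) a j t *: 'X^(n - j).

(* C^{k,1}([alpha, beta]).  Continuity of the derivatives on the open interval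
   is part of the existence of a continuous extension. *)
Definition Ck1 (k : nat) (alpha beta : R) (f : R -> C) : Prop :=
  [/\ forall i t, (i < k)%N -> t \in `]alpha, beta[ -> derivable (derive1n i f) t 1,
      forall i, (i <= k)%N -> exists2 g : R -> C,
        {within `[alpha, beta]%classic, continuous g} &
        {in `]alpha, beta[, derive1n i f =1 g}
    & [lipschitz derive1n k f t | t in `]alpha, beta[%classic] ].

Definition Lip (A : set R) (g : R -> C) : R :=
  sup [set r | exists x y, [/\ A x, A y, x != y & r = `|g x - g y| / `|x - y|]].

(* The real suprema are over bounded sets whenever [Ck1 k alpha beta f]. *)
Definition Ck1_norm (k : nat) (alpha beta : R) (f : R -> C) : R :=
  sup [set r | exists i t,
         [/\ (i <= k)%N, t \in `]alpha, beta[ & r = `|derive1n i f t|]]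
  + Lip `]alpha, beta[%classic (derive1n k f).

(* Closed subintervals with disjoint interiors. *)
Definition abs_continuous (A : set R) (f : R -> C) : Prop :=
  forall e : R, 0 < e -> exists2 d : R, 0 < d &
    forall (m : nat) (x y : 'I_m -> R),
      (forall i, x i < y i /\ `[x i, y i]%classic `<=` A) ->
      trivIset setT (fun i => `]x i, y i[%classic) ->
      \sum_i (y i - x i) < d -> \sum_i `|f (y i) - f (x i)| < e.

(* The pointwise derivative [derive1 f] of an absolutely continuous f exists
   almost everywhere; where it does not exist it takes the value 0, which has
   no effect on its norm. *)
Definition Lp_norm (p : R) (A : set R) (f : R -> C) : \bar R :=
  Lnorm mu p%:E ((fun t => `|f t|%:E) \_ A).

Definition in_Lp (p : R) (A : set R) (f : R -> C) : Prop :=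
  [/\ measurable_fun A (fun t => complex.Re (f t)),
      measurable_fun A (fun t => complex.Im (f t))
    & (Lp_norm p A f < +oo)%E].

(* Meaningful when both parts are integrable, as is the case in
   [weak_derivative] for f, g in L^p(A), p >= 1. *)
Definition Cintegral (A : set R) (f : R -> C) : C :=
  Complex (\int[mu]_(t in A) complex.Re (f t)) (\int[mu]_(t in A) complex.Im (f t)).

(* Real-valued test functions suffice: the identity in [weak_derivative] is
   linear in phi. *)
Definition test_function (A : set R) (phi : R -> R) : Prop :=
  (forall i t, derivable (derive1n i phi) t 1) /\
  (exists K : set R, [/\ compact K, K `<=` A & forall t, ~ K t -> phi t = 0]).

Definition weak_derivative (A : set R) (f g : R -> C) : Prop :=
  forall phi : R -> R, test_function A phi ->
    Cintegral A (fun t => derive1 phi t *: f t) =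
    - Cintegral A (fun t => phi t *: g t).

Definition in_W1p (p : R) (A : set R) (f : R -> C) : Prop :=
  in_Lp p A f /\ exists2 g, in_Lp p A g & weak_derivative A f g.

(* n / (n - 1), with the convention that it is infinite for n = 1. *)
Definition critical_exponent (n : nat) : \bar R :=
  if n == 1%N then +oo%E else (n%:R / (n.-1)%:R)%:E.

End Definitions.

(* Main.v *)
(** A continuous root of a monic polynomial is controlled through sums of
    |f(y) - f(x)|^p / (y - x)^(p - 1) over finite families of nonoverlapping
    intervals.  These are bounded by induction on the number m of roots in a
    cluster, that is, near a root of multiplicity m of a fixed polynomial.

    Subtracting the small root of the (m-1)-st z-derivative, which is as regular
    as the coefficients, the cluster is centered: its coefficient of z^(m-1)
    vanishes.  At a time t0 let d be the size of the centered cluster,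
    d = max_k |c_k(t0)|^(1/(m-k)), and let h <= d be the largest time scale with
    |c_k^(i)(t0)| h^i <= d^(m-k) for all k < m - 1, i < m.  Rescaling space by d
    and time by h yields a polynomial with bounded coefficients which is not a
    pure power, so the roots split into smaller clusters on a time interval of
    length comparable to h, and the induction hypothesis bounds the variation
    there by h (d/h)^p.

    A Whitney decomposition into intervals of length comparable to h reduces the
    claim to a bound for the sum of |Q| (d/h)^p.  Where d/h is large, equality
    |c_k^(i)(t0)| h^i = d^(m-k) holds for some 0 < i < m - k, so it suffices that
    the set where |F^(i)| = v^(j-i) and |F| theta^i <= A v^j has measure O(1/theta)
    for F in C^(j-1,1) with j = m - k: then sum |Q| (d/h)^p converges for
    p < j/(j-1).  This weak-type bound follows from sublevel estimates for F on
    intervals where F^(i) is nearly constant, summed with the same bound for the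
    smaller index j - i applied to F^(i).

    The bound for some p > 1 gives absolute continuity.  The real and imaginary
    parts are then integrals of their derivatives (Lebesgue-Stieltjes measures of
    the total variation and Radon-Nikodym), and the L^p bound follows from Fatou's
    lemma applied to the slopes of chords over uniform grids. *)
Require Import Defs.
From HB Require Import structures.
From mathcomp Require Import all_boot all_order all_algebra.
From mathcomp Require Import all_classical all_reals all_analysis.
From mathcomp Require Import measurable_realfun.
From mathcomp Require Import complex ring lra zify.

Set Implicit Arguments.
Unset Strict Implicit.
Unset Printing Implicit Defensive.

Import Order.TTheory GRing.Theory Num.Theory.
Import numFieldNormedType.Exports.

Local Open Scope classical_set_scope.
Local Open Scope ring_scope.

(** * The modulus of complex numbers *)

(** The factor of the polynomial belonging to a cluster is never split off. A cluster of m roots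
    keeps all n + 1 coefficients, normalized so that c_m = 1 and the others are small, and a
    continuous root starting in the unit disc cannot leave it, since modulus 1 contradicts that
    smallness. The smallness tau depends on m and n only. It is fixed before the regularity bound K,
    which grows at each rescaling. The functional |f(y) - f(x)|^p / (y - x)^(p - 1) involves no
    derivative, does not decrease when an interval is subdivided (hence localizes to Whitney
    intervals), and scales by h (D/h)^p when time is stretched by h and space by D. The condition (m
    - 1) p < m passes to smaller m. Regularity is stated through first-order expansions on closed
    intervals of length at most 1, so that every constant depends only on n, p and K. The
    homogeneity in max |a_j|^(1/j) comes from one rescaling of z at the very end, and the factor
    max{1, beta - alpha} from cutting into pieces of length at most 1. *)

Section ComplexModulus.
Variable R : realType.
Local Notation C := (Rcomplex R).

Definition nm (z : C) : R := `|z|.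

Definition cR (r : R) : C := Complex r 0.

Lemma cR_is_zmod_morphism : zmod_morphism cR.
Proof. by move=> x y; apply/eqP; rewrite eq_complex /= subr0 !eqxx. Qed.

Lemma cR_is_monoid_morphism : monoid_morphism cR.
Proof.
split=> // x y; apply/eqP.
by rewrite eq_complex /= mulr0 mul0r mulr0 subr0 addr0 !eqxx.
Qed.

HB.instance Definition _ := GRing.isZmodMorphism.Build R C cR cR_is_zmod_morphism.
HB.instance Definition _ := GRing.isMonoidMorphism.Build R C cR cR_is_monoid_morphism.

Lemma scale_cR (k : R) (z : C) : k *: z = cR k * z.
Proof.
by case: z => x y; apply/eqP; rewrite eq_complex /= !mul0r subr0 addr0 !eqxx.
Qed.

Lemma nmM (x y : C) : nm (x * y) = nm x * nm y.
Proof.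
rewrite /nm /Num.norm /=; case: x y => [a b] [c d] /=.
by rewrite -sqrtrM ?addr_ge0 ?sqr_ge0//; congr Num.sqrt; ring.
Qed.

Lemma nm_cR (r : R) : nm (cR r) = `|r|.
Proof. by rewrite /nm /Num.norm /= expr0n addr0 sqrtr_sqr. Qed.

Lemma nm0 : nm 0 = 0. Proof. exact: normr0. Qed.
Lemma nm1 : nm 1 = 1.
Proof. by have -> : 1 = cR 1 :> C by []; rewrite nm_cR normr1. Qed.
Lemma nmN x : nm (- x) = nm x. Proof. exact: normrN. Qed.
Lemma nm_ge0 x : 0 <= nm x. Proof. exact: normr_ge0. Qed.
Lemma nmD x y : nm (x + y) <= nm x + nm y. Proof. exact: ler_normD. Qed.
Lemma nmB x y : nm (x - y) <= nm x + nm y. Proof. exact: ler_normB. Qed.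
Lemma nm_distC x y : nm (x - y) = nm (y - x). Proof. exact: distrC. Qed.
Lemma nm_eq0 x : (nm x == 0) = (x == 0). Proof. exact: normr_eq0. Qed.
Lemma nm_gt0 x : (0 < nm x) = (x != 0). Proof. exact: normr_gt0. Qed.

Lemma nmX (x : C) n : nm (x ^+ n) = nm x ^+ n.
Proof. by elim: n => [|n IH]; rewrite ?expr0 ?nm1// !exprS nmM IH. Qed.

Lemma nmV (x : C) : nm x^-1 = (nm x)^-1.
Proof.
have [->|x0] := eqVneq x 0; first by rewrite invr0 nm0 invr0.
have h : nm x * nm x^-1 = 1 by rewrite -nmM divff// nm1.
by rewrite -[RHS]mulr1 -h mulKf// nm_eq0.
Qed.

Lemma nm_div (x y : C) : nm (x / y) = nm x / nm y.
Proof. by rewrite nmM nmV. Qed.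

Lemma nm_nat (k : nat) : nm (k%:R) = k%:R.
Proof. by rewrite -(rmorph_nat cR) nm_cR normr_nat. Qed.

Lemma nm_sum (I : Type) (r : seq I) (P : pred I) (F : I -> C) :
  nm (\sum_(i <- r | P i) F i) <= \sum_(i <- r | P i) nm (F i).
Proof. exact: ler_norm_sum. Qed.

Lemma ReD (x y : C) : complex.Re (x + y) = complex.Re x + complex.Re y.
Proof. by case: x y => [? ?] [? ?]. Qed.

Lemma ReN (x : C) : complex.Re (- x) = - complex.Re x.
Proof. by case: x. Qed.

Lemma Re_cRM (r : R) (x : C) : complex.Re (cR r * x) = r * complex.Re x.
Proof. by case: x => a b /=; rewrite mul0r subr0. Qed.

Lemma Re_le_nm (x : C) : `|complex.Re x| <= nm x.
Proof.
case: x => a b; rewrite /nm /Num.norm /= -[leLHS]sqrtr_sqr.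
by rewrite ler_wsqrtr// lerDl sqr_ge0.
Qed.

Lemma Im_le_nm (x : C) : `|complex.Im x| <= nm x.
Proof.
case: x => a b; rewrite /nm /Num.norm /= -[leLHS]sqrtr_sqr.
by rewrite ler_wsqrtr// lerDr sqr_ge0.
Qed.

Lemma nm_sqr (z : C) : nm z ^+ 2 = complex.Re z ^+ 2 + complex.Im z ^+ 2.
Proof.
by case: z => a b; rewrite /nm /Num.norm /= sqr_sqrtr ?addr_ge0 ?sqr_ge0.
Qed.

Lemma nm_le_ReIm (x : C) : nm x <= `|complex.Re x| + `|complex.Im x|.
Proof.
rewrite -(@ler_pXn2r _ 2) ?nnegrE ?nm_ge0 ?addr_ge0// nm_sqr sqrrD.
by rewrite !real_normK ?num_real// addrAC lerDl mulrn_wge0// mulr_ge0.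
Qed.

(** The unit number is the conjugate of u / |u|. It reduces lower bounds on complex functions that
    stay near u to bounds on real ones, see [sublevelC]. *)
Lemma Re_rotate (u : C) : exists w : C, nm w = 1 /\ complex.Re (u * w) = nm u.
Proof.
have [->|u0] := eqVneq u 0; first by exists 1; rewrite nm1 mul0r nm0.
have r0 : nm u != 0 by rewrite nm_eq0.
have h := nm_sqr u.
exists (Complex (complex.Re u / nm u) (- complex.Im u / nm u)); split.
  apply/eqP; rewrite -(@eqrXn2 _ 2)// ?nm_ge0//; apply/eqP.
  rewrite nm_sqr /= !expr_div_n -mulrDl sqrrN -h expr1n divff//.
  by rewrite expf_neq0.
have -> : complex.Re (u * Complex (complex.Re u / nm u) (- complex.Im u / nm u))
  = (complex.Re u ^+ 2 + complex.Im u ^+ 2) / nm u.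
  by move: r0; case: (u) (nm u) => a b r r0 /=; field.
by rewrite -h expr2 mulfK.
Qed.

End ComplexModulus.

(* The cost of [lra] grows with the number of order hypotheses in the context:
   keep those sharing a variable with the goal. *)
Ltac order_fact T := lazymatch T with
  | is_true (_ <= _)%R => idtac
  | is_true (_ < _)%R => idtac
  | is_true (_ && _) => idtac
  | (_ <= _)%R = _ => idtac
  | (_ < _)%R = _ => idtac
  | @eq (Equality.sort _) _ _ => idtac
  | @eq ?A _ _ => lazymatch type of A with Prop => fail | _ => idtac end
  | _ /\ _ => idtac
  end.

Ltac shares_var T G := match T with context [?x] =>
    is_var x; lazymatch type of x with realType => fail | _ => idtac end;
    match G with context [x] => idtac end
  end.

Ltac revert_related := match goal with |- ?G =>
    repeat match goal with H : ?T |- _ => order_fact T; shares_var T G; revert H end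
  end.

Ltac order_lra := first
  [ revert_related; clear; intros; lra
  | revert_related; revert_related; clear; intros; lra
  | lra ].

Ltac minmax := repeat (match goal with
  | |- context [Order.max ?x ?y] => is_var x; is_var y; case: (leP x y) => ?
  | |- context [Order.min ?x ?y] => is_var x; is_var y; case: (leP x y) => ?
  end); lra.

(** * Chains of intervals *)

Section Chains.
Variable R : realType.
Implicit Types (a b c d e x y : R) (L Q : seq (R * R)).

Fixpoint chain a b L : bool :=
  if L is q :: L' then [&& a <= q.1, q.1 < q.2 & chain q.2 b L'] else a <= b.

Lemma chain_le a b L : chain a b L -> a <= b.
Proof.
elim: L a => [|[x y] L IH] a //= /and3P[ax xy /IH yb].
exact: le_trans ax (le_trans (ltW xy) yb).
Qed.

Lemma chain_widenl a a' b L : a' <= a -> chain a b L -> chain a' b L.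
Proof.
case: L => [|[x y] L] /= a'a; first exact: le_trans.
by case/and3P=> ax -> ->; rewrite (le_trans a'a ax).
Qed.

Lemma chain_widenr a b b' L : b <= b' -> chain a b L -> chain a b' L.
Proof.
move=> bb'; elim: L a => [|[x y] L IH] a /=; first by move/le_trans; exact.
by case/and3P=> -> -> /IH ->.
Qed.

Lemma chain_cat a m b L1 L2 : chain a m L1 -> chain m b L2 -> chain a b (L1 ++ L2).
Proof.
elim: L1 a => [|[x y] L IH] a /=; first exact: chain_widenl.
by case/and3P=> -> -> h1 /(IH _ h1).
Qed.

Lemma chain_mem a b L q : chain a b L -> q \in L -> [/\ a <= q.1, q.1 < q.2 & q.2 <= b].
Proof.
elim: L a => [|[x y] L IH] a //= /and3P[ax xy h]; rewrite inE => /orP[/eqP->/=|].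
  by split=> //; exact: chain_le h.
by case/(IH _ h) => yq q12 q2b; split=> //; apply: le_trans ax (le_trans (ltW xy) yq).
Qed.

Lemma chain_filter a b L (P : pred (R * R)) : chain a b L -> chain a b [seq q <- L | P q].
Proof.
elim: L a => [|[x y] L IH] a //= /and3P[ax xy h]; case: ifP => _ /=.
  by rewrite ax xy IH.
by apply: chain_widenl (IH _ h); apply: le_trans ax (ltW xy).
Qed.

Lemma chain_tot a b L : chain a b L -> \sum_(q <- L) (q.2 - q.1) <= b - a.
Proof.
elim: L a => [|[x y] L IH] a /=; first by rewrite big_nil subr_ge0.
by case/and3P=> ax xy /IH; rewrite big_cons /=; lra.
Qed.

Definition clip c d L : seq (R * R) :=
  [seq q <- [seq (Num.max q.1 c, Num.min q.2 d) | q <- L] | q.1 < q.2].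

Lemma mem_clip c d L q : q \in clip c d L ->
  exists2 q0, q0 \in L & [/\ q0.1 <= q.1, q.1 < q.2, q.2 <= q0.2, c <= q.1 & q.2 <= d].
Proof.
rewrite mem_filter => /andP[h /mapP[q0 q0L qE]]; exists q0 => //.
by split=> //; rewrite qE /= ?le_max ?ge_min lexx ?orbT.
Qed.

(** The left end [min (max a c) d] is what the induction on [L] can propagate: [a] moves to the
    right and may pass [d]. *)
Lemma chain_clip a b L c d : chain a b L -> c <= d ->
  chain (Num.min (Num.max a c) d) d (clip c d L).
Proof.
move=> + cd; elim: L a => [|[x y] L IH] a /=; first by rewrite ge_min lexx orbT.
case/and3P=> ax xy /IH h; rewrite /clip /=.
case: ifP => /= [xy'|_].
  rewrite xy' /=; apply/andP; split; first by minmax.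
  by apply: chain_widenl h; move: ax xy cd; clear; minmax.
by apply: chain_widenl h; rewrite le_min2// le_max2// (le_trans ax) ?ltW.
Qed.

Lemma chain_clip_itv a b L c d : chain a b L -> c <= d -> chain c d (clip c d L).
Proof.
move=> h cd; apply: chain_widenl (chain_clip h cd).
by rewrite le_min le_max lexx orbT.
Qed.

Lemma clip_id a b L : chain a b L -> clip a b L = L.
Proof.
move=> h; rewrite /clip.
have -> : [seq (Num.max q.1 a, Num.min q.2 b) | q <- L] = L.
  rewrite -[RHS]map_id; apply/eq_in_map => -[x y] /(chain_mem h)/= [ax _ yb].
  by rewrite (max_idPl ax) (min_idPl yb).
by apply/all_filterP/allP => q /(chain_mem h)[].
Qed.

(** Restricting a sum over [L] to [[c, d]] makes it a subadditive function of the interval, which is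
    the form [whitney] distributes over its output. *)
Definition csum (phi : R -> R -> R) L c d := \sum_(q <- clip c d L) phi q.1 q.2.

(** Only the intervals of [L] that straddle [d] are cut, and there the subadditivity of [phi]
    applies; the case analysis treats the pieces degenerating at [d]. *)
Lemma csum_split (phi : R -> R -> R) L c d e : c <= d -> d <= e ->
  (forall x y, x < y -> 0 <= phi x y) ->
  (forall x y z, x < y -> y < z -> phi x z <= phi x y + phi y z) ->
  csum phi L c e <= csum phi L c d + csum phi L d e.
Proof.
move=> cd de phi0 phiD; rewrite /csum /clip !big_filter !big_map -!/(\sum_(i <- L | _) _).
rewrite [X in X <= _]big_mkcond [X in _ <= X + _]big_mkcond [X in _ <= _ + X]big_mkcond.
rewrite -big_split /=; apply: ler_sum => -[x y] _ /=.
have posP u v : 0 <= (if u < v then phi u v else 0) by case: ifP => // /phi0.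
case: ifPn => [h|_]; last exact: addr_ge0 (posP _ _) (posP _ _).
have [dx|xd] : d <= x \/ x < d by case: leP; [left|right].
  have -> : Num.max x d = Num.max x c by minmax.
  by rewrite h lerDr.
have [yd|dy] : y <= d \/ d < y by case: leP; [left|right].
  move: h; have -> : Num.min y e = y by minmax.
  have -> : Num.min y d = y by minmax.
  by move=> ->; rewrite lerDl.
have -> : Num.max x d = d by minmax.
have -> : Num.min y d = d by minmax.
have xcd : Num.max x c <= d by rewrite ge_max (ltW xd).
have dye : d <= Num.min y e by rewrite le_min (ltW dy).
move: xcd; rewrite le_eqVlt => /predU1P[xcd|xcd].
  by move: h; rewrite xcd => ->; rewrite ltxx add0r.
move: dye; rewrite le_eqVlt => /predU1P[dye|dye].
  by move: h; rewrite -dye => ->; rewrite ltxx addr0.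
by rewrite xcd dye phiD.
Qed.

(* Bisection until an interval is stopped or irrelevant. *)
Lemma whitney (stop irrel : R -> R -> Prop) (delta a b : R) :
  0 < delta -> a < b ->
  (forall c d, a <= c -> c < d -> d <= b -> d - c <= delta -> stop c d \/ irrel c d) ->
  exists Q, [/\ chain a b Q, forall q, q \in Q -> stop q.1 q.2,
    Q = [:: (a, b)] \/ forall q, q \in Q ->
      exists c d, [/\ c <= q.1, q.2 <= d, d - c = 2 * (q.2 - q.1) & ~ stop c d]
    & forall W : R -> R -> R,
      (forall c d e, c <= d -> d <= e -> W c e <= W c d + W d e) ->
      (forall c d, c < d -> irrel c d -> W c d <= 0) ->
      W a b <= \sum_(q <- Q) W q.1 q.2].
Proof.
move=> delta0 ab fine.
have [n hn] : exists n : nat, b - a <= delta * 2 ^+ n.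
  exists (Num.truncn ((b - a) / delta)).+1.
  rewrite -ler_pdivrMl// mulrC; apply: le_trans (ltW (truncnS_gt _)) _.
  by rewrite -natrX ler_nat ltnW// ltn_expl.
(* Every interval of the output except the starting one is a half of an interval that is not
   stopped. This is what later bounds its length from below by a multiple of the local scale. *)
have aux : forall c d, a <= c -> c < d -> d <= b -> d - c <= delta * 2 ^+ n ->
  exists Q, [/\ chain c d Q,
    forall q, q \in Q -> stop q.1 q.2 /\ (q = (c, d) \/
      exists c d, [/\ c <= q.1, q.2 <= d, d - c = 2 * (q.2 - q.1) & ~ stop c d])
    & forall W : R -> R -> R,
      (forall c d e, c <= d -> d <= e -> W c e <= W c d + W d e) ->
      (forall c d, c < d -> irrel c d -> W c d <= 0) ->
      W c d <= \sum_(q <- Q) W q.1 q.2].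
  elim: n {hn} => [|n IH] c d ac cd db.
    rewrite expr0 mulr1 => /(fine _ _ ac cd db)[h|h].
      exists [:: (c, d)]; split => [|q|W _ _]; first by rewrite /= !lexx cd.
        by rewrite inE => /eqP ->; split=> //; left.
      by rewrite big_seq1.
    exists [::]; split=> // [|W _]; first exact: ltW.
    by rewrite big_nil; exact.
  move=> dcn; have [h|h] := pselect (stop c d).
    exists [:: (c, d)]; split => [|q|W _ _]; first by rewrite /= !lexx cd.
      by rewrite inE => /eqP ->; split=> //; left.
    by rewrite big_seq1.
  pose m := (c + d) / 2.
  have cm : c < m by rewrite /m; lra.
  have md : m < d by rewrite /m; lra.
  have [||Q1 [ch1 st1 W1]] := IH c m ac cm; first by lra.
    by move: dcn; rewrite exprS /m; lra.
  have [||Q2 [ch2 st2 W2]] := IH m d _ md db; first by lra.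
    by move: dcn; rewrite exprS /m; lra.
  exists (Q1 ++ Q2); split => [|q|W Wadd Wirr].
  - exact: chain_cat ch1 ch2.
  - rewrite mem_cat => /orP[] hq.
      have [sq pq] := st1 q hq; split=> //; right.
      by case: pq => [->|//]; exists c, d; split=> //=; rewrite /m; order_lra.
    have [sq pq] := st2 q hq; split=> //; right.
    by case: pq => [->|//]; exists c, d; split=> //=; rewrite /m; order_lra.
  - rewrite big_cat /=; apply: le_trans (Wadd c m d (ltW cm) (ltW md)) _.
    by apply: lerD; [exact: W1|exact: W2].
have [sab|nsab] := pselect (stop a b).
  exists [:: (a, b)]; split => [|q||W _ _]; first by rewrite /= !lexx ab.
  - by rewrite inE => /eqP ->.
  - by left.
  - by rewrite big_seq1.
have [Q [chQ stQ WQ]] := aux a b (lexx _) ab (lexx _) hn.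
exists Q; split=> // [q /stQ[]//|]; right=> q /stQ[sq [qE|//]].
by rewrite qE in sq.
Qed.
Lemma csum_deg (phi : R -> R -> R) L c d : d <= c -> csum phi L c d = 0.
Proof.
move=> dc; rewrite /csum /clip big_filter big_map big1// => q.
by rewrite gt_max !lt_min => /andP[_ /andP[_]]; rewrite ltNge dc.
Qed.

Lemma csum_len_le a b L c d : chain a b L -> c <= d ->
  csum (fun x y => y - x) L c d <= d - c.
Proof. by move=> h cd; apply: chain_tot; apply: chain_clip_itv h cd. Qed.

Lemma csum_len_split L c d e : c <= d -> d <= e ->
  csum (fun x y => y - x) L c e <=
  csum (fun x y => y - x) L c d + csum (fun x y => y - x) L d e.
Proof.
by move=> cd de; apply: csum_split => // *; lra.
Qed.
End Chains.

(** * Quantitative C^(k,1) regularity *)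

Section Regularity.
Variable R : realType.
Local Notation C := (Rcomplex R).
Implicit Types (a b x y t K L M : R) (f g : R -> C).

(** Cutting into 2^n equal pieces gives e a b <= K (b - a)^2 / 2^n for every n. The mean value
    inequalities follow by applying it to the defect, such as |f y - f x| - M (y - x). *)
Lemma subadditive_square (e : R -> R -> R) K a b : a <= b ->
  (forall x y z, a <= x -> x <= y -> y <= z -> z <= b -> e x z <= e x y + e y z) ->
  (forall x y, a <= x -> x <= y -> y <= b -> e x y <= K * (y - x) ^+ 2) ->
  e a b <= 0.
Proof.
move=> ab eD eK.
have aux n : forall x y, a <= x -> x <= y -> y <= b ->
    e x y <= K * (y - x) ^+ 2 / 2 ^+ n.
  elim: n => [|n IH] x y ax xy yb; first by rewrite expr0 divr1 eK.
  pose m := (x + y) / 2.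
  have xm : x <= m by rewrite /m; lra.
  have my : m <= y by rewrite /m; lra.
  apply: le_trans (eD x m y ax xm my yb) _.
  apply: le_trans (lerD (IH x m ax xm (le_trans my yb)) (IH m y (le_trans ax xm) my yb)) _.
  have h2 : (2 ^+ n : R) != 0 by rewrite expf_neq0.
  rewrite le_eqVlt; apply/orP; left; apply/eqP; rewrite (exprS _ n) /m.
  by field.
rewrite leNgt; apply/negP => e0.
have h := aux _ _ _ (lexx a) ab (lexx b).
set Z := K * (b - a) ^+ 2 in h.
have Z0 : 0 < Z by have := h 0%N; rewrite expr0 divr1; apply: lt_le_trans.
have := h (Num.truncn (Z / e a b)).+1.
rewrite ler_pdivlMr ?exprn_gt0// => h1.
have h3 := truncnS_gt (Z / e a b).
have h2 : Z / e a b < 2 ^+ (Num.truncn (Z / e a b)).+1.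
  apply: lt_le_trans h3 _.
  by rewrite -natrX ler_nat ltnW// ltn_expl.
move: h2; rewrite ltr_pdivrMr// mulrC => h2.
by have := lt_le_trans h2 h1; rewrite ltxx.
Qed.

(* f' = g, with |g(y) - g(x)| = O(|y - x|); no differentiation is involved, so
   that the constants stay explicit on closed intervals. *)
Definition dq a b K f g := forall x y, a <= x <= b -> a <= y <= b ->
  nm (f y - f x - cR (y - x) * g x) <= K * (y - x) ^+ 2.
Definition bdd a b K f := forall x, a <= x <= b -> nm (f x) <= K.
Definition lip a b K f := forall x y, a <= x <= b -> a <= y <= b ->
  nm (f y - f x) <= K * `|y - x|.

Lemma mean_value_le a b K M f g : dq a b K f g ->
  forall x y, a <= x -> x <= y -> y <= b ->
  (forall t, x <= t <= y -> nm (g t) <= M) -> nm (f y - f x) <= M * (y - x).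
Proof.
move=> fg x y ax xy yb gM; rewrite -subr_le0.
apply: (@subadditive_square (fun x y => nm (f y - f x) - M * (y - x)) K x y xy).
  move=> u v w xu uv vw wy.
  have -> : f w - f u = (f v - f u) + (f w - f v) by ring.
  by have := nmD (f v - f u) (f w - f v); lra.
move=> u v xu uv vy.
have aub : a <= u <= b by lra.
have avb : a <= v <= b by lra.
have h := fg _ _ aub avb.
have -> : f v - f u = (f v - f u - cR (v - u) * g u) + cR (v - u) * g u by ring.
have h1 := nmD (f v - f u - cR (v - u) * g u) (cR (v - u) * g u).
have h2 : nm (cR (v - u) * g u) <= M * (v - u).
  rewrite nmM nm_cR ger0_norm ?subr_ge0// mulrC ler_wpM2r ?subr_ge0//.
  by apply: gM; lra.
lra.
Qed.

Lemma mean_value_ge a b K M (f g : R -> R) :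
  (forall x y, a <= x <= b -> a <= y <= b ->
     `|f y - f x - (y - x) * g x| <= K * (y - x) ^+ 2) ->
  forall x y, a <= x -> x <= y -> y <= b ->
  (forall t, x <= t <= y -> M <= g t) -> M * (y - x) <= f y - f x.
Proof.
move=> fg x y ax xy yb gM; rewrite -subr_le0.
apply: (@subadditive_square (fun x y => M * (y - x) - (f y - f x)) K x y xy).
  by move=> u v w xu uv vw wy; lra.
move=> u v xu uv vy.
have aub : a <= u <= b by lra.
have avb : a <= v <= b by lra.
have := fg _ _ aub avb; rewrite ler_norml => /andP[h _].
have : M * (v - u) <= (v - u) * g u.
  by rewrite mulrC ler_wpM2l ?subr_ge0//; apply: gM; lra.
lra.
Qed.

(** The mean value inequality for f minus its tangent at x turns the Lipschitz constant of the
    derivative into the constant of the expansion. [jets_rescale] relies on it: at the new scale it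
    is the Lipschitz constants that are under control. *)
Lemma dq_improve a b K M f g : 0 <= M -> dq a b K f g -> lip a b M g -> dq a b M f g.
Proof.
move=> M0 fg gM x y xab yab.
have fg' : dq a b K (fun t => f t - cR t * g x) (fun t => g t - g x).
  move=> u v uab vab.
  have -> : f v - cR v * g x - (f u - cR u * g x) - cR (v - u) * (g u - g x) =
    f v - f u - cR (v - u) * g u by ring.
  exact: fg.
have gle t : a <= t <= b -> `|t - x| <= `|y - x| -> nm (g t - g x) <= M * `|y - x|.
  by move=> tab h; apply: le_trans (gM _ _ xab tab) _; rewrite ler_wpM2l.
have -> : f y - f x - cR (y - x) * g x = (f y - cR y * g x) - (f x - cR x * g x) by ring.
have [xy|yx] := leP x y.
  have yx0 : 0 <= y - x by lra.
  apply: le_trans (mean_value_le (M := M * (y - x)) fg' _ xy _ _) _; [lra|lra| |lra].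
  move=> t txy; have := gle t; rewrite (ger0_norm yx0); apply; first lra.
  by rewrite ger0_norm; lra.
rewrite nm_distC.
have yx0 : y - x <= 0 by lra.
apply: le_trans (mean_value_le (M := M * (x - y)) fg' _ (ltW yx) _ _) _; [lra|lra| |lra].
move=> t txy; have := gle t; rewrite (ler0_norm yx0) opprB; apply; first lra.
by rewrite ler0_norm; lra.
Qed.

(** A ball of C^(k,1) on a closed interval. The derivatives are existential witnesses, so that
    products, inverses and implicit functions only have to exhibit one. *)
Fixpoint Reg a b (k : nat) K f : Prop :=
  and (bdd a b K f)
  (match k with
   | 0%N => lip a b K f
   | k'.+1 => exists2 g, Reg a b k' K g & dq a b K f g
   end).

Lemma Reg_bdd a b k K f : Reg a b k K f -> bdd a b K f.
Proof. by case: k => [|k] []. Qed.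

Lemma Reg_mono a b k K L f : K <= L -> Reg a b k K f -> Reg a b k L f.
Proof.
move=> KL; elim: k f => [|k IH] f [fb].
  move=> fl; split=> [x /fb|x y xab yab]; first by move/le_trans; apply.
  by apply: le_trans (fl _ _ xab yab) _; rewrite ler_wpM2r.
case=> g /IH g1 fg; split=> [x /fb|]; first by move/le_trans; apply.
by exists g => // x y xab yab; apply: le_trans (fg _ _ xab yab) _; rewrite ler_wpM2r ?sqr_ge0.
Qed.

Lemma bdd_ge0 a b K f : a <= b -> bdd a b K f -> 0 <= K.
Proof.
by move=> ab h; apply: le_trans (nm_ge0 _) (h a _); rewrite lexx ab.
Qed.

Lemma Reg_lip a b k K f : b - a <= 1 -> Reg a b k K f -> lip a b (2 * K) f.
Proof.
move=> ab1; case: k => [|k] [fb].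
  move=> fl x y xab yab; apply: le_trans (fl _ _ xab yab) _.
  have : 0 <= K * `|y - x| by apply: le_trans (fl _ _ xab yab); exact: nm_ge0.
  lra.
case=> g gR fg x y xab yab.
have K0 : 0 <= K by apply: bdd_ge0 fb; lra.
have h1 := fg _ _ xab yab; have h2 := Reg_bdd gR xab.
have -> : f y - f x = (f y - f x - cR (y - x) * g x) + cR (y - x) * g x by ring.
apply: le_trans (nmD _ _) _; rewrite nmM nm_cR.
have yx1 : `|y - x| <= 1 by rewrite ler_norml; lra.
have h3 : `|y - x| * nm (g x) <= `|y - x| * K by rewrite ler_wpM2l.
have h4 : (y - x) ^+ 2 <= `|y - x|.
  by rewrite -real_normK ?num_real// expr2 ler_piMl.
have : K * (y - x) ^+ 2 <= K * `|y - x| by rewrite ler_wpM2l.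
lra.
Qed.

Lemma Reg_le a b k K f : b - a <= 1 -> 0 <= K -> Reg a b k.+1 K f -> Reg a b k (2 * K) f.
Proof.
move=> ab1 K0; elim: k f => [|k IH] f fR.
  split; last exact: Reg_lip fR.
  by move=> x /(Reg_bdd fR); lra.
case: (fR) => fb [g gR fg]; split; first by move=> x /fb; lra.
exists g; first exact: IH.
move=> x y xab yab; apply: le_trans (fg _ _ xab yab) _.
by rewrite ler_wpM2r ?sqr_ge0//; lra.
Qed.

Lemma Reg_cst a b k K (c : C) : nm c <= K -> Reg a b k K (fun=> c).
Proof.
move=> cK; have K0 : 0 <= K by apply: le_trans cK; exact: nm_ge0.
elim: k c cK => [|k IH] c cK; split; try by move=> x _.
  by move=> x y _ _; rewrite subrr nm0 mulr_ge0.
exists (fun=> 0); first by apply: IH; rewrite nm0.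
by move=> x y _ _; rewrite subrr mulr0 subr0 nm0 mulr_ge0 ?sqr_ge0.
Qed.

Lemma eq_Reg a b k K f g : (forall t, a <= t <= b -> f t = g t) ->
  Reg a b k K f -> Reg a b k K g.
Proof.
move=> fg; case: k => [|k] [fb].
  move=> fl; split=> [x xab|x y xab yab]; first by rewrite -fg// fb.
  by rewrite -!fg// fl.
case=> g' g'R fg'; split=> [x xab|]; first by rewrite -fg// fb.
by exists g' => // x y xab yab; rewrite -!fg// fg'.
Qed.

Lemma Reg_add a b k K L f g : Reg a b k K f -> Reg a b k L g ->
  Reg a b k (K + L) (fun t => f t + g t).
Proof.
elim: k f g => [|k IH] f g [fb fl] [gb gl].
  split=> [x xab|x y xab yab].
    by apply: le_trans (nmD _ _) _; apply: lerD; [exact: fb|exact: gb].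
  have -> : f y + g y - (f x + g x) = (f y - f x) + (g y - g x) by ring.
  by apply: le_trans (nmD _ _) _; rewrite mulrDl; apply: lerD; [exact: fl|exact: gl].
case: fl => f' f'R ff'; case: gl => g' g'R gg'; split=> [x xab|].
  by apply: le_trans (nmD _ _) _; apply: lerD; [exact: fb|exact: gb].
exists (fun t => f' t + g' t); first exact: IH.
move=> x y xab yab.
have -> : f y + g y - (f x + g x) - cR (y - x) * (f' x + g' x) =
  (f y - f x - cR (y - x) * f' x) + (g y - g x - cR (y - x) * g' x) by ring.
by apply: le_trans (nmD _ _) _; rewrite mulrDl; apply: lerD; [exact: ff'|exact: gg'].
Qed.

(** Induction through the Leibniz rule, which needs the undifferentiated factor at the lower order
    k; on an interval of length at most 1 this costs a factor 2 ([Reg_le]). *)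
Lemma Reg_mul k K L : 0 <= K -> 0 <= L -> exists2 M, 0 <= M & forall a b f g, b - a <= 1 ->
  Reg a b k K f -> Reg a b k L g -> Reg a b k M (fun t => f t * g t).
Proof.
elim: k K L => [|k IH] K L K0 L0.
  exists (2 * K * L); first by rewrite !mulr_ge0.
  move=> a b f g ab1 [fb fl] [gb gl]; split=> [x xab|x y xab yab].
    rewrite nmM; have : nm (f x) * nm (g x) <= K * L.
      by apply: ler_pM; rewrite ?nm_ge0 ?fb ?gb.
    by have := mulr_ge0 K0 L0; lra.
  have -> : f y * g y - f x * g x = f y * (g y - g x) + (f y - f x) * g x by ring.
  apply: le_trans (nmD _ _) _; rewrite !nmM.
  have h1 : nm (f y) * nm (g y - g x) <= K * (L * `|y - x|).
    by apply: ler_pM; rewrite ?nm_ge0 ?fb ?gl.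
  have h2 : nm (f y - f x) * nm (g x) <= (K * `|y - x|) * L.
    by apply: ler_pM; rewrite ?nm_ge0 ?fl ?gb.
  by lra.
have [||M1 M10 h1] := IH K (2 * L) => //; first lra.
have [||M2 M20 h2] := IH (2 * K) L => //; first lra.
pose M := M1 + M2 + 6 * K * L.
exists M; first by rewrite /M !addr_ge0 ?mulr_ge0.
move=> a b f g ab1 fR gR.
have KL0 := mulr_ge0 K0 L0.
have fb := Reg_bdd fR; have gb := Reg_bdd gR.
have fl := Reg_lip ab1 fR; have gl := Reg_lip ab1 gR.
have f1 := Reg_le ab1 K0 fR; have g1 := Reg_le ab1 L0 gR.
case: fR => _ [f' f'R ff']; case: gR => _ [g' g'R gg'].
split=> [x xab|].
  rewrite nmM; have : nm (f x) * nm (g x) <= K * L.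
    by apply: ler_pM; rewrite ?nm_ge0 ?fb ?gb.
  by rewrite /M; lra.
exists (fun t => f' t * g t + f t * g' t).
  have := Reg_add (h1 a b _ _ ab1 f'R g1) (h2 a b _ _ ab1 f1 g'R).
  by apply: Reg_mono; rewrite /M; lra.
move=> x y xab yab.
have -> : f y * g y - f x * g x - cR (y - x) * (f' x * g x + f x * g' x) =
  (f y - f x - cR (y - x) * f' x) * g x + f x * (g y - g x - cR (y - x) * g' x)
  + (f y - f x) * (g y - g x) by ring.
apply: le_trans (nmD _ _) _; apply: le_trans (lerD (nmD _ _) (lexx _)) _; rewrite !nmM.
have e1 : nm (f y - f x - cR (y - x) * f' x) * nm (g x) <= (K * (y - x) ^+ 2) * L.
  by apply: ler_pM; rewrite ?nm_ge0 ?ff' ?gb.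
have e2 : nm (f x) * nm (g y - g x - cR (y - x) * g' x) <= K * (L * (y - x) ^+ 2).
  by apply: ler_pM; rewrite ?nm_ge0 ?gg' ?fb.
have e3 : nm (f y - f x) * nm (g y - g x) <= (2 * K * `|y - x|) * (2 * L * `|y - x|).
  by apply: ler_pM; rewrite ?nm_ge0 ?fl ?gl.
have e4 : (2 * K * `|y - x|) * (2 * L * `|y - x|) = 4 * (K * L) * (y - x) ^+ 2.
  by rewrite -(real_normK (num_real (y - x))); ring.
have e5 : 0 <= (M1 + M2) * (y - x) ^+ 2 by rewrite mulr_ge0 ?sqr_ge0 ?addr_ge0.
rewrite e4 in e3; rewrite /M; lra.
Qed.
End Regularity.

Section RegularityClosure.
Variable R : realType.
Local Notation C := (Rcomplex R).
Implicit Types (a b x y t K L M : R) (f g : R -> C).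

Lemma Reg_opp a b k K f : Reg a b k K f -> Reg a b k K (fun t => - f t).
Proof.
elim: k f => [|k IH] f [fb fl].
  split=> [x xab|x y xab yab]; first by rewrite nmN fb.
  by rewrite -opprD nmN; exact: fl.
case: fl => g gR fg; split=> [x xab|]; first by rewrite nmN fb.
exists (fun t => - g t); first exact: IH.
move=> x y xab yab.
have -> : - f y - - f x - cR (y - x) * - g x = - (f y - f x - cR (y - x) * g x) by ring.
by rewrite nmN fg.
Qed.

(** Induction through (1/f)' = - f' / f^2, with the powers of 1/f regular at order k by
    induction. *)
Lemma Reg_inv k K (kappa : R) : 0 <= K -> 0 < kappa ->
  exists2 M, 0 <= M & forall a b f, b - a <= 1 ->
  Reg a b k K f -> (forall t, a <= t <= b -> kappa <= nm (f t)) ->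
  Reg a b k M (fun t => (f t)^-1).
Proof.
move=> + k0; have ik0 : 0 <= kappa^-1 by rewrite invr_ge0 ltW.
have invb f a b : (forall t, a <= t <= b -> kappa <= nm (f t)) ->
    bdd a b kappa^-1 (fun t => (f t)^-1).
  move=> fk x xab; rewrite nmV lef_pV2 ?fk// posrE//.
  exact: lt_le_trans (fk _ xab).
elim: k K => [|k IH] K K0.
  exists (kappa^-1 + K * kappa^-1 ^+ 2); first by rewrite addr_ge0 ?mulr_ge0 ?exprn_ge0.
  move=> a b f ab1 [fb fl] fk; have ib := invb _ _ _ fk; split=> [x xab|x y xab yab].
    by apply: le_trans (ib _ xab) _; rewrite lerDl mulr_ge0 ?exprn_ge0.
  have fx0 : f x != 0 by rewrite -nm_gt0; apply: lt_le_trans (fk _ xab).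
  have fy0 : f y != 0 by rewrite -nm_gt0; apply: lt_le_trans (fk _ yab).
  have -> : (f y)^-1 - (f x)^-1 = - ((f y - f x) * ((f y)^-1 * (f x)^-1)).
    by field; rewrite fx0 fy0.
  rewrite nmN !nmM.
  have h1 : nm (f y)^-1 * nm (f x)^-1 <= kappa^-1 ^+ 2.
    by rewrite expr2; apply: ler_pM; rewrite ?nm_ge0 ?ib.
  have h2 : nm (f y - f x) * (nm (f y)^-1 * nm (f x)^-1) <= K * `|y - x| * kappa^-1 ^+ 2.
    by apply: ler_pM; rewrite ?mulr_ge0 ?nm_ge0 ?fl.
  have h3 : 0 <= kappa^-1 * `|y - x| by rewrite mulr_ge0.
  by lra.
have [|M0 M00 h0] := IH (2 * K); first lra.
have [M1 M10 h1] := Reg_mul k M00 M00.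
have [M2 M20 h2] := Reg_mul k K0 M10.
pose N := 4 * K ^+ 2 * kappa^-1 ^+ 3 + K * kappa^-1 ^+ 2.
have N0 : 0 <= N by rewrite addr_ge0 ?mulr_ge0 ?exprn_ge0.
exists (kappa^-1 + M2 + N); first lra.
move=> a b f ab1 fR fk; have ib := invb _ _ _ fk.
have f1 := Reg_le ab1 K0 fR; have fl := Reg_lip ab1 fR.
case: fR => fb [g gR fg]; split=> [x xab|].
  by apply: le_trans (ib _ xab) _; rewrite -addrA lerDl addr_ge0.
exists (fun t => - (g t * ((f t)^-1 * (f t)^-1))).
  apply: Reg_mono (Reg_opp (h2 _ _ _ _ ab1 gR (h1 _ _ _ _ ab1 (h0 _ _ _ ab1 f1 fk) (h0 _ _ _ ab1 f1 fk)))).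
  by lra.
move=> x y xab yab.
have fx0 : f x != 0 by rewrite -nm_gt0; apply: lt_le_trans (fk _ xab).
have fy0 : f y != 0 by rewrite -nm_gt0; apply: lt_le_trans (fk _ yab).
have -> : (f y)^-1 - (f x)^-1 - cR (y - x) * - (g x * ((f x)^-1 * (f x)^-1)) =
   (f y - f x) ^+ 2 * ((f y)^-1 * (f x)^-1 ^+ 2)
   - (f y - f x - cR (y - x) * g x) * (f x)^-1 ^+ 2.
  by field; rewrite fx0 fy0.
apply: le_trans (nmB _ _) _.
have e1 : nm (f y - f x) ^+ 2 <= (2 * K * `|y - x|) ^+ 2.
  by rewrite lerXn2r ?nnegrE ?nm_ge0 ?mulr_ge0// fl.
have e2 : nm (f x)^-1 ^+ 2 <= kappa^-1 ^+ 2 by rewrite lerXn2r ?nnegrE ?nm_ge0 ?ib.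
have e3 : nm (f y)^-1 * nm (f x)^-1 ^+ 2 <= kappa^-1 ^+ 3.
  by rewrite (exprS kappa^-1); apply: ler_pM => //; rewrite ?exprn_ge0 ?nm_ge0 ?ib.
have e4 : nm ((f y - f x) ^+ 2 * ((f y)^-1 * (f x)^-1 ^+ 2)) <=
    (2 * K * `|y - x|) ^+ 2 * kappa^-1 ^+ 3.
  rewrite nmM nmX nmM nmX.
  apply: ler_pM e1 e3; first by rewrite exprn_ge0// nm_ge0.
  by rewrite mulr_ge0 ?exprn_ge0 ?nm_ge0.
have e5 : nm ((f y - f x - cR (y - x) * g x) * (f x)^-1 ^+ 2) <=
   K * (y - x) ^+ 2 * kappa^-1 ^+ 2.
  rewrite nmM nmX.
  by apply: ler_pM; rewrite ?exprn_ge0 ?nm_ge0 ?fg.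
have e6 : (2 * K * `|y - x|) ^+ 2 = 4 * K ^+ 2 * (y - x) ^+ 2.
  by rewrite -[in RHS](real_normK (num_real (y - x))); ring.
have e7 : 0 <= (kappa^-1 + M2) * (y - x) ^+ 2 by rewrite mulr_ge0 ?sqr_ge0 ?addr_ge0.
by rewrite e6 in e4; rewrite /N; lra.
Qed.

Lemma Reg_exp k K n : 0 <= K -> exists2 M, 0 <= M & forall a b f, b - a <= 1 ->
  Reg a b k K f -> Reg a b k M (fun t => f t ^+ n).
Proof.
move=> K0; elim: n => [|n [M M0 IH]].
  by exists 1 => // a b f _ _; apply: eq_Reg (Reg_cst a b k (_ : nm 1 <= 1)); rewrite ?nm1.
have [M' M'0 h] := Reg_mul k K0 M0; exists M' => // a b f ab1 fR.
by apply: eq_Reg (h a b f _ ab1 fR (IH _ _ _ ab1 fR)) => t _; rewrite exprS.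
Qed.

Lemma Reg_sum k K n a b (F : nat -> R -> C) : 0 <= K ->
  (forall i, (i < n)%N -> Reg a b k K (F i)) ->
  Reg a b k (n%:R * K) (fun t => \sum_(i < n) F i t).
Proof.
move=> K0; elim: n => [|n IH] h.
  by apply: eq_Reg (Reg_cst a b k (_ : nm 0 <= _)) => [t _|]; rewrite ?big_ord0 ?nm0 ?mul0r.
apply: (eq_Reg (f := fun t => \sum_(i < n) F i t + F n t)) => [t _|].
  by rewrite big_ord_recr.
rewrite -natr1 mulrDl mul1r; apply: Reg_add; last exact: h.
by apply: IH => i ni; apply: h; apply: ltnW.
Qed.

(** The ball [Reg] with the derivatives chosen once and for all, because the scales below are
    defined from their values at a point. *)
Definition jets a b k K (F : nat -> R -> C) := [/\
  forall i, (i <= k)%N -> bdd a b K (F i),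
  forall i, (i < k)%N -> dq a b K (F i) (F i.+1) & lip a b K (F k)].

Lemma Reg_jets a b k K f : Reg a b k K f -> exists2 F, jets a b k K F & F 0%N = f.
Proof.
elim: k f => [|k IH] f [fb].
  by move=> fl; exists (fun=> f) => //; split=> // i.
case=> g /IH[F [Fb Fd Fl] F0] fg; exists (fun i => if i is j.+1 then F j else f) => //.
split=> [[|i]|[|i]|//]; [by []|exact: Fb|by rewrite F0|exact: Fd].
Qed.

Lemma jets_Reg a b k K F : jets a b k K F -> Reg a b k K (F 0%N).
Proof.
elim: k F => [|k IH] F [Fb Fd Fl]; split; try exact: Fb; try exact: Fl.
exists (F 1%N); last exact: Fd.
by apply: (IH (fun i => F i.+1)); split=> // i ik; [exact: Fb|exact: Fd].
Qed.

Lemma jets_shift a b i k K F : jets a b (i + k) K F -> jets a b k K (fun l => F (i + l)%N).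
Proof.
move=> [Fb Fd Fl]; split=> // l lk; first by apply: Fb; rewrite leq_add2l.
by rewrite addnS; apply: Fd; rewrite ltn_add2l.
Qed.

Lemma jets_lip a b k K F i : b - a <= 1 -> jets a b k K F -> (i <= k)%N ->
  lip a b (2 * K) (F i).
Proof.
move=> ab1 Fj ik; have : jets a b (i + (k - i)) K F by rewrite subnKC.
by move/jets_shift/jets_Reg/(Reg_lip ab1); rewrite addn0.
Qed.

Lemma jets_trunc a b k K F i : b - a <= 1 -> 0 <= K -> jets a b k K F -> (i <= k)%N ->
  jets a b i (2 * K) F.
Proof.
move=> ab1 K0 Fj ik; have Fl := jets_lip ab1 Fj ik.
case: Fj => Fb Fd _; split=> // l li.
  by move=> x xab; have := Fb l (leq_trans li ik) x xab; lra.
move=> x y xab yab; have := Fd l (leq_trans li ik) x y xab yab.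
have : 0 <= K * (y - x) ^+ 2 by rewrite mulr_ge0 ?sqr_ge0.
by lra.
Qed.

(** Descending induction on the order, from the Lipschitz bound of the top derivative: passing from
    one order to the next lower one adds y to the bound, whence [K' = 1 + K + k]. *)
Lemma jets_local a b k K F (t0 h y : R) : 0 <= K -> jets a b k K F -> a <= t0 <= b ->
  0 < h -> 0 <= y -> h ^+ k.+1 <= y ->
  (forall l, (0 < l)%N -> (l <= k)%N -> nm (F l t0) * h ^+ l <= y) ->
  let K' := 1 + K + k%:R in
  forall t t', a <= t <= b -> a <= t' <= b -> `|t - t0| <= h -> `|t' - t0| <= h ->
  (forall l, (0 < l)%N -> (l <= k)%N -> nm (F l t) * h ^+ l <= K' * y) /\
  (forall l, (l <= k)%N -> nm (F l t - F l t') * h ^+ l.+1 <= K' * y * `|t - t'|).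
Proof.
move=> K0 [Fb Fd Fl] t0ab h0 y0 hky F0 K'.
pose near t := a <= t <= b /\ `|t - t0| <= h.
have nt0 : near t0 by split=> //; rewrite subrr normr0 ltW.
have yK : 0 <= K * y by rewrite mulr_ge0.
have P j : (j <= k)%N -> (forall t t', near t -> near t' ->
   nm (F (k - j)%N t - F (k - j)%N t') * h ^+ (k - j).+1 <= (K + j%:R) * y * `|t - t'|)
   /\ ((0 < k - j)%N -> forall t, near t -> nm (F (k - j)%N t) * h ^+ (k - j) <=
          (1 + K + j%:R) * y).
  elim: j => [_|j IH jk].
    rewrite subn0 addr0; have H t t' : near t -> near t' ->
        nm (F k t - F k t') * h ^+ k.+1 <= K * y * `|t - t'|.
      move=> [tab _] [t'ab _].
      have := ler_pM (nm_ge0 _) (exprn_ge0 k.+1 (ltW h0)) (Fl t' t t'ab tab) hky.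
      by rewrite mulrAC.
    split=> // k_gt0 t nt; have e1 := F0 _ k_gt0 (leqnn _).
    have e2 := H _ _ nt nt0; case: nt => tab th.
    have e3 : nm (F k t - F k t0) * h ^+ k <= K * y.
      have hne : h != 0 by rewrite gt_eqF.
      rewrite -(ler_pM2r h0) -mulrA -exprSr; apply: le_trans e2 _.
      by rewrite ler_wpM2l.
    have e4 : nm (F k t) <= nm (F k t - F k t0) + nm (F k t0).
      by rewrite -[X in nm X <= _](subrK (F k t0)) nmD.
    have := ler_wpM2r (exprn_ge0 k (ltW h0)) e4; rewrite mulrDl addr0.
    by lra.
  have [_ IHb] := IH (ltnW jk).
  set l := (k - j.+1)%N.
  have lE : (k - j = l.+1)%N by rewrite /l; lia.
  rewrite lE in IHb; have {}IHb := IHb isT.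
  have lk : (l < k)%N by rewrite /l; lia.
  have H t t' : near t -> near t' -> nm (F l t - F l t') * h ^+ l.+1 <=
      (K + j.+1%:R) * y * `|t - t'|.
    have E : K + j.+1%:R = 1 + K + j%:R by rewrite -natr1; ring.
    rewrite E.
    wlog : t t' / t' <= t.
      move=> W; have [t't|/ltW tt'] := leP t' t; first exact: W.
      by move=> nt nt'; rewrite nm_distC distrC; apply: W.
    move=> t't [tab th] [t'ab t'h].
    rewrite (ger0_norm (_ : 0 <= t - t')) ?subr_ge0//.
    rewrite -ler_pdivlMr ?exprn_gt0//.
    apply: le_trans (mean_value_le (M := (1 + K + j%:R) * y / h ^+ l.+1)
        (Fd l lk) _ t't _ _) _; [lra|lra| |].
      move=> u tut'; rewrite ler_pdivlMr ?exprn_gt0//; apply: IHb; split; first lra.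
      by move: th t'h; rewrite !ler_norml; lra.
    by rewrite le_eqVlt; apply/orP; left; apply/eqP; ring.
  split=> // l0 t nt; have e1 := F0 _ l0 (ltnW lk).
  have e2 := H _ _ nt nt0; case: nt => tab th.
  have e3 : nm (F l t - F l t0) * h ^+ l <= (K + j.+1%:R) * y.
    rewrite -(ler_pM2r h0) -mulrA -exprSr; apply: le_trans e2 _.
    by rewrite ler_wpM2l// mulr_ge0// addr_ge0.
  have e4 : nm (F l t) <= nm (F l t - F l t0) + nm (F l t0).
    by rewrite -[X in nm X <= _](subrK (F l t0)) nmD.
  have := ler_wpM2r (exprn_ge0 l (ltW h0)) e4; rewrite mulrDl.
  by lra.
move=> t t' tab t'ab th t'h; split=> l.
  move=> l0 lk; have [_ ] := P (k - l)%N (leq_subr _ _).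
  rewrite subKn// => /(_ l0 t (conj tab th)) H; apply: le_trans H _.
  by rewrite ler_wpM2r// lerD2l ler_nat leq_subr.
move=> lk; have [+ _] := P (k - l)%N (leq_subr _ _).
rewrite subKn// => /(_ t t' (conj tab th) (conj t'ab t'h)) H; apply: le_trans H _.
rewrite ler_wpM2r// ler_wpM2r// /K'.
have : (k - l)%:R <= k%:R :> R by rewrite ler_nat leq_subr.
by lra.
Qed.

(** Dividing the function by y and time by h gives a norm that depends on K and k alone. It exceeds
    the constant of [jets_local] by 1 because order 0 is its value at t0 plus its oscillation. *)
Lemma jets_rescale a b k K F (t0 h y a' b' : R) : 0 <= K -> jets a b k K F ->
  a <= t0 <= b -> 0 < h -> 0 < y -> h ^+ k.+1 <= y ->
  (forall l, (l <= k)%N -> nm (F l t0) * h ^+ l <= y) ->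
  (forall s, a' <= s <= b' -> a <= t0 + h * s <= b /\ `|s| <= 1) ->
  jets a' b' k (2 + K + k%:R) (fun i s => cR (h ^+ i / y) * F i (t0 + h * s)).
Proof.
move=> K0 Fj t0ab h0 y0 hky F0 sP; set K2 := 2 + K + k%:R.
have := jets_local K0 Fj t0ab h0 (ltW y0) hky (fun l _ => F0 l).
set K' := 1 + K + k%:R => loc.
have K'0 : 0 <= K' by rewrite /K' !addr_ge0.
have K2E : K2 = 1 + K' by rewrite /K2 /K'; ring.
case: Fj => Fb Fd Fl.
have hyP i : 0 <= h ^+ i / y by rewrite divr_ge0 ?exprn_ge0// ltW.
have near s : a' <= s <= b' -> a <= t0 + h * s <= b /\ `|t0 + h * s - t0| <= h.
  move=> /sP[? s1]; split=> //; rewrite addrAC subrr add0r normrM gtr0_norm//.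
  by rewrite ler_piMr// ltW.
have Gl i : (i <= k)%N -> lip a' b' K2 (fun s => cR (h ^+ i / y) * F i (t0 + h * s)).
  move=> ik s s' /near[tab th] /near[t'ab t'h].
  have [_ /(_ i ik)] := loc _ _ t'ab tab t'h th.
  rewrite -mulrBr nmM nm_cR (ger0_norm (hyP i)).
  have -> : t0 + h * s' - (t0 + h * s) = h * (s' - s) by ring.
  rewrite normrM (gtr0_norm h0) exprSr => H.
  have H' : nm (F i (t0 + h * s') - F i (t0 + h * s)) * h ^+ i <= K' * y * `|s' - s|.
    by rewrite -(ler_pM2r h0); lra.
  rewrite mulrAC ler_pdivrMr// mulrC; apply: le_trans H' _.
  have : 0 <= y * `|s' - s| by rewrite mulr_ge0// ltW.
  by rewrite K2E; lra.
split=> [i ik s /near[tab th]|i ik|]; last exact: Gl.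
  rewrite nmM nm_cR (ger0_norm (hyP i)).
  rewrite mulrAC ler_pdivrMr// mulrC.
  case: i ik => [|i] ik.
    have t0n : `|t0 - t0| <= h by rewrite subrr normr0 ltW.
    have [_ /(_ 0%N (leq0n _))] := loc _ _ tab t0ab th t0n.
    have := F0 0%N (leq0n _); rewrite expr0 expr1 mulr1.
    move=> e0 e1.
    have e2 : nm (F 0%N (t0 + h * s) - F 0%N t0) <= K' * y.
      rewrite -(ler_pM2r h0); apply: le_trans e1 _.
      by rewrite ler_wpM2l// mulr_ge0// ltW.
    have : nm (F 0%N (t0 + h * s)) <= nm (F 0%N (t0 + h * s) - F 0%N t0) + nm (F 0%N t0).
      by rewrite -[X in nm X <= _](subrK (F 0%N t0)) nmD.
    by rewrite mulr1 K2E; lra.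
  have [/(_ i.+1 isT ik) H _] := loc _ _ tab tab th th.
  by apply: le_trans H _; rewrite ler_pM2r// K2E; lra.
apply: (dq_improve (K := h ^+ i.+2 / y * K)); first by rewrite K2E; lra.
  move=> s s' /near[tab th] /near[t'ab t'h].
  have := Fd i ik _ _ tab t'ab.
  have -> : t0 + h * s' - (t0 + h * s) = h * (s' - s) by ring.
  set u := F i (t0 + h * s'); set v := F i (t0 + h * s); set w := F i.+1 (t0 + h * s).
  have -> : cR (h ^+ i / y) * u - cR (h ^+ i / y) * v - cR (s' - s) * (cR (h ^+ i.+1 / y) * w)
    = cR (h ^+ i / y) * (u - v - cR (h * (s' - s)) * w).
    have -> : h ^+ i.+1 / y = h ^+ i / y * h by rewrite exprS; ring.
    by ring.
  rewrite nmM nm_cR (ger0_norm (hyP i)) => H.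
  apply: le_trans (ler_wpM2l (hyP i) H) _.
  by rewrite le_eqVlt !exprS; apply/orP; left; apply/eqP; ring.
exact: Gl.
Qed.
End RegularityClosure.

(** * Sublevel sets *)

Section Sublevel.
Variable R : realType.
Local Notation C := (Rcomplex R).
Local Notation len := (fun x y : R => y - x).
Implicit Types (a b c d x y t K M : R) (f g : R -> C) (L : seq (R * R)).

(** A sublevel estimate of van der Corput type. In the inductive step G n has slope at least u, so
    it changes sign at most once, at z. Outside a window of radius 2 gam around z one has |G n| >= u
    gam, and the induction hypothesis applies on each side to G or - G with u gam in place of u; the
    window itself has length at most 4 gam. *)
Lemma sublevel n : exists2 B : R, 0 <= B & forall (G : nat -> R -> R) K c d u gam eta L a b,
  c <= d ->
  (forall l, (l < n)%N -> forall x y, c <= x <= d -> c <= y <= d ->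
     `|G l y - G l x - (y - x) * G l.+1 x| <= K * (y - x) ^+ 2) ->
  0 < u -> 0 < gam -> eta < u * gam ^+ n -> (forall t, c <= t <= d -> u <= G n t) ->
  chain a b L ->
  (forall q t, q \in L -> q.1 <= t <= q.2 -> c <= t <= d -> `|G 0%N t| <= eta) ->
  csum len L c d <= B * gam.
Proof.
elim: n => [|n [B B0 IH]].
  exists 0 => // G K c d u gam eta L a b cd _ u0 gam0.
  rewrite expr0 mulr1 mul0r => eu Gu chL Le.
  rewrite /csum; have -> : clip c d L = [::]; last by rewrite big_nil.
  case E : (clip c d L) => [//|q s].
  have [|q0 q0L [h1 h2 h3 h4 h5]] := @mem_clip _ c d L q; first by rewrite E mem_head.
  have cq : c <= q.1 <= d by lra.
  exfalso; have := Le _ q.1 q0L; rewrite h1 (le_trans (ltW h2) h3) => /(_ isT cq).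
  have := Gu _ cq; have := ler_norm (G 0%N q.1); lra.
exists (2 * B + 4) => [|G K c d u gam eta L a b cd Gd u0 gam0 eu Gu chL Le]; first lra.
pose E := [set t | c <= t <= d /\ G n t <= 0].
(* z is the supremum of the points where G n <= 0, or c if there are none. The last clause gives a
   nonpositive value within gam of z, from which the slope yields G n <= - u gam to the left of z -
   2 gam. *)
have [z [zcd zr zl]] : exists z, [/\ c <= z <= d,
    (forall t, c <= t <= d -> z < t -> 0 < G n t) &
    c < z - gam -> exists t, [/\ c <= t <= d, z - gam < t & G n t <= 0]].
  have [[t0 t0E]|E0] := pselect (E !=set0); last first.
    exists c; split; [lra| |lra].
    move=> t tcd _; rewrite ltNge; apply/negP => Gt; apply: E0.
    by exists t.
  have supE : has_sup E by split; [exists t0|exists d => x [xcd _]; lra].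
  exists (sup E); split.
  - have := ub_le_sup (proj2 supE) t0E; case: t0E => t0cd _.
    have : sup E <= d by apply: ge_sup; [exact: (proj1 supE)|move=> x [xcd _]; lra].
    lra.
  - move=> t tcd st; rewrite ltNge; apply/negP => Gt.
    have := ub_le_sup (proj2 supE) (conj tcd Gt : E t); lra.
  - move=> _; have [t [tcd Gt] st] := sup_adherent gam0 supE.
    by exists t.
have Gslope x y : c <= x -> x <= y -> y <= d -> u * (y - x) <= G n y - G n x.
  move=> cx xy yd; apply: (mean_value_ge (a := c) (b := d) (K := K) (g := G n.+1)) => //.
    exact: Gd.
  by move=> t txy; apply: Gu; lra.
pose l := Num.max c (z - 2 * gam); pose r := Num.min d (z + 2 * gam).
have cl : c <= l by rewrite le_max lexx.
have rd : r <= d by rewrite ge_min lexx.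
have lr : l <= r.
  by rewrite /l /r ge_max !le_min; apply/andP; split; apply/andP; split; order_lra.
have rl4 : r - l <= 4 * gam.
  have : r <= z + 2 * gam by rewrite ge_min lexx orbT.
  have : z - 2 * gam <= l by rewrite le_max lexx orbT.
  lra.
have bl : csum len L c l <= B * gam.
  have [lc|cl'] := leP l c; first by rewrite csum_deg// mulr_ge0// ltW.
  have lE : l = z - 2 * gam by move: cl'; rewrite /l; case: (leP c (z - 2 * gam)); order_lra.
  apply: (IH (fun i t => - G i t) K c l (u * gam) gam eta L a b) => //.
  - move=> i ni x y xcl ycl; rewrite -normrN.
    have -> : - (- G i y - - G i x - (y - x) * - G i.+1 x) =
      G i y - G i x - (y - x) * G i.+1 x by ring.
    by apply: Gd; order_lra || (rewrite ltnS ltnW//).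
  - by rewrite mulr_gt0.
  - by rewrite -mulrA -exprS.
  - move=> t tcl; have [|t' [t'cd zt' Gt']] := zl; first order_lra.
    have h1 : u * (t' - t) <= G n t' - G n t by apply: Gslope; order_lra.
    have h2 : u * gam <= u * (t' - t) by rewrite ler_pM2l//; order_lra.
    order_lra.
  - by move=> q t qL tq tcl; rewrite normrN; apply: (Le q) => //; order_lra.
have br : csum len L r d <= B * gam.
  have [dr|rd'] := leP d r; first by rewrite csum_deg// mulr_ge0// ltW.
  have rE : r = z + 2 * gam by move: rd'; rewrite /r; case: (leP d (z + 2 * gam)); order_lra.
  apply: (IH G K r d (u * gam) gam eta L a b) => //.
  - move=> i ni x y xcl ycl.
    by apply: Gd; order_lra || (rewrite ltnS ltnW//).
  - by rewrite mulr_gt0.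
  - by rewrite -mulrA -exprS.
  - move=> t trd; have t'0 : 0 < G n (z + gam) by apply: zr; order_lra.
    have h1 : u * (t - (z + gam)) <= G n t - G n (z + gam) by apply: Gslope; order_lra.
    have h2 : u * gam <= u * (t - (z + gam)) by rewrite ler_pM2l//; order_lra.
    order_lra.
  - by move=> q t qL tq tcl; apply: (Le q) => //; order_lra.
have := csum_len_split L cl (le_trans lr rd).
have := csum_len_split L lr rd.
have := csum_len_le chL lr.
order_lra.
Qed.

(** As F n stays within |w0|/2 of w0, rotating w0 to the positive axis makes its real part at least
    |w0|/2, and the real case applies. *)
Lemma sublevelC n : exists2 B : R, 0 <= B & forall (F : nat -> R -> C) K c d (w0 : C) gam eta L a b,
  c <= d -> (forall l, (l < n)%N -> dq c d K (F l) (F l.+1)) -> w0 != 0 -> 0 < gam ->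
  eta < nm w0 / 2 * gam ^+ n ->
  (forall t, c <= t <= d -> nm (F n t - w0) <= nm w0 / 2) ->
  chain a b L ->
  (forall q t, q \in L -> q.1 <= t <= q.2 -> c <= t <= d -> nm (F 0%N t) <= eta) ->
  csum len L c d <= B * gam.
Proof.
have [B B0 H] := sublevel n; exists B => // F K c d w0 gam eta L a b cd Fd w00 gam0 eu Fn chL Le.
have [w [w1 wE]] := Re_rotate w0.
apply: (H (fun i t => complex.Re (F i t * w)) K c d (nm w0 / 2) gam eta L a b) => //.
- move=> l ln x y xcd ycd.
  have -> : complex.Re (F l y * w) - complex.Re (F l x * w) - (y - x) * complex.Re (F l.+1 x * w)
     = complex.Re ((F l y - F l x - cR (y - x) * F l.+1 x) * w).
    by rewrite -Re_cRM -!ReN -!ReD; congr complex.Re; ring.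
  by apply: le_trans (Re_le_nm _) _; rewrite nmM w1 mulr1; apply: Fd.
- by rewrite divr_gt0// nm_gt0.
- move=> t tcd; have -> : F n t * w = w0 * w + (F n t - w0) * w by ring.
  rewrite ReD wE; have := Fn t tcd; have := Re_le_nm ((F n t - w0) * w).
  by rewrite nmM w1 mulr1 ler_norml => /andP[]; lra.
- move=> q t qL tq tcd; apply: le_trans (Re_le_nm _) _.
  by rewrite nmM w1 mulr1; apply: Le qL _ _.
Qed.

Lemma exists_rootn (x : R) (n : nat) : (0 < n)%N -> 0 < x -> exists2 r : R, 0 < r & r ^+ n = x.
Proof.
move=> n0 x0; exists (x `^ n%:R^-1); first by rewrite powR_gt0.
rewrite -powR_mulrn ?powR_ge0// -powRrM mulVf ?powRr1 ?ltW//.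
by rewrite pnatr_eq0 -lt0n.
Qed.

(** The largest admissible scale. When the next constraint fails, h is shrunk until this constraint
    is an equality, so the final h is h0 or has an active constraint; later sums are sorted by
    it. *)
Lemma exists_scale (s : seq (nat * R)) (h0 : R) : 0 < h0 ->
  (forall p, p \in s -> (0 < p.1)%N /\ 0 <= p.2) ->
  exists h, [/\ 0 < h, h <= h0, forall p, p \in s -> p.2 * h ^+ p.1 <= 1
    & h = h0 \/ exists2 p, p \in s & p.2 * h ^+ p.1 = 1].
Proof.
move=> h00; elim: s => [|p s IH] sP; first by exists h0; split=> //; left.
have [|h [hp hh0 hs hE]] := IH; first by move=> q qs; apply: sP; rewrite inE qs orbT.
have [p10 p20] := sP p (mem_head _ _).
have [ph|ph] := leP (p.2 * h ^+ p.1) 1.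
  exists h; split=> // [q|]; first by rewrite inE => /orP[/eqP ->|/hs].
  by case: hE => [->|[q qs qE]]; [left|right; exists q => //; rewrite inE qs orbT].
have p2gt0 : 0 < p.2.
  by rewrite lt_def p20 andbT; apply: contraTneq ph => ->; rewrite mul0r -leNgt ler01.
have [|h' h'0 h'E] := @exists_rootn p.2^-1 p.1 p10; first by rewrite invr_gt0.
have h'h : h' <= h.
  rewrite leNgt; apply/negP => hh'.
  have : h ^+ p.1 <= h' ^+ p.1 by rewrite lerXn2r ?nnegrE ?ltW.
  by rewrite h'E; move: ph; rewrite -ltr_pdivrMl// mulr1 => /lt_le_trans/[apply]; rewrite ltxx.
exists h'; split=> // [|q|]; first exact: le_trans h'h hh0.
  rewrite inE => /orP[/eqP ->|qs]; first by rewrite h'E divff ?gt_eqF.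
  apply: le_trans (hs _ qs); have [_ q20] : (0 < q.1)%N /\ 0 <= q.2 by apply: sP; rewrite inE qs orbT.
  by rewrite ler_wpM2l// lerXn2r ?nnegrE ?(ltW hp) ?(ltW h'0).
by right; exists p; rewrite ?mem_head// h'E divff ?gt_eqF.
Qed.
End Sublevel.

(** * Weak-type bounds for quotients of jets *)

Section WeakType.
Variable R : realType.
Local Notation C := (Rcomplex R).
Local Notation len := (fun x y : R => y - x).
Implicit Types (a b c d x y t K M : R) (f g : R -> C) (L Q : seq (R * R)).

Lemma geometric_le (x : R) (N : nat) : 0 <= x -> x < 1 -> \sum_(k < N) x ^+ k <= (1 - x)^-1.
Proof.
move=> x0 x1; have h : 0 < 1 - x by lra.
rewrite -[leRHS]mul1r ler_pdivlMr// mulrC.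
have := subrX1 x N; rewrite -[x - 1]opprB mulNr => h1.
have := exprn_ge0 N x0; lra.
Qed.

Lemma layer_cake_pointwise (e : nat) (p s : R) (N : nat) : 0 <= p -> 0 <= s ->
  s <= (2 ^+ N) ^+ e ->
  s `^ p <= 1 + \sum_(k < N) (((2 ^+ k.+1) ^+ e) `^ p * ((2 ^+ k) ^+ e < s)%R%:R).
Proof.
move=> p0 s0; elim: N => [|N IH].
  rewrite expr0 expr1n big_ord0 addr0 => s1.
  have E : (1 : R) `^ p = 1 by rewrite powR1.
  by rewrite -[leRHS]E; apply: ge0_ler_powR; rewrite ?nnegrE.
move=> sN; rewrite big_ord_recr /=.
have pos k : 0 <= ((2 ^+ k.+1) ^+ e) `^ p * ((2 ^+ k) ^+ e < s)%R%:R :> R.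
  by rewrite mulr_ge0 ?powR_ge0// ler0n.
have [h|h] := leP s ((2 ^+ N) ^+ e).
  by apply: le_trans (IH h) _; rewrite addrA lerDl mulr_ge0 ?powR_ge0// ler0n.
rewrite mulr1; apply: (@le_trans _ _ (((2 ^+ N.+1) ^+ e) `^ p)).
  by apply: ge0_ler_powR; rewrite ?nnegrE// ?exprn_ge0.
by rewrite addrA lerDr addr_ge0// sumr_ge0.
Qed.

(** Dyadic levels s ~ 2^(k e) carry mass O(2^(- k (e + 1))), so the sum of w s^p is dominated by a
    geometric series of ratio 2^(e p) / 2^(e + 1), which is below 1 exactly when e p < e + 1. *)
Lemma layer_cake (e : nat) (p A : R) : (0 < e)%N -> 0 <= p -> 0 <= A ->
  e%:R * p < e.+1%:R -> exists2 B : R, 0 <= B & forall (Q : seq (R * R)) (w s : R * R -> R),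
  (forall q, q \in Q -> 0 <= w q) -> (forall q, q \in Q -> 0 <= s q) ->
  (forall tau : R, 1 <= tau -> \sum_(q <- Q | tau ^+ e < s q) w q * tau ^+ e.+1 <= A) ->
  \sum_(q <- Q) w q <= 1 -> \sum_(q <- Q) w q * s q `^ p <= B.
Proof.
move=> e0 p0 A0 ep.
pose g : R := (2 ^+ e) `^ p; pose x : R := g / 2 ^+ e.+1.
have p2 (n : nat) : 0 < 2 ^+ n :> R by rewrite exprn_gt0.
have g0 : 0 <= g by rewrite powR_ge0.
have x0 : 0 <= x by rewrite divr_ge0// ltW.
have x1 : x < 1.
  rewrite ltr_pdivrMr// mul1r /g -!powR_mulrn// -powRrM /powR pnatr_eq0 /=.
  by rewrite ltr_expR ltr_pM2r// ln_gt0// ltr1n.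
exists (1 + A * g * (1 - x)^-1).
  by rewrite addr_ge0// mulr_ge0 ?mulr_ge0// invr_ge0; lra.
move=> Q w s w0 s0 tail sw.
have [N hN] : exists N : nat, forall q, q \in Q -> s q <= (2 ^+ N) ^+ e.
  exists (Num.truncn (\sum_(q <- Q) s q)).+1 => q qQ.
  apply: (@le_trans _ _ (\sum_(q <- Q) s q)).
    rewrite (perm_big _ (perm_to_rem qQ)) /= big_cons lerDl big_seq sumr_ge0// => r rQ.
    by apply: s0; apply: mem_rem rQ.
  apply: le_trans (ltW (truncnS_gt _)) _; set n := (Num.truncn _).+1.
  apply: (@le_trans _ _ (2 ^+ n)); first by rewrite -natrX ler_nat ltnW// ltn_expl.
  by rewrite ler_eXnr// exprn_ege1// ler1n.
apply: (@le_trans _ _ (\sum_(q <- Q) (w q +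
   \sum_(k < N) (w q * (((2 ^+ k.+1) ^+ e) `^ p * ((2 ^+ k) ^+ e < s q)%R%:R))))).
  rewrite big_seq [leRHS]big_seq; apply: ler_sum => q qQ.
  rewrite -mulr_sumr -[X in X + _]mulr1 -mulrDr ler_wpM2l ?w0//.
  by apply: layer_cake_pointwise => //; [exact: s0|exact: hN].
rewrite big_split /= exchange_big /=; apply: lerD => //.
apply: (@le_trans _ _ (\sum_(k < N) A * g * x ^+ k)); last first.
  rewrite -mulr_sumr ler_wpM2l ?mulr_ge0//.
  exact: geometric_le.
apply: ler_sum => k _.
have -> : \sum_(q <- Q) w q * (((2 ^+ k.+1) ^+ e) `^ p * ((2 ^+ k) ^+ e < s q)%R%:R) =
   ((2 ^+ k.+1) ^+ e) `^ p * \sum_(q <- Q | (2 ^+ k) ^+ e < s q) w q.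
  rewrite mulr_sumr [RHS]big_mkcond; apply: eq_bigr => q _.
  by case: ifP => _; rewrite ?mulr1 ?mulr0// mulrC.
have E : ((2 ^+ k.+1) ^+ e) `^ p = g ^+ k.+1 :> R.
  rewrite exprAC /g; elim: k.+1 => [|m IH]; first by rewrite !expr0 powR1.
  by rewrite !exprS powRM ?exprn_ge0// ?ltW// IH.
rewrite E; have := tail (2 ^+ k); rewrite exprn_ege1 ?ler1n// => /(_ isT).
rewrite -mulr_suml -ler_pdivlMr ?exprn_gt0// => H.
apply: le_trans (ler_wpM2l (exprn_ge0 _ g0) H) _.
rewrite le_eqVlt; apply/orP; left; apply/eqP.
by rewrite /x expr_div_n -exprM mulnC exprM exprS; ring.
Qed.

(** v is the size of F i in the unit in which F 0 has degree j and F i degree j - i. The set to be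
    measured is given as a chain, its measure being the sum of the lengths. *)
Definition weak_type (j i : nat) := forall K A, 0 <= K -> 0 <= A ->
  exists2 B : R, 0 <= B & forall a b (F : nat -> R -> C) L theta, b - a <= 1 ->
  jets a b j.-1 K F -> 0 < theta -> chain a b L ->
  (forall q t, q \in L -> q.1 <= t <= q.2 ->
     exists v, [/\ 0 < v, v ^+ (j - i) = nm (F i t) & nm (F 0%N t) * theta ^+ i <= A * v ^+ j]) ->
  (\sum_(q <- L) (q.2 - q.1)) * theta <= B.

(** Where d/h > tau^(j - 1), the relation d^j <= 2 |F i| h^i forces v >= d tau^i / 2, for v = |F
    i|^(1/(j - i)). Then |F 0| theta^i <= 2^(j + 1) v^j with theta = tau^j, so the weak-type bound
    is the tail bound required by [layer_cake] with e = j - 1. *)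
Lemma weak_type_sum (j i : nat) (p K : R) : (0 < i < j)%N -> weak_type j i -> 0 <= p ->
  j.-1%:R * p < j%:R -> 0 <= K ->
  exists2 B : R, 0 <= B & forall a b (F : nat -> R -> C) Q (dd hh : R * R -> R), b - a <= 1 ->
  jets a b j.-1 K F -> chain a b Q ->
  (forall q, q \in Q -> [/\ 0 < dd q, 0 < hh q & forall t, q.1 <= t <= q.2 ->
     nm (F 0%N t) <= 2 * dd q ^+ j /\ dd q ^+ j <= 2 * nm (F i t) * hh q ^+ i]) ->
  \sum_(q <- Q) (q.2 - q.1) * (dd q / hh q) `^ p <= B.
Proof.
move=> /andP[i0 ij] W p0 jp K0.
have A0 : 0 <= 2 ^+ j.+1 :> R by rewrite exprn_ge0.
have [B0 B00 HB0] := W K _ K0 A0.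
have j1 : (0 < j.-1)%N by lia.
have jE : j.-1.+1 = j by lia.
have [|B BB0 HB] := layer_cake j1 p0 B00; first by rewrite jE.
exists B => // a b F Q dd hh ab1 Fj chQ Qd.
apply: (HB Q (fun q => q.2 - q.1) (fun q => dd q / hh q)).
- by move=> q /(chain_mem chQ)[]; lra.
- by move=> q /Qd[d0 h0 _]; rewrite divr_ge0// ltW.
- move=> tau tau1; rewrite -mulr_suml jE -big_filter.
  apply: (HB0 a b F _ _ ab1 Fj); first by rewrite exprn_gt0//; lra.
    exact: chain_filter chQ.
  move=> q t; rewrite mem_filter => /andP[stau qQ] tq.
  have [d0 h0 /(_ t tq)[F0 Fi]] := Qd q qQ.
  have tau0 : 0 < tau by lra.
  have Fi0 : 0 < nm (F i t).
    have : 0 < 2 * nm (F i t) * hh q ^+ i by apply: lt_le_trans Fi; rewrite exprn_gt0.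
    by rewrite pmulr_lgt0 ?exprn_gt0// pmulr_rgt0.
  have ji0 : (0 < j - i)%N by rewrite subn_gt0.
  have [v v0 vE] := exists_rootn ji0 Fi0; exists v; split=> //.
  pose x := dd q * tau ^+ i / 2.
  have x0 : 0 < x by rewrite divr_gt0// mulr_gt0// exprn_gt0.
  have xv : x <= v.
    rewrite -(@ler_pXn2r _ (j - i)) ?nnegrE ?(ltW x0) ?(ltW v0)// vE.
    have e1 : x ^+ (j - i) <= dd q ^+ (j - i) * (tau ^+ (j - i)) ^+ i / 2.
      rewrite /x !exprMn -exprM mulnC exprM.
      rewrite ler_wpM2l ?mulr_ge0 ?exprn_ge0 ?(ltW d0) ?(ltW tau0)//.
      by rewrite ler_iXnr// ?invr_ge0// invf_le1// ler1n.
    have e2 : (tau ^+ (j - i)) ^+ i <= (dd q / hh q) ^+ i.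
      rewrite lerXn2r ?nnegrE ?exprn_ge0 ?divr_ge0 ?ltW//.
      apply: le_lt_trans stau; rewrite ler_weXn2l//.
      by rewrite -subn1 leq_sub2l.
    have e3 : dd q ^+ (j - i) * (dd q / hh q) ^+ i = dd q ^+ j / hh q ^+ i.
      by rewrite expr_div_n mulrA -exprD subnK// ltnW.
    have e4 : dd q ^+ j / hh q ^+ i <= 2 * nm (F i t) by rewrite ler_pdivrMr ?exprn_gt0.
    have e5 : dd q ^+ (j - i) * (tau ^+ (j - i)) ^+ i <= dd q ^+ (j - i) * (dd q / hh q) ^+ i.
      by rewrite ler_wpM2l// exprn_ge0// ltW.
    by rewrite e3 in e5; lra.
  have e6 : x ^+ j <= v ^+ j by rewrite lerXn2r ?nnegrE ?(ltW x0) ?(ltW v0).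
  apply: le_trans (ler_wpM2l A0 e6).
  apply: (@le_trans _ _ (2 * dd q ^+ j * (tau ^+ j) ^+ i)).
    by rewrite ler_wpM2r// exprn_ge0// exprn_ge0// ltW.
  rewrite /x !exprMn -!exprM (mulnC j i) exprS exprVn.
  have h2 : 2 ^+ j != 0 :> R by rewrite expf_neq0.
  by rewrite le_eqVlt; apply/orP; left; apply/eqP; field.
- by apply: le_trans (chain_tot chQ) _.
Qed.


Lemma sum_cover (Q : seq (R * R)) (w : R * R -> R) (n : nat) (P : nat -> R * R -> bool) :
  (forall q, q \in Q -> 0 <= w q) ->
  (forall q, q \in Q -> exists2 l, (l < n)%N & P l q) ->
  \sum_(q <- Q) w q <= \sum_(l < n) \sum_(q <- Q | P l q) w q.
Proof.
move=> w0 cov.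
under [leRHS]eq_bigr do rewrite big_mkcond.
rewrite exchange_big /= big_seq [leRHS]big_seq; apply: ler_sum => q qQ.
have [l ln Pl] := cov q qQ.
rewrite (bigD1 (Ordinal ln)) //= Pl lerDl; apply: sumr_ge0 => i _.
by case: ifP => // _; exact: w0.
Qed.

Lemma lip_min c d K f : c <= d -> lip c d K f -> (forall t, c <= t <= d -> 0 < nm (f t)) ->
  exists2 m : R, 0 < m & forall t, c <= t <= d -> m <= nm (f t).
Proof.
move=> cd fl f0.
have [|t tcd tmin] := @EVT_min R (fun t => nm (f t)) c d cd.
  apply/subspace_continuousP => x /= xcd; apply/cvgrPdist_le => e e0.
  have K0 : 0 < 1 + `|K| by have := normr_ge0 K; lra.
  have d0 : 0 < e / (1 + `|K|) by rewrite divr_gt0.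
  have N : \forall t \near nbhs x, `|x - t| <= e / (1 + `|K|).
    exact: (@cvgr_dist_le _ _ _ (nbhs x) _ id x cvg_id _ d0).
  move: N; apply: filterS => t /= xt tcd.
  rewrite in_itv /= in xcd; rewrite in_itv /= in tcd.
  apply: (@le_trans _ _ (nm (f x - f t))); first exact: ler_dist_dist.
  apply: le_trans (fl _ _ tcd xcd) _.
  apply: (@le_trans _ _ ((1 + `|K|) * `|x - t|)).
    by rewrite ler_wpM2r//; have := ler_norm K; lra.
  by rewrite mulrC -ler_pdivlMr.
exists (nm (f t)); first by apply: f0; rewrite in_itv in tcd.
by move=> u ucd; apply: tmin; rewrite in_itv.
Qed.

(** A compactness bound that guarantees the termination of the bisection in [whitney]; m enters none
    of the final constants. *)
Lemma lip_min_seq a b K f L : lip a b K f -> chain a b L ->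
  (forall q t, q \in L -> q.1 <= t <= q.2 -> 0 < nm (f t)) ->
  exists2 m : R, 0 < m & forall q t, q \in L -> q.1 <= t <= q.2 -> m <= nm (f t).
Proof.
move=> fl; elim: L a fl => [|q L IH] a fl /= ; first by exists 1.
case/and3P=> aq q12 ch f0.
have qb := chain_le ch.
have [||m m0 mL] := IH q.2 _ ch.
- by move=> x y xab yab; apply: fl; lra.
- by move=> r t rL; apply: f0; rewrite inE rL orbT.
have [||m' m'0 m'q] := @lip_min q.1 q.2 K f (ltW q12).
- by move=> x y xab yab; apply: fl; lra.
- by move=> t; apply: f0; rewrite mem_head.
exists (Num.min m m'); first by rewrite lt_min m0.
move=> r t; rewrite inE => /orP[/eqP -> /m'q|rL /(mL r t rL)] h; rewrite ge_min h ?orbT//.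
Qed.

End WeakType.

(** * Induction proving the weak-type bounds *)

Section WeakTypeInduction.
Variable R : realType.
Local Notation C := (Rcomplex R).
Local Notation len := (fun x y : R => y - x).
Implicit Types (a b c d x y t K M : R) (f g : R -> C) (L Q : seq (R * R)).

(** Strong induction on j. On Whitney intervals adapted to F i, the function F i is nearly constant
    of modulus v^(j - i), and [sublevelC] bounds the part of [L] in the interval by O(v / theta). It
    remains to bound the sum of v, that is of |Q| v / h. This is the case p = 1 of [weak_type_sum]
    for F i with index j - i < j. *)
Lemma weak_typeP j i : (0 < i < j)%N -> weak_type R j i.
Proof.
elim/ltn_ind: j i => j IH i /andP[i0 ij] K A K0 A0.
set j1 := (j - i)%N.
have j10 : (0 < j1)%N by rewrite subn_gt0.
have j1j : (j1 < j)%N by rewrite ltn_subrL i0 (leq_trans _ ij).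
have ij1 : (j.-1 = i + j1.-1)%N by rewrite /j1; lia.
have lj1 l : (l < j1)%N -> (l <= j1.-1)%N by rewrite -{1}(prednK j10) ltnS.
have ilt l : (l < i)%N -> (l < j.-1)%N.
  by move=> li; apply: leq_trans li _; rewrite ij1 leq_addr.
have [B1 B10 sub] := sublevelC R i.
have /choice[Bf HBf] : forall l : nat, exists Bl : R, 0 <= Bl /\ ((0 < l < j1)%N ->
   forall a b (F : nat -> R -> C) Q (dd hh : R * R -> R), b - a <= 1 ->
  jets a b j1.-1 K F -> chain a b Q ->
  (forall q, q \in Q -> [/\ 0 < dd q, 0 < hh q & forall t, q.1 <= t <= q.2 ->
     nm (F 0%N t) <= 2 * dd q ^+ j1 /\ dd q ^+ j1 <= 2 * nm (F l t) * hh q ^+ l]) ->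
  \sum_(q <- Q) (q.2 - q.1) * (dd q / hh q) `^ 1 <= Bl).
  move=> l; have [lj|nlj] := boolP (0 < l < j1)%N; last by exists 0; split.
  have [|B B0 HB] := @weak_type_sum R j1 l 1 K lj (IH _ j1j _ lj) ler01 _ K0.
    by rewrite mulr1 ltr_nat prednK.
  by exists B; split.
pose B2 := \sum_(l < j1) Bf l.
have B20 : 0 <= B2 by apply: sumr_ge0 => l _; case: (HBf l).
have BfB l : (l < j1)%N -> Bf l <= B2.
  move=> lj; rewrite /B2 (bigD1 (Ordinal lj)) //= lerDl; apply: sumr_ge0 => k _.
  by case: (HBf k).
pose K' := 1 + K + j1.-1%:R.
have K'0 : 0 < K' by have := ler0n R j1.-1; rewrite /K'; order_lra.
(* On an interval of length c1 h, the quantity F (i + l) h^l then varies by at most v^j1 / 2, by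
   [jets_local]. *)
pose c1 := (2 * K')^-1.
have c10 : 0 < c1 by rewrite invr_gt0; order_lra.
have c1K : K' * c1 = 2^-1 by rewrite /c1; field; rewrite gt_eqF.
have c1le1 : c1 <= 1.
  by rewrite invf_le1; have := ler0n R j1.-1; rewrite /K'; order_lra.
have A2j : 0 <= 2 * A * 2 ^+ j by rewrite !mulr_ge0// exprn_ge0.
(* Chosen so that gam = A2 v / theta satisfies the strict inequality required by [sublevelC]: A (2
   v)^j / theta^i < (v^j1 / 2) gam^i. *)
have [A2 A21 A2E] : exists2 A2 : R, 1 <= A2 & 2 * A * 2 ^+ j < A2.
  by exists (2 * A * 2 ^+ j + 1); order_lra.
(* Bound for the sum of v: 1 + K if the whole interval is not divided, otherwise 1 for the intervals
   with h = v and B2 for each possible active constraint. *)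
pose S := (1 + K) + 2 / c1 * (1 + j1%:R * B2).
have S0 : 0 <= S.
  by rewrite /S addr_ge0 ?mulr_ge0 ?invr_ge0 ?addr_ge0 ?mulr_ge0//; order_lra.
exists (B1 * A2 * S); first by rewrite !mulr_ge0//; order_lra.
move=> a b F L theta ab1 Fj th0 chL LP.
have [ba|ab] := leP b a.
  apply: (@le_trans _ _ 0); last by rewrite !mulr_ge0//; order_lra.
  by rewrite pmulr_lle0//; have := chain_tot chL; order_lra.
have F'j : jets a b j1.-1 K (fun l => F (i + l)%N) by apply: jets_shift; rewrite -ij1.
have Fil : lip a b (2 * K) (F i) by apply: jets_lip ab1 Fj _; rewrite ij1 leq_addr.
have [m m0 mL] : exists2 m : R, 0 < m & forall q t, q \in L -> q.1 <= t <= q.2 -> m <= nm (F i t).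
  apply: lip_min_seq Fil chL _ => q t qL tq.
  by have [v [v0 <- _]] := LP q t qL tq; rewrite exprn_gt0.
(* The admissible scale of F i at t0: the largest h <= v at which its derivatives do not dominate
   its value. The last clause records what limits h. *)
pose SC t0 h v := [/\ a <= t0 <= b, 0 < h /\ h <= v, v ^+ j1 = nm (F i t0),
  forall l, (0 < l < j1)%N -> nm (F (i + l)%N t0) * h ^+ l <= v ^+ j1
  & h = v \/ exists2 l, (0 < l < j1)%N & nm (F (i + l)%N t0) * h ^+ l = v ^+ j1].
have SCex t0 v : a <= t0 <= b -> 0 < v -> v ^+ j1 = nm (F i t0) -> exists h, SC t0 h v.
  move=> t0ab v0 vE; have vj0 : 0 < v ^+ j1 by rewrite exprn_gt0.
  have [|h [h0 hv hs hE]] := @exists_scale R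
     [seq (l, nm (F (i + l)%N t0) / v ^+ j1) | l <- iota 1 j1.-1] v v0.
    move=> p /mapP[l]; rewrite mem_iota => /andP[l1 _] -> /=; split=> //.
    by rewrite divr_ge0 ?nm_ge0// ltW.
  exists h; split=> // [l /andP[l0 lj]|].
    have := hs (l, nm (F (i + l)%N t0) / v ^+ j1); rewrite /= mulrAC ler_pdivrMr// mul1r.
    by apply; apply/mapP; exists l => //; rewrite mem_iota l0 add1n prednK.
  case: hE => [->|[p /mapP[l ls ->] /= hE]]; [by left|right; exists l].
    by move: ls; rewrite mem_iota add1n prednK.
  by move: hE; rewrite mulrAC => /(canRL (mulfVK _)); rewrite mul1r => ->//; rewrite gt_eqF.
(* A lower bound for the scale wherever |F i| >= m; intervals meeting [L] are therefore stopped
   after finitely many bisections. *)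
pose dl := Num.min 1 (m / (1 + K)).
have dl0 : 0 < dl by rewrite lt_min ltr01 divr_gt0//; order_lra.
have SClow t0 h v : SC t0 h v -> m <= nm (F i t0) -> dl <= h.
  move=> [t0ab [h0 hv] vE hs hE] mF.
  have [h1|h1] := leP 1 h; first by rewrite ge_min h1.
  rewrite ge_min; apply/orP; right; rewrite ler_pdivrMr; last order_lra.
  case: hE => [hE|[l /andP[l0 lj] hE]].
    have : v ^+ j1 <= v by rewrite ler_iXnr// -hE ltW.
    have : 0 <= v * K by rewrite mulr_ge0// -hE ltW.
    by rewrite hE; order_lra.
  have : h ^+ l <= h by rewrite ler_iXnr// ltW.
  have Fb : nm (F (i + l)%N t0) <= K.
    by case: Fj => Fb _ _; apply: Fb => //; rewrite ij1 leq_add2l lj1.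
  have : nm (F (i + l)%N t0) * h ^+ l <= K * h ^+ l.
    by rewrite ler_wpM2r// exprn_ge0// ltW.
  have : K * h ^+ l <= K * h by rewrite ler_wpM2l// ler_iXnr// ltW.
  by rewrite hE vE; order_lra.
pose stop c d := exists t0 h v, [/\ c <= t0 <= d, SC t0 h v & d - c <= c1 * h].
have [||Q [chQ Qst Qpar QW]] := @whitney R stop (fun c d => clip c d L = [::]) (c1 * dl) a b _ ab.
- by rewrite mulr_gt0.
- move=> c d ac cd db dcd.
  case E : (clip c d L) => [|q s]; [by right|left].
  have [|q0 q0L [h1 h2 h3 h4 h5]] := @mem_clip _ c d L q; first by rewrite E mem_head.
  have tq : q0.1 <= q.1 <= q0.2 by rewrite h1 (le_trans (ltW h2) h3).
  have [v [v0 vE _]] := LP q0 q.1 q0L tq.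
  have [|h hSC] := SCex q.1 v _ v0 vE; first order_lra.
  exists q.1, h, v; split=> //; first order_lra.
  by apply: le_trans dcd _; rewrite ler_pM2l//; apply: (SClow _ _ v hSC); exact: mL tq.
have [tt [hh [vv HQ]]] : exists tt hh vv : R * R -> R, forall q, q \in Q ->
   [/\ q.1 <= tt q <= q.2, SC (tt q) (hh q) (vv q) & q.2 - q.1 <= c1 * hh q].
  have : forall q, exists thv : R * R * R, q \in Q ->
     [/\ q.1 <= thv.1.1 <= q.2, SC thv.1.1 thv.1.2 thv.2 & q.2 - q.1 <= c1 * thv.1.2].
    move=> q; have [qQ|nqQ] := boolP (q \in Q); last by exists (0, 0, 0).
    by have [t0 [h [v H]]] := Qst q qQ; exists (t0, h, v).
  move=> /choice[f Hf]; exists (fun q => (f q).1.1), (fun q => (f q).1.2), (fun q => (f q).2).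
  by move=> q /Hf.
have loc q : q \in Q -> forall l t, (l < j1)%N -> q.1 <= t <= q.2 ->
   nm (F (i + l)%N t - F (i + l)%N (tt q)) * hh q ^+ l <= vv q ^+ j1 / 2.
  move=> qQ l t lj tq; have [ttq [t0ab [h0 hv] vE hs _] qh] := HQ q qQ.
  have [aq _ qb] := chain_mem chQ qQ.
  have tab : a <= t <= b by order_lra.
  have v0 : 0 < vv q by apply: lt_le_trans hv.
  have vj0 : 0 <= vv q ^+ j1 by rewrite exprn_ge0// ltW.
  have hhv : hh q ^+ j1.-1.+1 <= vv q ^+ j1.
    by rewrite prednK// lerXn2r ?nnegrE ?(ltW h0) ?(ltW v0).
  have tth : `|t - tt q| <= c1 * hh q by rewrite ler_norml; order_lra.
  have c1h : c1 * hh q <= hh q by rewrite ler_piMl// ltW.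
  have [||_ /(_ l)] := jets_local K0 F'j t0ab h0 vj0 hhv _ tab t0ab (le_trans tth c1h).
  - by move=> k k0 kj; apply: hs; rewrite k0 /= -(prednK j10) ltnS.
  - by rewrite subrr normr0 ltW.
  move=> H; have {}H := H (lj1 _ lj); rewrite -(ler_pM2r h0) -mulrA -exprSr.
  apply: le_trans H _.
  apply: (@le_trans _ _ (K' * vv q ^+ j1 * (c1 * hh q))).
    by rewrite ler_wpM2l// mulr_ge0// ltW.
  have -> : K' * vv q ^+ j1 * (c1 * hh q) = (K' * c1) * vv q ^+ j1 * hh q by ring.
  by rewrite c1K; order_lra.
have vK q : q \in Q -> vv q <= 1 + K.
  move=> qQ; have [_ [t0ab [h0 hv] vE _ _] _] := HQ q qQ.
  have : nm (F i (tt q)) <= K by case: Fj => Fb _ _; apply: Fb => //; rewrite ij1 leq_addr.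
  rewrite -vE => H; have [v1|v1] := leP (vv q) 1; first order_lra.
  have : vv q <= vv q ^+ j1 by rewrite ler_eXnr// ltW.
  order_lra.
have WQ q : q \in Q -> csum len L q.1 q.2 <= B1 * A2 / theta * vv q.
  move=> qQ; have [ttq [t0ab [h0 hv] vE hs _] qh] := HQ q qQ.
  have [aq q12 qb] := chain_mem chQ qQ.
  have v0 : 0 < vv q by apply: lt_le_trans hv.
  have thi0 : 0 < theta ^+ i by rewrite exprn_gt0.
  have -> : B1 * A2 / theta * vv q = B1 * (A2 * vv q / theta) by ring.
  apply: (sub F K q.1 q.2 (F i (tt q)) _ (A * (2 * vv q) ^+ j / theta ^+ i) L a b) => //.
  - exact: ltW.
  - case: Fj => _ Fd _ l li x y xq yq; apply: Fd (ilt _ li) _ _ _ _; order_lra.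
  - by rewrite -nm_gt0 -vE exprn_gt0.
  - by rewrite divr_gt0// mulr_gt0//; order_lra.
  - rewrite -vE.
    have -> : vv q ^+ j1 / 2 * (A2 * vv q / theta) ^+ i =
      vv q ^+ j1 / 2 * (A2 ^+ i * vv q ^+ i) / theta ^+ i.
      by rewrite expr_div_n exprMn !mulrA.
    rewrite exprMn ltr_pM2r ?invr_gt0//.
    have -> : vv q ^+ j1 / 2 * (A2 ^+ i * vv q ^+ i) = A2 ^+ i * vv q ^+ j / 2.
      by rewrite -(subnK (ltnW ij)) exprD -/j1; ring.
    have hv0 : 0 < vv q ^+ j by rewrite exprn_gt0.
    have A2i : A2 <= A2 ^+ i by rewrite ler_eXnr.
    have : 2 * A * 2 ^+ j * vv q ^+ j < A2 ^+ i * vv q ^+ j.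
      by rewrite (ltr_pM2r hv0); apply: lt_le_trans A2E A2i.
    by order_lra.
  - move=> t tq; have := loc q qQ 0%N t j10 tq; rewrite addn0 expr0 mulr1 vE.
    by [].
  - move=> p t pL tp tq; have [v [v0' vtE Ht]] := LP p t pL tp.
    rewrite ler_pdivlMr//; apply: le_trans Ht _; rewrite ler_wpM2l//.
    rewrite lerXn2r ?nnegrE ?(ltW v0')//; first by rewrite mulr_ge0// ltW.
    rewrite -(@ler_pXn2r _ j1) ?nnegrE ?(ltW v0') ?mulr_ge0 ?(ltW v0)//.
    rewrite vtE exprMn; have := loc q qQ 0%N t j10 tq; rewrite addn0 expr0 mulr1 => h1.
    have h2 : nm (F i t) <= nm (F i t - F i (tt q)) + nm (F i (tt q)).
      by rewrite -[X in nm X <= _](subrK (F i (tt q))) nmD.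
    rewrite -vE in h2.
    have : 2 * vv q ^+ j1 <= 2 ^+ j1 * vv q ^+ j1.
      by rewrite ler_wpM2r ?exprn_ge0 ?(ltW v0)// ler_eXnr// ler1n.
    have : 0 <= vv q ^+ j1 by rewrite exprn_ge0// ltW.
    by order_lra.
have len0 q : q \in Q -> 0 <= q.2 - q.1 by move=> /(chain_mem chQ)[]; order_lra.
have Sv : \sum_(q <- Q) vv q <= S.
  case: Qpar => [QE|Qpar].
    rewrite QE big_seq1; apply: le_trans (vK _ _) _; first by rewrite QE mem_head.
    rewrite /S lerDl mulr_ge0 ?divr_ge0 ?addr_ge0 ?mulr_ge0//; order_lra.
  (* The parent of q is not stopped, so its length exceeds c1 h and h <= (2 / c1) |q|; then v = h (v
     / h). *)
  have vle q : q \in Q -> vv q <= 2 / c1 * ((q.2 - q.1) * (vv q / hh q) `^ 1).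
    move=> qQ; have [ttq hSC qh] := HQ q qQ.
    have [c [d [cq qd cdE nst]]] := Qpar q qQ.
    have ch : c1 * hh q < d - c.
      rewrite ltNge; apply/negP => H; apply: nst; exists (tt q), (hh q), (vv q).
      by split=> //; order_lra.
    case: hSC => _ [h0 hv] _ _ _; have v0 : 0 < vv q by apply: lt_le_trans hv.
    rewrite powRr1; last by rewrite divr_ge0// ltW.
    have h1 : hh q <= 2 / c1 * (q.2 - q.1).
      by rewrite mulrAC ler_pdivlMr//; order_lra.
    have h2 : 0 <= vv q / hh q by rewrite divr_ge0// ltW.
    have := ler_wpM2r h2 h1; have -> : hh q * (vv q / hh q) = vv q; last by rewrite !mulrA.
    by rewrite mulrC divfK// gt_eqF.
  rewrite big_seq; apply: le_trans (ler_sum _ vle) _; rewrite -big_seq -mulr_sumr.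
  rewrite /S; apply: (@le_trans _ _ (2 / c1 * (1 + j1%:R * B2))); last order_lra.
  rewrite ler_wpM2l ?divr_ge0 ?(ltW c10)//.
  (* Intervals are sorted by the constraint that limits their scale, with l = 0 standing for h =
     v. *)
  pose P l q := if l == 0%N then hh q == vv q else nm (F (i + l)%N (tt q)) * hh q ^+ l == vv q ^+ j1.
  apply: le_trans (sum_cover (n := j1) (P := P) _ _) _.
  - by move=> q qQ; rewrite mulr_ge0 ?len0// powR_ge0.
  - move=> q qQ; have [_ [_ _ _ _ [hE|[l /andP[l0 lj] hE]]] _] := HQ q qQ.
      by exists 0%N => //; rewrite /P /= hE.
    by exists l => //; rewrite /P gtn_eqF// hE.
  apply: (@le_trans _ _ (\sum_(l < j1) ((l == 0%N :> nat)%:R + B2))).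
    apply: ler_sum => l _; have [l0|l0] := eqVneq (l : nat) 0%N.
      rewrite (eq_bigl (fun q => hh q == vv q)); last by move=> q; rewrite /P l0.
      apply: (@le_trans _ _ 1); last by rewrite lerDl.
      apply: (@le_trans _ _ (\sum_(q <- Q) (q.2 - q.1))).
        rewrite big_seq_cond big_mkcondr /= [leRHS]big_seq; apply: ler_sum => q qQ.
        case: eqP => [hE|_]; last exact: len0.
        have [_ [_ [h0 _] _ _ _] _] := HQ q qQ.
        by rewrite hE divff ?powR1 ?mulr1// -hE gt_eqF.
      by apply: le_trans (chain_tot chQ) _.
    rewrite (eq_bigl (fun q => nm (F (i + l)%N (tt q)) * hh q ^+ l == vv q ^+ j1)); last first.
      by move=> q; rewrite /P (negbTE l0).
    rewrite add0r; apply: le_trans (BfB l (ltn_ord l)).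
    have l0j : (0 < l < j1)%N by rewrite lt0n l0 ltn_ord.
    have [_ /(_ l0j) H] := HBf l.
    rewrite -big_filter; apply: (H a b _ _ vv hh ab1 F'j (chain_filter _ chQ)).
    move=> q; rewrite mem_filter => /andP[/eqP hE qQ].
    have [_ [_ [h0 hv] vE _ _] _] := HQ q qQ.
    have v0 : 0 < vv q by apply: lt_le_trans hv.
    split=> // t tq; split.
      have := loc q qQ 0%N t j10 tq; rewrite addn0 expr0 mulr1 => h1.
      have h2 : nm (F i t) <= nm (F i t - F i (tt q)) + nm (F i (tt q)).
        by rewrite -[X in nm X <= _](subrK (F i (tt q))) nmD.
      rewrite -vE in h2.
      have : 0 <= vv q ^+ j1 by rewrite exprn_ge0// ltW.
      by order_lra.
    have h1 := loc q qQ l t (ltn_ord l) tq.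
    have h2 : nm (F (i + l)%N (tt q)) <= nm (F (i + l)%N t - F (i + l)%N (tt q)) + nm (F (i + l)%N t).
      rewrite nm_distC -[X in nm X <= _](subrK (F (i + l)%N t)); exact: nmD.
    have := ler_wpM2r (exprn_ge0 l (ltW h0)) h2; rewrite hE mulrDl.
    by order_lra.
  rewrite big_split /= sumr_const card_ord -[B2 *+ j1]mulr_natl lerD2r.
  rewrite (bigD1 (Ordinal j10)) //= big1 ?addr0// => l.
  by rewrite -val_eqE /= => /negbTE ->.
have LE : \sum_(q <- L) (q.2 - q.1) = csum len L a b by rewrite /csum (clip_id chL).
rewrite LE -ler_pdivlMr//.
apply: le_trans (QW (csum len L) _ _) _.
- by move=> c d e cd de; exact: csum_len_split.
- by move=> c d cd; rewrite /csum => ->; rewrite big_nil.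
rewrite big_seq; apply: le_trans (ler_sum _ WQ) _; rewrite -big_seq -mulr_sumr.
have -> : B1 * A2 * S / theta = B1 * A2 / theta * S by ring.
by rewrite ler_wpM2l// divr_ge0 ?mulr_ge0//; order_lra.
Qed.
End WeakTypeInduction.

(** * Centering a cluster of roots *)

Section Centering.
Variable R : realType.
Local Notation C := (Rcomplex R).
Implicit Types (a b x y t K M : R) (f g : R -> C).

Lemma nm_exp_le1 (x : C) i : nm x <= 1 -> nm (x ^+ i) <= 1.
Proof. by move=> x1; rewrite nmX exprn_ile1// nm_ge0. Qed.

Lemma nm_diff_exp (x y : C) i : nm x <= 1 -> nm y <= 1 ->
  nm (y ^+ i - x ^+ i) <= i%:R * nm (y - x).
Proof.
move=> x1 y1; elim: i => [|i IH]; first by rewrite !expr0 subrr nm0 mul0r.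
have -> : y ^+ i.+1 - x ^+ i.+1 = y * (y ^+ i - x ^+ i) + (y - x) * x ^+ i.
  by rewrite !exprS; ring.
apply: le_trans (nmD _ _) _; rewrite !nmM -natr1 mulrDl mul1r.
have h1 : nm y * nm (y ^+ i - x ^+ i) <= nm (y ^+ i - x ^+ i) by rewrite ler_piMl ?nm_ge0.
have h2 : nm (y - x) * nm (x ^+ i) <= nm (y - x).
  by rewrite ler_piMr ?nm_ge0// nm_exp_le1.
lra.
Qed.

Lemma nm_diff_exp2 (x y : C) i : nm x <= 1 -> nm y <= 1 ->
  nm (y ^+ i - x ^+ i - i%:R * x ^+ i.-1 * (y - x)) <= i%:R ^+ 2 * nm (y - x) ^+ 2.
Proof.
move=> x1 y1; elim: i => [|i IH].
  by rewrite !expr0 subrr !mul0r subrr nm0 expr0n mul0r.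
have E : i%:R * x ^+ i.-1 * x = i%:R * x ^+ i.
  by case: i {IH} => [|i]; rewrite ?mul0r// -mulrA -exprSr.
have -> : y ^+ i.+1 - x ^+ i.+1 - i.+1%:R * x ^+ i * (y - x) =
   y * (y ^+ i - x ^+ i - i%:R * x ^+ i.-1 * (y - x)) + i%:R * x ^+ i.-1 * (y - x) ^+ 2.
  transitivity (y * (y ^+ i - x ^+ i - i%:R * x ^+ i.-1 * (y - x))
    + (y - x) * (i%:R * x ^+ i.-1 * y - i%:R * x ^+ i)).
    by rewrite -natr1 !exprS; ring.
  by rewrite -E; ring.
apply: le_trans (nmD _ _) _.
have -> : nm (i%:R * x ^+ i.-1 * (y - x) ^+ 2) =
  nm i%:R * nm (x ^+ i.-1) * nm (y - x) ^+ 2 by rewrite nmM [nm (_ ^+ 2)]nmX nmM.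
rewrite nmM; set D := y ^+ i - x ^+ i - _ in IH *.
have h1 : nm y * nm D <= nm D by rewrite ler_piMl ?nm_ge0.
have h2 : nm i%:R * nm (x ^+ i.-1) * nm (y - x) ^+ 2 <= i%:R * nm (y - x) ^+ 2.
  rewrite ler_wpM2r ?sqr_ge0// nm_nat ler_piMr//; exact: nm_exp_le1.
have h3 : 0 <= nm (y - x) ^+ 2 by rewrite sqr_ge0.
have h4 : 0 <= i%:R * nm (y - x) ^+ 2 by rewrite mulr_ge0.
by rewrite -natr1; lra.
Qed.

(** The right-hand side contracts in mu with factor 1/2, so the increment of mu is at most twice the
    one caused by the phi i. *)
Lemma implicit_lip n K a b (phi : nat -> R -> C) (mu : R -> C) : b - a <= 1 ->
  (forall i, (i < n)%N -> lip a b K (phi i)) ->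
  bdd a b 1 mu -> (forall t, a <= t <= b -> mu t = \sum_(i < n) phi i t * mu t ^+ i) ->
  (forall t, a <= t <= b -> \sum_(i < n) i%:R * nm (phi i t) <= 2^-1) ->
  lip a b (2 * n%:R * K) mu.
Proof.
move=> ab1 phil mub muE phis x y xab yab.
have -> : mu y - mu x = \sum_(i < n) ((phi i y - phi i x) * mu y ^+ i +
    phi i x * (mu y ^+ i - mu x ^+ i)).
  by rewrite {1}(muE y yab) {1}(muE x xab) -sumrB; apply: eq_bigr => i _; ring.
set D := nm _; have DE : D = nm (mu y - mu x).
  rewrite /D; congr nm; rewrite [RHS](_ : _ = \sum_(i < n) (phi i y * mu y ^+ i - phi i x * mu x ^+ i)).
    by apply: eq_bigr => i _; ring.
  by rewrite sumrB -muE// -muE.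
have h : D <= \sum_(i < n) (K * `|y - x| + (i%:R * nm (phi i x)) * D).
  rewrite {1}/D; apply: le_trans (nm_sum _ _ _) _; apply: ler_sum => i _.
  apply: le_trans (nmD _ _) _; rewrite !nmM; apply: lerD.
    have e1 := phil i (ltn_ord i) x y xab yab.
    have e2 : nm (phi i y - phi i x) * nm (mu y ^+ i) <= nm (phi i y - phi i x).
      by rewrite ler_piMr ?nm_ge0// nm_exp_le1// mub.
    lra.
  have e3 := nm_diff_exp i (mub x xab) (mub y yab); rewrite -DE in e3.
  have := ler_wpM2l (nm_ge0 (phi i x)) e3; lra.
rewrite big_split /= sumr_const card_ord -mulr_suml -mulr_natl in h.
have D0 : 0 <= D by exact: nm_ge0.
have := ler_wpM2r D0 (phis x xab); lra.
Qed.

(** Implicit differentiation: mu' = Nm / Dn with Nm the sum of phi_i' mu^i and Dn = 1 minus the sum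
    of i phi_i mu^(i-1), of modulus at least 1/2. Regularity of mu at order k makes Nm / Dn regular
    at order k, hence mu at order k + 1. *)
Lemma Reg_implicit n k K : 0 <= K -> exists2 M, 0 <= M & forall a b (phi : nat -> R -> C) mu,
  b - a <= 1 -> (forall i, (i < n)%N -> Reg a b k K (phi i)) -> bdd a b 1 mu ->
  (forall t, a <= t <= b -> mu t = \sum_(i < n) phi i t * mu t ^+ i) ->
  (forall t, a <= t <= b -> \sum_(i < n) i%:R * nm (phi i t) <= 2^-1) ->
  Reg a b k M mu.
Proof.
elim: k K => [|k IH] K K0.
  exists (1 + 2 * n%:R * K); first by rewrite addr_ge0 ?mulr_ge0.
  move=> a b phi mu ab1 phiR mub muE phis; split.
    move=> x /mub h; have h0 : 0 <= 2 * n%:R * K by rewrite !mulr_ge0.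
    lra.
  have := implicit_lip ab1 (fun i ni => proj2 (phiR i ni)) mub muE phis.
  by move=> H x y xab yab; apply: le_trans (H x y xab yab) _; rewrite ler_wpM2r// lerDr.
have K20 : 0 <= 2 * K by lra.
have [M M0 HM] := IH _ K20.
have expC i : exists Mi : R, 0 <= Mi /\ forall a b f, b - a <= 1 ->
    Reg a b k M f -> Reg a b k Mi (fun t => f t ^+ i).
  by have [Mi Mi0 H] := Reg_exp k i M0; exists Mi.
have [Me HMe] := choice expC.
pose M1 := \sum_(i < n.+1) Me i.
have Me0 i : 0 <= Me i by case: (HMe i).
have M10 : 0 <= M1 by apply: sumr_ge0.
have expR i a b f : (i < n.+1)%N -> b - a <= 1 -> Reg a b k M f -> Reg a b k M1 (fun t => f t ^+ i).
  move=> ni ab1 fR; have [_ /(_ a b f ab1 fR)] := HMe i; apply: Reg_mono.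
  by rewrite /M1 (bigD1 (Ordinal ni)) //= lerDl; apply: sumr_ge0.
have [M2 M20 HM2] := Reg_mul k K20 M10.
have nM20 : 0 <= n%:R * M2 by rewrite mulr_ge0.
have [M3 M30 HM3] := Reg_mul k (ler0n R n) M20.
have nM30 : 0 <= 1 + n%:R * M3 by rewrite addr_ge0 ?mulr_ge0.
have [M4 M40 HM4] := @Reg_inv R k _ 2^-1 nM30 (ltac:(by rewrite invr_gt0)).
have [M5 M50 HM5] := Reg_mul k nM20 M40.
pose Lc := 2 * n%:R * (2 * K).
have Lc0 : 0 <= Lc by rewrite !mulr_ge0.
pose N := 2 * (n%:R * (K + 2 * K * (n%:R * Lc) + K * (n%:R ^+ 2 * Lc ^+ 2))).
have N0 : 0 <= N by rewrite !mulr_ge0 ?addr_ge0 ?mulr_ge0 ?exprn_ge0.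
exists (1 + M5 + N); first by lra.
move=> a b phi mu ab1 phiR mub muE phis.
have phik i : (i < n)%N -> Reg a b k (2 * K) (phi i) by move=> ni; exact: Reg_le (phiR i ni).
have muR := HM a b phi mu ab1 phik mub muE phis.
have phil i : (i < n)%N -> lip a b (2 * K) (phi i) by move=> ni; apply: Reg_lip ab1 (phiR i ni).
have mul := implicit_lip ab1 phil mub muE phis; rewrite -/Lc in mul.
have /choice[psi Hpsi] : forall i, exists g, (i < n)%N -> Reg a b k K g /\ dq a b K (phi i) g.
  move=> i; have [ni|ni] := boolP (i < n)%N; last by exists (fun=> 0).
  by case: (phiR i ni) => _ [g gR gd]; exists g.
pose Nm t := \sum_(i < n) psi i t * mu t ^+ i.
pose Dn t := 1 + - \sum_(i < n) (i%:R * (phi i t * mu t ^+ i.-1)).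
have Dn2 t : a <= t <= b -> 2^-1 <= nm (Dn t).
  move=> tab; have h1 : nm (\sum_(i < n) (i%:R * (phi i t * mu t ^+ i.-1))) <= 2^-1.
    apply: le_trans (nm_sum _ _ _) _; apply: le_trans (phis t tab); apply: ler_sum => i _.
    rewrite !nmM nm_nat ler_wpM2l// ler_piMr ?nm_ge0// nm_exp_le1//; exact: mub.
  have := nmD (Dn t) (\sum_(i < n) (i%:R * (phi i t * mu t ^+ i.-1))).
  by rewrite subrK nm1; order_lra.
have NmR : Reg a b k (n%:R * M2) Nm.
  apply: (Reg_sum (F := fun i t => psi i t * mu t ^+ i) M20) => i ni; apply: HM2 => //.
    by apply: Reg_mono (proj1 (Hpsi i ni)); order_lra.
  by apply: expR => //; exact: ltnW.
have DnR : Reg a b k (1 + n%:R * M3) Dn.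
  apply: Reg_add; first by apply: Reg_cst; rewrite nm1.
  apply: Reg_opp; apply: (Reg_sum (F := fun i t => i%:R * (phi i t * mu t ^+ i.-1)) M30) => i ni.
  apply: HM3 => //; first by apply: Reg_cst; rewrite nm_nat ler_nat ltnW.
  apply: HM2 => //; first exact: phik.
  by apply: expR => //; apply: leq_ltn_trans (leq_pred _) (ltnW _).
split=> [x /mub|]; first by order_lra.
exists (fun t => Nm t * (Dn t)^-1).
  by apply: Reg_mono (HM5 _ _ _ _ ab1 NmR (HM4 _ _ _ ab1 DnR Dn2)); order_lra.
move=> x y xab yab.
have Dnx : Dn x != 0 by rewrite -nm_gt0; apply: lt_le_trans (Dn2 x xab); rewrite invr_gt0.
pose De := mu y - mu x; pose h := y - x.
(* The difference of the fixed-point equations at y and x, arranged so that each remaining term is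
   of second order in y - x. *)
have key : Dn x * De - cR h * Nm x = \sum_(i < n) (
   (phi i y - phi i x - cR h * psi i x) * mu x ^+ i + (phi i y - phi i x) * (mu y ^+ i - mu x ^+ i)
   + phi i x * (mu y ^+ i - mu x ^+ i - i%:R * mu x ^+ i.-1 * De)).
  have -> : Dn x * De - cR h * Nm x = De - (\sum_(i < n) (i%:R * (phi i x * mu x ^+ i.-1) * De + cR h * (psi i x * mu x ^+ i))).
    by rewrite big_split /= -mulr_suml -mulr_sumr /Dn /Nm; ring.
  have {1}-> : De = \sum_(i < n) (phi i y * mu y ^+ i - phi i x * mu x ^+ i).
    by rewrite sumrB -muE// -muE.
  by rewrite -sumrB; apply: eq_bigr => i _; ring.
have DeL : nm De <= Lc * `|h| by exact: mul.
have h2E : `|h| ^+ 2 = h ^+ 2 by rewrite real_normK ?num_real.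
have keyb : nm (Dn x * De - cR h * Nm x) <= N / 2 * h ^+ 2.
  rewrite key; apply: le_trans (nm_sum _ _ _) _.
  apply: (@le_trans _ _ (\sum_(i < n) ((K + 2 * K * (n%:R * Lc) + K * (n%:R ^+ 2 * Lc ^+ 2)) * h ^+ 2))).
    apply: ler_sum => i _; have ni := ltn_ord i.
    have [_ pd] := Hpsi i ni.
    have in1 : i%:R <= n%:R :> R by rewrite ler_nat ltnW.
    apply: le_trans (nmD _ _) _; apply: le_trans (lerD (nmD _ _) (lexx _)) _; rewrite !nmM.
    have e1 : nm (phi i y - phi i x - cR h * psi i x) * nm (mu x ^+ i) <= K * h ^+ 2.
      apply: le_trans (pd x y xab yab).
      by rewrite ler_piMr ?nm_ge0// nm_exp_le1// mub.
    have e2 : nm (phi i y - phi i x) * nm (mu y ^+ i - mu x ^+ i) <=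
        (2 * K * `|h|) * (n%:R * (Lc * `|h|)).
      apply: ler_pM; rewrite ?nm_ge0//; first exact: phil.
      apply: le_trans (nm_diff_exp i (mub x xab) (mub y yab)) _.
      by apply: ler_pM; rewrite ?nm_ge0.
    have e3 : nm (phi i x) * nm (mu y ^+ i - mu x ^+ i - i%:R * mu x ^+ i.-1 * De) <=
        K * (n%:R ^+ 2 * (Lc * `|h|) ^+ 2).
      apply: ler_pM; rewrite ?nm_ge0//; first exact: Reg_bdd (phiR i ni) x xab.
      apply: le_trans (nm_diff_exp2 i (mub x xab) (mub y yab)) _.
      have l1 : (Lc * `|h|) \is Num.nneg by rewrite nnegrE mulr_ge0.
      by apply: ler_pM; rewrite ?exprn_ge0 ?nm_ge0// lerXn2r ?nnegrE ?nm_ge0.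
    have e4 : (2 * K * `|h|) * (n%:R * (Lc * `|h|)) = 2 * K * (n%:R * Lc) * h ^+ 2.
      by rewrite -h2E; ring.
    have e5 : K * (n%:R ^+ 2 * (Lc * `|h|) ^+ 2) = K * (n%:R ^+ 2 * Lc ^+ 2) * h ^+ 2.
      by rewrite -h2E; ring.
    by rewrite e4 in e2; rewrite e5 in e3; order_lra.
  rewrite sumr_const card_ord -mulr_natl /N.
  by rewrite le_eqVlt; apply/orP; left; apply/eqP; field.
have -> : mu y - mu x - cR (y - x) * (Nm x * (Dn x)^-1) = (Dn x * De - cR h * Nm x) * (Dn x)^-1.
  by rewrite /De /h; field.
rewrite nmM nmV.
have i2 : (nm (Dn x))^-1 <= 2.
  by rewrite -[leRHS]invrK lef_pV2 ?posrE ?invr_gt0// ?Dn2// nm_gt0.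
have := ler_pM (nm_ge0 _) (_ : 0 <= (nm (Dn x))^-1) keyb i2.
rewrite invr_ge0 nm_ge0 => /(_ isT) H; apply: le_trans H _.
have : 0 <= (1 + M5) * h ^+ 2 by rewrite mulr_ge0 ?sqr_ge0//; order_lra.
by rewrite -/h; order_lra.
Qed.

Lemma prod_roots_deriv (r : seq C) : (forall z, z \in r -> z != 0) ->
  nm ((\prod_(z <- r) ('X - z%:P))^`()).[0] <=
  \sum_(z <- r) nm (\prod_(z <- r) ('X - z%:P)).[0] / nm z.
Proof.
elim: r => [|z r IH] r0; first by rewrite !big_nil derivC horner0 nm0.
have z0 : z != 0 by apply: r0; rewrite mem_head.
have nz0 : nm z != 0 by rewrite nm_eq0.
rewrite !big_cons derivM derivXsubC mul1r !(hornerXsubC, hornerM, hornerD) sub0r.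
set q := \prod_(j <- r) _.
apply: le_trans (nmD _ _) _; rewrite !nmM !nmN; apply: lerD.
  by rewrite mulrAC divff// mul1r.
have {}IH : nm (q^`()).[0] <= \sum_(z0 <- r) nm q.[0] / nm z0.
  by apply: IH => w wr; apply: r0; rewrite inE wr orbT.
apply: le_trans (ler_wpM2l (nm_ge0 z) IH) _.
by rewrite mulr_sumr; apply: ler_sum => w _; rewrite mulrA.
Qed.

(** The logarithmic derivative at 0 has modulus |al 1| / |al 0| and is at most the sum of 1/|z| over
    at most N roots. It would be too small if every root were larger than the bound. *)
Lemma small_root (al : nat -> C) (N : nat) : al 1%N != 0 -> (0 < N)%N ->
  exists z, \sum_(k < N.+1) al k * z ^+ k = 0 /\ nm z <= N%:R * (nm (al 0%N) / nm (al 1%N)).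
Proof.
move=> al1 N0.
have [al0|al0] := eqVneq (al 0%N) 0.
  exists 0; split; last by rewrite nm0 mulr_ge0// divr_ge0 ?nm_ge0.
  by apply: big1 => -[[|k] ?] _ /=; rewrite ?al0 ?mul0r// expr0n mulr0.
pose p : {poly C} := \poly_(k < N.+1) al k.
have pE z : p.[z] = \sum_(k < N.+1) al k * z ^+ k by rewrite horner_poly.
have p0 : p.[0] = al 0%N by rewrite horner_coef0 coef_poly.
have p1 : (p^`()).[0] = al 1%N by rewrite horner_coef0 coef_deriv coef_poly ltnS N0.
have [r pr] := closed_field_poly_normal p.
have pn0 : p != 0 by apply: contraNneq al0 => pp; rewrite -p0 pp horner0.
have lp0 : lead_coef p != 0 by rewrite lead_coef_eq0.
have sr : (size r <= N)%N.
  have : (size p <= N.+1)%N by rewrite size_poly.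
  by rewrite pr size_scale// size_prod_XsubC.
pose del := N%:R * (nm (al 0%N) / nm (al 1%N)).
have [[z zr zd]|nex] := pselect (exists2 z, z \in r & nm z <= del).
  exists z; rewrite -pE; split=> //; apply/rootP.
  by rewrite pr rootZ// root_prod_XsubC.
exfalso.
have d0 : 0 < del by rewrite mulr_gt0 ?ltr0n// divr_gt0// nm_gt0.
have rd z : z \in r -> del < nm z.
  by move=> zr; rewrite ltNge; apply/negP => zd; apply: nex; exists z.
have := @prod_roots_deriv r.
set q := \prod_(z <- r) _ => H.
have {}H : nm (q^`()).[0] <= \sum_(z <- r) nm q.[0] / nm z.
  by apply: H => z /rd; rewrite -nm_gt0; apply: lt_trans.
have e1 : nm (al 1%N) <= \sum_(z <- r) nm (al 0%N) / nm z.
  rewrite -p1 -p0 pr derivZ !hornerZ !nmM; apply: le_trans (ler_wpM2l (nm_ge0 _) H) _.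
  by rewrite mulr_sumr; apply: ler_sum => z _; rewrite mulrA.
have a10 : 0 < nm (al 1%N) by rewrite nm_gt0.
case: r pr sr rd q H e1 nex => [|z r] pr sr rd q H e1 nex.
  by rewrite big_nil leNgt a10 in e1.
have e2 w : w \in z :: r -> nm (al 0%N) / nm w < nm (al 1%N) / N%:R.
  move=> /rd dw; have w0 := lt_trans d0 dw.
  rewrite ltr_pdivrMr// mulrAC ltr_pdivlMr ?ltr0n//.
  by move: dw; rewrite /del mulrA ltr_pdivrMr//; lra.
have : \sum_(w <- z :: r) nm (al 0%N) / nm w < nm (al 1%N).
  rewrite big_cons; apply: (@lt_le_trans _ _ (nm (al 1%N) / N%:R + \sum_(w <- r) nm (al 1%N) / N%:R)).
    apply: ltr_leD; first by apply: e2; rewrite mem_head.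
    rewrite big_seq [leRHS]big_seq; apply: ler_sum => w wr; apply: ltW; apply: e2.
    by rewrite inE wr orbT.
  rewrite big_const_seq count_predT iter_addr addr0 -mulrS -[_ *+ (size r).+1]mulr_natr.
  rewrite mulrAC ler_pdivrMr ?ltr0n// ler_wpM2l ?nm_ge0// ler_nat; exact: sr.
by rewrite ltNge e1.
Qed.

(** Taylor coefficients of the polynomial at [mu]. The truncated subtraction is harmless, as the
    binomial vanishes for l < k. *)
Definition shiftc n (c : nat -> C) (mu : C) k := \sum_(l < n.+1) 'C(l, k)%:R * c l * mu ^+ (l - k).

Lemma shiftcE n (c : nat -> C) (mu w : C) : \sum_(k < n.+1) c k * (mu + w) ^+ k =
  \sum_(k < n.+1) shiftc n c mu k * w ^+ k.
Proof.
rewrite /shiftc; under [RHS]eq_bigr do rewrite mulr_suml.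
rewrite exchange_big /=; apply: eq_bigr => l _.
rewrite exprDn mulr_sumr (big_ord_widen n.+1
  (fun i => c l * (mu ^+ (l - i) * w ^+ i *+ 'C(l, i)))) //= big_mkcond.
apply: eq_bigr => k _; case: ifP => kl; first by rewrite -[in LHS]mulr_natl; ring.
by rewrite bin_small ?mul0r// ltnNge -ltnS kl.
Qed.

Lemma bin_le_expn l k : ('C(l, k) <= 2 ^ l)%N.
Proof.
have [kl|lk] := leqP k l; last by rewrite bin_small.
have -> : (2 ^ l = \sum_(i < l.+1) 'C(l, i))%N.
  by rewrite -(addn1 1) expnDn; apply: eq_bigr => i _; rewrite !exp1n !muln1.
by rewrite (bigD1 (Ordinal (kl : (k < l.+1)%N))) //= leq_addr.
Qed.


Lemma natC_neq0 k : (0 < k)%N -> k%:R != 0 :> C.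
Proof. by move=> k0; rewrite -nm_gt0 nm_nat ltr0n. Qed.

(** With coefficients above m present, subtracting c_(m-1) / m would not cancel the coefficient of
    z^(m-1) exactly. The shift is by a solution of an implicit equation with small coefficients,
    followed by a division by the new coefficient of z^m. [tau] precedes [K], as in
    [root_estimate]. *)
Lemma tschirnhaus (n m : nat) (tau1 : R) : (1 < m <= n)%N -> 0 < tau1 -> exists2 tau : R, 0 < tau &
  forall K, 0 <= K -> exists2 K1 : R, 0 <= K1 & forall a b (c : nat -> R -> C), b - a <= 1 ->
  (forall k, (k <= n)%N -> Reg a b m.-1 K (c k)) ->
  (forall t, a <= t <= b -> c m t = 1 /\ forall k, (k <= n)%N -> k != m -> nm (c k t) <= tau) ->
  exists (mu : R -> C) (c' : nat -> R -> C), [/\ Reg a b m.-1 K1 mu,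
    forall k, (k <= n)%N -> Reg a b m.-1 K1 (c' k),
    forall t, a <= t <= b -> [/\ c' m t = 1, c' m.-1 t = 0 &
      forall k, (k <= n)%N -> k != m -> nm (c' k t) <= tau1],
    forall t, a <= t <= b -> nm (mu t) <= 1
    & forall t z, a <= t <= b -> \sum_(k < n.+1) c k t * z ^+ k = 0 ->
        \sum_(k < n.+1) c' k t * (z - mu t) ^+ k = 0].
Proof.
move=> /andP[m1 mn] tau10.
pose B : R := 2 ^+ n; have B0 : 0 < B by rewrite exprn_gt0.
have B1 : 1 <= B by rewrite exprn_ege1// ler1n.
have binB l k : (l <= n)%N -> 'C(l, k)%:R <= B.
  move=> ln; rewrite /B -natrX ler_nat; apply: leq_trans (bin_le_expn l k) _.
  by rewrite leq_exp2l.
(* E tau bounds the shifted coefficients s k for k <> m. As |s m| >= 1/2, the quotients are at most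
   2 E tau, which the choice of tau puts below tau1. *)
pose E : R := 2 * n.+1%:R * (B * B).
have n10 : 1 <= n.+1%:R :> R by rewrite ler1n.
have nE : n.+1%:R = 1 + n%:R :> R by rewrite -natr1 addrC.
have n0 : 0 <= n%:R :> R by [].
have BB1 : 1 <= B * B by have := ler_pM ler01 ler01 B1 B1; rewrite mulr1.
have nB0 : 0 <= n%:R * (B * B) by rewrite mulr_ge0//; lra.
have E1 : 1 <= E by rewrite /E nE; lra.
have E0 : 0 < E by lra.
pose tau := Num.min 1 tau1 / (2 * n.+1%:R * E).
have d0 : 0 < 2 * n.+1%:R * E by rewrite !mulr_gt0//; lra.
have t0 : 0 < tau by rewrite divr_gt0// lt_min ltr01.
have tE : 2 * n.+1%:R * E * tau <= 1.
  by rewrite mulrC /tau divfK ?gt_eqF// ge_min lexx.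
have tE1 : 2 * n.+1%:R * E * tau <= tau1.
  by rewrite mulrC /tau divfK ?gt_eqF// ge_min lexx orbT.
have Et0 : 0 <= E * tau by rewrite mulr_ge0// ltW.
have nEt0 : 0 <= n%:R * (E * tau) by rewrite mulr_ge0.
have Et : 2 * (E * tau) <= 1 by rewrite nE in tE; lra.
have Et1 : 2 * (E * tau) <= tau1 by rewrite nE in tE1; lra.
have Bt0 : 0 <= B * tau by rewrite mulr_ge0// ltW.
have nBt0 : 0 <= n%:R * (B * tau) by rewrite mulr_ge0.
have BD : B * tau <= B * (B * tau) by rewrite ler_peMl.
have nBD : n%:R * (B * tau) <= n%:R * (B * (B * tau)) by rewrite ler_wpM2l.
have Etau : E * tau = 2 * (B * (B * tau)) + 2 * (n%:R * (B * (B * tau))) by rewrite /E nE; ring.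
have m10 : (0 < m.-1)%N by rewrite -subn1 subn_gt0.
have mE : (m.-1 + 1 = m)%N by rewrite addn1 prednK// ltnW.
have mn0 : m%:R != 0 :> R by rewrite pnatr_eq0 -lt0n ltnW.
exists tau => // K K0.
pose n1 := (n - m.-1)%N.
have n1n : (n1 <= n)%N by rewrite leq_subr.
have n1E : (m.-1 + n1 = n)%N by rewrite subnKC// (leq_trans (leq_pred m)).
have n10' : (0 < n1)%N by rewrite subn_gt0 (leq_trans _ mn)// prednK// ltnW.
pose Kphi := B.
have [K2 K20 HK2] := Reg_mul m.-1 (ltW B0) K0.
have [M M0 HM] := Reg_implicit n1.+1 m.-1 K20.
have expC i : exists Mi : R, 0 <= Mi /\ forall a b f, b - a <= 1 ->
    Reg a b m.-1 M f -> Reg a b m.-1 Mi (fun t => f t ^+ i).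
  by have [Mi Mi0 H] := Reg_exp m.-1 i M0; exists Mi.
have [Me HMe] := choice expC.
pose M1 := \sum_(i < n.+1) Me i.
have Me0 i : 0 <= Me i by case: (HMe i).
have M10 : 0 <= M1 by apply: sumr_ge0.
have expR i a b f : (i < n.+1)%N -> b - a <= 1 -> Reg a b m.-1 M f ->
    Reg a b m.-1 M1 (fun t => f t ^+ i).
  move=> ni ab1 fR; have [_ /(_ a b f ab1 fR)] := HMe i; apply: Reg_mono.
  by rewrite /M1 (bigD1 (Ordinal ni)) //= lerDl; apply: sumr_ge0.
have [M2 M20 HM2] := Reg_mul m.-1 K20 M10.
have S0 : 0 <= n.+1%:R * M2 by rewrite mulr_ge0.
have [M3 M30 HM3] := @Reg_inv R m.-1 _ 2^-1 S0 (ltac:(by rewrite invr_gt0)).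
have [M4 M40 HM4] := Reg_mul m.-1 S0 M30.
exists (M + M4); first by rewrite addr_ge0.
move=> a b c ab1 creg ct.
(* the centre is the small root of the (m-1)-st z-derivative *)
pose al t k := 'C(m.-1 + k, m.-1)%:R * c (m.-1 + k)%N t.
have al0 t : al t 0%N = c m.-1 t by rewrite /al addn0 binn mul1r.
have al1 t : a <= t <= b -> al t 1%N = m%:R.
  by move=> tab; have [cm _] := ct t tab; rewrite /al mE -{1}mE addn1 binSn prednK ?(ltnW m1)// cm mulr1.
have alb t k : a <= t <= b -> (k <= n1)%N -> (k != 1)%N -> nm (al t k) <= B * tau.
  move=> tab kn1 k1; have [_ ctau] := ct t tab.
  have kn : (m.-1 + k <= n)%N by rewrite -n1E leq_add2l.
  rewrite nmM nm_nat; apply: ler_pM; rewrite ?nm_ge0 ?binB//.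
  apply: ctau => //; apply: contra k1 => /eqP h.
  by rewrite -(eqn_add2l m.-1) mE h.
(* The root is picked separately at each t. Its regularity in t is then forced by the contraction in
   [Reg_implicit]. *)
have /choice[mu Hmu] : forall t, exists z : C, a <= t <= b ->
    \sum_(k < n1.+1) al t k * z ^+ k = 0 /\ nm z <= n%:R * (B * tau).
  move=> t; have [tab|ntab] := boolP (a <= t <= b); last by exists 0.
  have [|z [z0 zb]] := @small_root (al t) n1 _ n10'.
    by rewrite al1// natC_neq0// ltnW.
  exists z => _; split=> //; apply: le_trans zb _.
  rewrite al1// nm_nat; apply: ler_pM; rewrite ?ler_nat ?divr_ge0 ?nm_ge0//.
  apply: (@le_trans _ _ (nm (al t 0%N))); last exact: alb.
  by rewrite ler_pdivrMr ?ltr0n ?(ltnW m1)// ler_peMr ?nm_ge0// ler1n ltnW.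
have mub t : a <= t <= b -> nm (mu t) <= n%:R * (B * tau) by move=> /Hmu[].
have nBt1 : n%:R * (B * tau) <= 1.
  by rewrite Etau in Et; order_lra.
have mu1 : bdd a b 1 mu by move=> t /mub/le_trans; apply.
(* The equation solved for its linear term, whose coefficient is m because c m = 1. *)
pose phi i t := if i == 1%N then 0 else - m%:R^-1 * al t i.
have phiR i : (i < n1.+1)%N -> Reg a b m.-1 K2 (phi i).
  move=> in1; rewrite /phi; case: eqP => _; first by apply: Reg_cst; rewrite nm0.
  have kn : (m.-1 + i <= n)%N by rewrite -n1E leq_add2l.
  apply: (eq_Reg (f := fun t => (- m%:R^-1 * 'C(m.-1 + i, m.-1)%:R) * c (m.-1 + i)%N t)).
    by move=> t _; rewrite /al mulrA.
  apply: HK2 => //; last exact: creg.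
  apply: Reg_cst; rewrite nmM nmN nmV !nm_nat; apply: le_trans (binB _ m.-1 kn).
  by rewrite ler_piMl// invf_le1 ?ltr0n ?ler1n ltnW.
have phib t i : a <= t <= b -> (i < n1.+1)%N -> nm (phi i t) <= B * tau.
  move=> tab; rewrite ltnS => in1; rewrite /phi; case: eqP => [_|/eqP i1]; first by rewrite nm0.
  rewrite nmM nmN nmV nm_nat; apply: le_trans (alb t i tab in1 i1).
  by rewrite ler_piMl ?nm_ge0// invf_le1 ?ltr0n ?ler1n ltnW.
have muE t : a <= t <= b -> mu t = \sum_(i < n1.+1) phi i t * mu t ^+ i.
  move=> tab; have [+ _] := Hmu t tab.
  have i1 : (1 < n1.+1)%N by rewrite ltnS.
  have mC0 : m%:R != 0 :> C by rewrite natC_neq0// ltnW.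
  rewrite (bigD1 (Ordinal i1)) //= al1// expr1 => H.
  rewrite [RHS](bigD1 (Ordinal i1)) //= {1}/phi eqxx mul0r add0r /phi.
  have {H} H : mu t = - m%:R^-1 * (\sum_(k < n1.+1 | k != Ordinal i1) al t k * mu t ^+ k).
    by apply: (mulfI mC0); rewrite mulrA mulrN divff// mulN1r; apply/eqP; rewrite -addr_eq0 H.
  rewrite [LHS]H mulr_sumr; apply: eq_bigr => k; rewrite -val_eqE /= => /negbTE ->.
  by rewrite mulrA.
have phis t : a <= t <= b -> \sum_(i < n1.+1) i%:R * nm (phi i t) <= 2^-1.
  move=> tab; apply: (@le_trans _ _ (\sum_(i < n1.+1) n%:R * (B * tau))).
    apply: ler_sum => i _; apply: ler_pM; rewrite ?nm_ge0 ?ler_nat//; last exact: phib.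
    by apply: leq_trans n1n; rewrite -ltnS.
  rewrite sumr_const card_ord -[_ *+ n1.+1]mulr_natl.
  apply: (@le_trans _ _ (n.+1%:R * (n%:R * (B * tau)))).
    by rewrite ler_wpM2r// ler_nat.
  have : n%:R * (B * tau) <= E * tau by rewrite Etau; order_lra.
  move=> h; have := ler_wpM2l (ler0n R n.+1) h; order_lra.
have muR : Reg a b m.-1 M mu := HM a b phi mu ab1 phiR mu1 muE phis.
pose s k t := shiftc n (fun l => c l t) (mu t) k.
have sR k : Reg a b m.-1 (n.+1%:R * M2) (s k).
  apply: (Reg_sum (F := fun l t => 'C(l, k)%:R * c l t * mu t ^+ (l - k)) M20) => l ln.
  apply: HM2 => //.
    apply: HK2 => //; last exact: creg.
    by apply: Reg_cst; rewrite nm_nat binB.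
  by apply: expR => //; apply: leq_ltn_trans (leq_subr _ _) ln.
have sm t : a <= t <= b -> nm (s m t - 1) <= 2^-1.
  move=> tab; have [cm ctau] := ct t tab.
  have -> : s m t - 1 = \sum_(l < n.+1 | l != m :> nat) 'C(l, m)%:R * c l t * mu t ^+ (l - m).
    rewrite /s /shiftc (bigD1 (Ordinal (mn : (m < n.+1)%N))) //= cm binn subnn !mulr1 mulr1n addrAC subrr add0r.
    by apply: eq_bigl => l; rewrite -val_eqE.
  apply: le_trans (nm_sum _ _ _) _.
  apply: (@le_trans _ _ (\sum_(l < n.+1) B * tau)).
    rewrite big_mkcond; apply: ler_sum => l _; case: ifP => [/= lm|_]; last exact: Bt0.
    rewrite !nmM nm_nat -[leRHS]mulr1; apply: ler_pM; rewrite ?mulr_ge0 ?nm_ge0//.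
      by apply: ler_pM; rewrite ?nm_ge0 ?binB ?ctau// -ltnS.
    by apply: nm_exp_le1; apply: mu1.
  by rewrite sumr_const card_ord -[_ *+ n.+1]mulr_natl nE; move: Et; rewrite Etau; order_lra.
have sm2 t : a <= t <= b -> 2^-1 <= nm (s m t).
  move=> tab; have := sm t tab; have := nmB (s m t) (s m t - 1).
  have -> : s m t - (s m t - 1) = 1 by ring.
  by rewrite nm1; order_lra.
have sb k t : a <= t <= b -> (k <= n)%N -> k != m -> nm (s k t) <= E * tau.
  move=> tab kn km; have [cm ctau] := ct t tab.
  rewrite /s /shiftc (bigD1 (Ordinal (mn : (m < n.+1)%N))) //=.
  have e1 : nm ('C(m, k)%:R * c m t * mu t ^+ (m - k)) <= B * (n%:R * (B * tau)).
    rewrite cm mulr1 nmM nm_nat.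
    have [mk|mk] := ltnP m k; first by rewrite bin_small// mul0r mulr_ge0// ltW.
    apply: ler_pM; rewrite ?nm_ge0 ?binB//.
    have mk0 : (0 < m - k)%N by rewrite subn_gt0 ltn_neqAle km.
    rewrite -(prednK mk0) exprS nmM; apply: le_trans (mub t tab).
    by rewrite ler_piMr ?nm_ge0//; apply: nm_exp_le1; apply: mu1.
  have e2 : nm (\sum_(l < n.+1 | l != Ordinal (mn : (m < n.+1)%N)) 'C(l, k)%:R * c l t * mu t ^+ (l - k))
     <= \sum_(l < n.+1) B * tau.
    apply: le_trans (nm_sum _ _ _) _.
    rewrite big_mkcond; apply: ler_sum => l _; rewrite -val_eqE /=; case: ifP => [/= lm|_]; last exact: Bt0.
    rewrite !nmM nm_nat -[leRHS]mulr1; apply: ler_pM; rewrite ?mulr_ge0 ?nm_ge0//.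
      by apply: ler_pM; rewrite ?nm_ge0 ?binB ?ctau// -ltnS.
    by apply: nm_exp_le1; apply: mu1.
  rewrite sumr_const card_ord -[_ *+ n.+1]mulr_natl in e2.
  apply: le_trans (nmD _ _) _; apply: le_trans (lerD e1 e2) _.
  by rewrite nE Etau; order_lra.
exists mu, (fun k t => s k t * (s m t)^-1); split=> [|k kn|t tab|t /mu1//|t z tab zr].
- by apply: Reg_mono muR; rewrite lerDl.
- have := HM4 _ _ _ _ ab1 (sR k) (HM3 _ _ _ ab1 (sR m) sm2).
  by apply: Reg_mono; rewrite lerDr.
- have smn0 : s m t != 0 by rewrite -nm_gt0; apply: lt_le_trans (sm2 t tab); rewrite invr_gt0.
  split; first by rewrite divff.
    suff -> : s m.-1 t = 0 by rewrite mul0r.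
    have [<- _] := Hmu t tab; rewrite /s /shiftc.
    rewrite -(big_mkord xpredT (fun l => 'C(l, m.-1)%:R * c l t * mu t ^+ (l - m.-1))).
    rewrite -n1E -addnS (@big_cat_nat _ _ _ m.-1) ?leq_addr//= big1_seq ?add0r.
      rewrite -{1}[m.-1]add0n big_addn addKn big_mkord; apply: eq_bigr => l _.
      by rewrite /al addnK (addnC m.-1).
    by move=> l; rewrite mem_index_iota => /andP[_ lm]; rewrite bin_small// !mul0r.
  move=> k kn km; rewrite nm_div ler_pdivrMr ?nm_gt0//.
  have := sb k t tab kn km; have := ler_wpM2l (ltW tau10) (sm2 t tab); order_lra.
- have -> : \sum_(k < n.+1) s k t * (s m t)^-1 * (z - mu t) ^+ k =
     (s m t)^-1 * \sum_(k < n.+1) s k t * (z - mu t) ^+ k.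
    by rewrite mulr_sumr; apply: eq_bigr => k _; ring.
  by rewrite -shiftcE addrC subrK zr mulr0.
Qed.

End Centering.

(** * The p-variation of a cluster of roots *)

Section Variation.
Variable R : realType.
Local Notation C := (Rcomplex R).
Implicit Types (a b c d x y t K M p : R) (f g : R -> C) (L Q : seq (R * R)).

(* |f y - f x|^p / (y - x)^(p - 1), the summand of Riesz' p-variation *)
Definition rvar p f x y : R := (y - x) * (nm (f y - f x) / (y - x)) `^ p.

Definition VB p f a b B := forall L, chain a b L -> \sum_(q <- L) rvar p f q.1 q.2 <= B.

Lemma rvar_ge0 p f x y : x <= y -> 0 <= rvar p f x y.
Proof. by move=> xy; rewrite mulr_ge0 ?powR_ge0// subr_ge0. Qed.

(** Convexity of x^p: the slope over [x, z] is at most the average of the slopes over [x, y] and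
    [y, z], weighted by length. *)
Lemma rvar_split p f x y z : 1 <= p -> x < y -> y < z ->
  rvar p f x z <= rvar p f x y + rvar p f y z.
Proof.
move=> p1 xy yz; rewrite /rvar.
have u0 : 0 < y - x by rewrite subr_gt0.
have v0 : 0 < z - y by rewrite subr_gt0.
have w0 : 0 < z - x by rewrite subr_gt0 (lt_trans xy).
set A := nm (f y - f x); set B := nm (f z - f y).
have A0 : 0 <= A by exact: nm_ge0.
have B0 : 0 <= B by exact: nm_ge0.
have AB : nm (f z - f x) <= A + B.
  have -> : f z - f x = (f y - f x) + (f z - f y) by ring.
  exact: nmD.
pose s := (y - x) / (z - x).
have s01 : 0 <= s <= 1.
  by rewrite divr_ge0 ?(ltW u0) ?(ltW w0)//= ler_pdivrMr// mul1r; lra.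
have s1 : 0 <= 1 - s by rewrite subr_ge0; case/andP: s01.
have s0 : 0 <= s by case/andP: s01.
have tw : (z - x) * s = y - x by rewrite mulrC divfK// gt_eqF.
have tw' : (z - x) * (1 - s) = z - y by rewrite mulrBr mulr1 tw; ring.
clearbody s.
have conv : (s * (A / (y - x)) + (1 - s) * (B / (z - y))) `^ p <=
    s * (A / (y - x)) `^ p + (1 - s) * (B / (z - y)) `^ p.
  have [s0' s1'] := andP s01.
  have := @convex_powR R p p1 (Itv01 s0' s1') (A / (y - x)) (B / (z - y)).
  rewrite !inE /= !in_itv /= !andbT !divr_ge0 ?(ltW u0) ?(ltW v0)// => /(_ isT isT).
  by rewrite /conv /= ?convRE /=.
have h1 : (nm (f z - f x) / (z - x)) `^ p <= (s * (A / (y - x)) + (1 - s) * (B / (z - y))) `^ p.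
  apply: ge0_ler_powR; rewrite ?nnegrE; first lra.
  - by rewrite divr_ge0 ?nm_ge0 ?(ltW w0).
  - by apply: addr_ge0; apply: mulr_ge0 => //; apply: divr_ge0 => //; exact: ltW.
  - rewrite ler_pdivrMr//; apply: le_trans AB _.
    have -> : (s * (A / (y - x)) + (1 - s) * (B / (z - y))) * (z - x) =
      ((z - x) * s) * (A / (y - x)) + ((z - x) * (1 - s)) * (B / (z - y)) by ring.
    by rewrite tw tw' ![_ * (_ / _)]mulrC !divfK ?gt_eqF.
have h2 := ler_wpM2l (ltW w0) (le_trans h1 conv).
apply: le_trans h2 _; by rewrite mulrDr ![(z - x) * (_ * _)]mulrA tw tw' lexx.
Qed.

Lemma csum_VB p f a b L c d B : VB p f c d B -> chain a b L -> c <= d ->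
  csum (rvar p f) L c d <= B.
Proof. by move=> H chL cd; apply: H; apply: chain_clip_itv chL cd. Qed.

Lemma powRD_le (x y p : R) : 0 <= x -> 0 <= y -> 0 <= p -> (x + y) `^ p <= 2 `^ p * (x `^ p + y `^ p).
Proof.
move=> x0 y0 p0.
wlog xy : x y x0 y0 / x <= y.
  move=> W; have [/W|/ltW yx] := leP x y; first exact.
  by rewrite addrC [X in _ * X]addrC; apply: W.
apply: (@le_trans _ _ ((2 * y) `^ p)).
  by apply: ge0_ler_powR; rewrite ?nnegrE ?addr_ge0 ?mulr_ge0//; lra.
by rewrite powRM// ler_wpM2l ?powR_ge0// lerDr powR_ge0.
Qed.

Lemma rvar_lip p K f x y : 0 <= p -> x < y -> nm (f y - f x) <= K * (y - x) ->
  rvar p f x y <= K `^ p * (y - x).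
Proof.
move=> p0 xy H; rewrite /rvar mulrC ler_wpM2r ?subr_ge0 ?(ltW xy)//.
have xy0 : 0 < y - x by rewrite subr_gt0.
have K0 : 0 <= K by rewrite -(pmulr_lge0 _ xy0); apply: le_trans H; exact: nm_ge0.
apply: ge0_ler_powR => //; rewrite ?nnegrE ?divr_ge0 ?nm_ge0 ?(ltW xy0)//.
by rewrite ler_pdivrMr.
Qed.

Lemma VB_lip p K f a b : 0 <= p -> b - a <= 1 -> lip a b K f -> VB p f a b (K `^ p).
Proof.
move=> p0 ab1 fl L chL.
apply: (@le_trans _ _ (\sum_(q <- L) K `^ p * (q.2 - q.1))).
  rewrite big_seq [leRHS]big_seq; apply: ler_sum => q qL.
  have [aq q12 qb] := chain_mem chL qL; apply: rvar_lip => //.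
  have := fl q.1 q.2; rewrite ger0_norm ?subr_ge0 ?(ltW q12)//; apply; lra.
rewrite -mulr_sumr -[leRHS]mulr1 ler_wpM2l ?powR_ge0//.
exact: le_trans (chain_tot chL) ab1.
Qed.

Lemma VB_add p f g a b A B : 0 <= p -> VB p f a b A -> VB p g a b B ->
  VB p (fun t => f t + g t) a b (2 `^ p * (A + B)).
Proof.
move=> p0 fA gB L chL.
apply: (@le_trans _ _ (\sum_(q <- L) 2 `^ p * (rvar p f q.1 q.2 + rvar p g q.1 q.2))).
  rewrite big_seq [leRHS]big_seq; apply: ler_sum => q qL.
  have [aq q12 qb] := chain_mem chL qL; rewrite /rvar -mulrDr mulrCA.
  have q0 : 0 <= q.2 - q.1 by rewrite subr_ge0 ltW.
  rewrite ler_wpM2l//; apply: le_trans (powRD_le _ _ p0); rewrite ?divr_ge0 ?nm_ge0//.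
  apply: ge0_ler_powR; rewrite ?nnegrE ?addr_ge0 ?divr_ge0 ?nm_ge0//.
  rewrite -mulrDl ler_wpM2r ?invr_ge0//.
  have -> : f q.2 + g q.2 - (f q.1 + g q.1) = (f q.2 - f q.1) + (g q.2 - g q.1) by ring.
  exact: nmD.
by rewrite -mulr_sumr big_split /= ler_wpM2l ?powR_ge0// lerD ?fA ?gB.
Qed.

Lemma chain_affine a b t0 h L : 0 < h -> chain a b L ->
  chain ((a - t0) / h) ((b - t0) / h) [seq ((q.1 - t0) / h, (q.2 - t0) / h) | q <- L].
Proof.
move=> h0; have H x y : x <= y -> (x - t0) / h <= (y - t0) / h.
  by move=> xy; rewrite ler_wpM2r ?invr_ge0 ?(ltW h0)//; lra.
elim: L a => [|q L IH] a /=; first exact: H.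
case/and3P=> aq q12 /IH ->; rewrite H// andbT/=.
by rewrite ltr_pM2r ?invr_gt0//; lra.
Qed.

Lemma VB_affine p f g a b t0 h (D : R) B : 0 <= p -> 0 < h -> 0 <= D ->
  (forall x y, a <= x <= b -> a <= y <= b ->
     nm (f y - f x) <= D * nm (g ((y - t0) / h) - g ((x - t0) / h))) ->
  VB p g ((a - t0) / h) ((b - t0) / h) B -> VB p f a b (B * (h * (D / h) `^ p)).
Proof.
move=> p0 h0 D0 fg gB L chL.
apply: (@le_trans _ _ ((\sum_(q <- [seq ((q.1 - t0) / h, (q.2 - t0) / h) | q <- L])
    rvar p g q.1 q.2) * (h * (D / h) `^ p))).
  rewrite big_map mulr_suml big_seq [leRHS]big_seq; apply: ler_sum => q qL /=.
  have [aq q12 qb] := chain_mem chL qL; rewrite /rvar.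
  have q0 : 0 < q.2 - q.1 by rewrite subr_gt0.
  set N := nm (g _ - g _).
  have -> : (q.2 - t0) / h - (q.1 - t0) / h = (q.2 - q.1) / h by rewrite -mulrBl; congr (_ / _); ring.
  have -> : (q.2 - q.1) / h * (N / ((q.2 - q.1) / h)) `^ p * (h * (D / h) `^ p) =
     (q.2 - q.1) * ((N / ((q.2 - q.1) / h)) `^ p * (D / h) `^ p).
    by field; rewrite gt_eqF.
  rewrite ler_wpM2l ?(ltW q0)// -powRM ?divr_ge0 ?nm_ge0 ?(ltW h0) ?(ltW q0)//.
  apply: ge0_ler_powR; rewrite ?nnegrE ?mulr_ge0 ?invr_ge0 ?mulr_ge0 ?nm_ge0 ?invr_ge0 ?(ltW q0) ?(ltW h0)//.
  have -> : N / ((q.2 - q.1) / h) * (D / h) = D * N / (q.2 - q.1).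
    by field; rewrite !gt_eqF.
  by rewrite ler_wpM2r ?invr_ge0 ?(ltW q0)// fg; lra.
rewrite ler_wpM2r ?mulr_ge0 ?powR_ge0 ?(ltW h0)//.
by apply: gB; exact: chain_affine.
Qed.

Definition cont a b f := forall x, a <= x <= b -> forall e, 0 < e -> exists2 d, 0 < d &
  forall y, a <= y <= b -> `|y - x| < d -> nm (f y - f x) < e.

Lemma cont_within a b c d f : cont a b f -> a <= c -> d <= b ->
  {within `[c, d], continuous (fun t => nm (f t))}.
Proof.
move=> fc ac db; apply/subspace_continuousP => x /= xcd; apply/cvgrPdist_le => e e0.
rewrite in_itv /= in xcd.
have xab : a <= x <= b by case/andP: xcd => cx xd; rewrite (le_trans ac cx) (le_trans xd db).
have [del d0 H] := fc x xab e e0.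
have N : \forall t \near nbhs x, `|x - t| < del.
  exact: (@cvgr_dist_lt _ _ _ (nbhs x) _ id x cvg_id _ d0).
move: N; apply: filterS => t /= xt tcd.
rewrite in_itv /= in tcd.
apply: (@le_trans _ _ (nm (f x - f t))); first exact: ler_dist_dist.
rewrite nm_distC; apply: ltW; apply: H; last by rewrite distrC.
by case/andP: tcd => ct td; rewrite (le_trans ac ct) (le_trans td db).
Qed.

(** Intermediate value theorem; it keeps a rescaled continuous root inside its cluster. *)
Lemma barrier a b f x0 : cont a b f -> a <= x0 <= b -> f x0 = 0 ->
  (forall x, a <= x <= b -> nm (f x) != 1) -> forall x, a <= x <= b -> nm (f x) <= 1.
Proof.
move=> fc /andP[ax0 x0b] fx0 f1 x /andP[ax xb]; rewrite leNgt; apply/negP => fx.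
have [x0x|xx0] := leP x0 x.
  have [||y ycd fy] := @IVT R (fun t => nm (f t)) x0 x 1 x0x.
  - exact: cont_within fc ax0 xb.
  - by rewrite fx0 nm0 ge_min le_max ler01 (ltW fx) orbT.
  move: ycd; rewrite in_itv /= => /andP[x0y yx].
  by have := f1 y; rewrite fy eqxx (le_trans ax0 x0y) (le_trans yx xb) => /(_ isT).
have [||y ycd fy] := @IVT R (fun t => nm (f t)) x x0 1 (ltW xx0).
- exact: cont_within fc ax x0b.
- by rewrite fx0 nm0 ge_min le_max ler01 (ltW fx) !orbT.
move: ycd; rewrite in_itv /= => /andP[x0y yx].
by have := f1 y; rewrite fy eqxx (le_trans ax x0y) (le_trans yx x0b) => /(_ isT).
Qed.

(** A quantitative Newton polygon: at a suitable radius e, bounded below uniformly, one monomial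
    dominates all the others. Its degree is the number of roots in the cluster at 0. *)
Lemma dominant_index (n M : nat) (kappa tau K : R) : (M <= n)%N -> 0 < kappa -> 0 < tau -> tau <= 1 ->
  1 <= K -> exists2 e0 : R, 0 < e0 <= 1 & forall q : nat -> C,
  (forall k, (k <= n)%N -> nm (q k) <= K) -> q 0%N = 0 ->
  (exists2 k, (0 < k <= M)%N & kappa <= nm (q k)) ->
  exists m e, [/\ (0 < m <= M)%N, e0 <= e <= 1, e0 <= nm (q m) &
    forall k, (k <= n)%N -> k != m -> nm (q k) * e ^+ k <= tau * (nm (q m) * e ^+ m)].
Proof.
move=> + + tau0 tau1 K1; have K0 : 0 < K by lra.
elim: M kappa => [|M IH] kappa Mn k0.
  by exists 1; rewrite ?ltr01 ?lexx// => q _ _ [[|k]].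
(* At radius e the terms above M + 1 are negligible against a coefficient of size kappa in degree M
   + 1. The threshold k' below makes the lower terms negligible too; if some lower coefficient
   reaches k', the induction hypothesis is used with k' instead of kappa. *)
have [e [e0 e1 Ke]] : exists e, [/\ 0 < e, e <= 1 & K * e <= tau * kappa].
  exists (Num.min 1 (tau * kappa / K)); split.
  - by rewrite lt_min ltr01 divr_gt0// mulr_gt0.
  - by rewrite ge_min lexx.
  - by rewrite mulrC -ler_pdivlMr// ge_min lexx orbT.
pose k' := tau * kappa * e ^+ M.+1.
have k'0 : 0 < k' by rewrite !mulr_gt0// exprn_gt0.
have [e' /andP[e'0 e'1] He'] := IH k' (ltnW Mn) k'0.
exists (Num.min e' (Num.min e kappa)).
  by rewrite !lt_min e'0 e0 k0 ge_min e'1.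
move=> q qK q0 [k /andP[k_gt0 kM] kq].
have [[l /andP[l0 lM] lq]|nex] := pselect (exists2 k, (0 < k <= M)%N & k' <= nm (q k)).
  have [|m [ee [mM eeP mq H]]] := He' q qK q0; first by exists l; rewrite ?l0.
  exists m, ee; split=> //; first by case/andP: mM => -> /leqW.
    by case/andP: eeP => h ->; rewrite ge_min h.
  by rewrite ge_min mq.
have kE : k = M.+1.
  apply/eqP; rewrite eqn_leq kM ltnNge; apply/negP => kM'; apply: nex.
  exists k; first by rewrite k_gt0.
  apply: le_trans kq; rewrite /k' mulrAC ler_piMl ?(ltW k0)//.
  by rewrite mulr_ile1 ?exprn_ge0 ?exprn_ile1 ?(ltW e0) ?(ltW tau0).
rewrite kE in kq; exists M.+1, e; split=> //.
- exact: leqnn.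
- by rewrite !ge_min lexx e1 !orbT.
- by rewrite !ge_min kq !orbT.
move=> l ln lM.
have qe : kappa * e ^+ M.+1 <= nm (q M.+1) * e ^+ M.+1 by rewrite ler_wpM2r// exprn_ge0// ltW.
have qe' := ler_wpM2l (ltW tau0) qe.
apply: le_trans qe'.
have [lM'|lM'] := ltnP M.+1 l.
  apply: (@le_trans _ _ (K * e ^+ M.+2)).
    apply: ler_pM; rewrite ?nm_ge0 ?exprn_ge0 ?(ltW e0) ?qK//.
    by apply: ler_wiXn2l; rewrite ?(ltW e0).
  rewrite exprS mulrA [in leRHS]mulrA ler_wpM2r// exprn_ge0//; exact: ltW.
have lM2 : (l <= M)%N by rewrite -ltnS ltn_neqAle lM.
have [->|l0] := posnP l.
  by rewrite q0 nm0 mul0r !mulr_ge0 ?exprn_ge0 ?(ltW e0) ?(ltW k0) ?(ltW tau0).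
have ql : nm (q l) <= k'.
  by rewrite leNgt; apply/negP => h; apply: nex; exists l; rewrite ?l0// ltW.
rewrite mulrA -/k' -[leRHS]mulr1; apply: ler_pM; rewrite ?nm_ge0 ?exprn_ge0 ?(ltW e0)//.
by rewrite exprn_ile1// ltW.
Qed.

(** If |nu| > 2 m d, the terms below m add up to at most m d |nu|^(m-1) < |nu|^m / 2. Those from m
    on equal nu^m (1 + T) with |T| <= 1/2, because |nu| <= 2 and tau is small. The sum could not
    vanish. *)
Lemma root_bound (n m : nat) (c : nat -> C) (nu : C) (d tau : R) : (0 < m <= n)%N -> 0 < d ->
  c m = 1 -> (forall k, (k < m)%N -> nm (c k) <= d ^+ (m - k)) ->
  (forall k, (m < k <= n)%N -> nm (c k) <= tau) -> nm nu <= 2 ->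
  0 <= tau -> n.+1%:R * (2 ^+ n * tau) <= 2^-1 ->
  \sum_(k < n.+1) c k * nu ^+ k = 0 -> nm nu <= 2 * m%:R * d.
Proof.
move=> /andP[m0 mn] d0 cm cd ct nu2 tau0 tau1 nu0.
rewrite leNgt; apply/negP => dnu; set x := nm nu in dnu nu2.
have m1 : 1 <= m%:R :> R by rewrite ler1n.
have dx : d <= x.
  by apply: le_trans (ltW dnu); rewrite ler_peMl ?(ltW d0)//; lra.
have x0 : 0 < x by apply: lt_le_trans dx.
pose T := \sum_(k < n.+1 | (m < k)%N) c k * nu ^+ (k - m).
have Tb : nm T <= 2^-1.
  apply: le_trans tau1; apply: le_trans (nm_sum _ _ _) _; rewrite big_mkcond.
  apply: (@le_trans _ _ (\sum_(k < n.+1) 2 ^+ n * tau)); last first.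
    by rewrite sumr_const card_ord -[_ *+ n.+1]mulr_natl.
  apply: ler_sum => k _; case: ifP => mk; last by rewrite mulr_ge0// exprn_ge0.
  rewrite nmM nmX mulrC; apply: ler_pM; rewrite ?exprn_ge0 ?nm_ge0//; last first.
    by apply: ct; rewrite mk -ltnS /=.
  apply: (@le_trans _ _ (2 ^+ (k - m))); first by rewrite lerXn2r ?nnegrE ?nm_ge0.
  apply: ler_weXn2l; first by rewrite ler1n.
  by apply: leq_trans (leq_subr _ _) _; rewrite -ltnS.
have E : nu ^+ m * (1 + T) = - \sum_(k < n.+1 | (k < m)%N) c k * nu ^+ k.
  apply/eqP; rewrite -addr_eq0 -[X in _ == X]nu0 mulrDr mulr1 mulr_sumr; apply/eqP.
  rewrite [RHS](bigID (fun k : 'I_n.+1 => (k < m)%N)) /= addrC; congr (_ + _).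
  rewrite [RHS](bigD1 (Ordinal (mn : (m < n.+1)%N))) /= ?ltnn// cm mul1r; congr (_ + _).
  apply: eq_big => [k|k mk]; first by rewrite -val_eqE /= -leqNgt ltn_neqAle eq_sym andbC.
  by rewrite mulrCA -exprD subnKC// ltnW.
have h1 : x ^+ m / 2 <= nm (nu ^+ m * (1 + T)).
  rewrite nmM nmX -/x ler_wpM2l ?exprn_ge0 ?(ltW x0)//.
  have := nmB (1 + T) T; rewrite addrK nm1; lra.
have h2 : nm (- \sum_(k < n.+1 | (k < m)%N) c k * nu ^+ k) <= m%:R * (d * x ^+ m.-1).
  rewrite nmN; apply: le_trans (nm_sum _ _ _) _.
  rewrite -(big_ord_widen_cond n.+1 xpredT (fun k => nm (c k * nu ^+ k))); last exact: leqW.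
  apply: (@le_trans _ _ (\sum_(k < m) d * x ^+ m.-1)); last first.
    by rewrite sumr_const card_ord -[_ *+ m]mulr_natl.
  apply: ler_sum => k _; rewrite nmM nmX -/x.
  have km := ltn_ord k.
  apply: (@le_trans _ _ (d ^+ (m - k) * x ^+ k)); first by rewrite ler_wpM2r ?exprn_ge0 ?(ltW x0) ?cd.
  have mk0 : (0 < m - k)%N by rewrite subn_gt0.
  rewrite -(prednK mk0) exprS -mulrA ler_wpM2l ?(ltW d0)//.
  have -> : (m.-1 = (m - k).-1 + k)%N by move: km; clear; lia.
  by rewrite exprD ler_wpM2r ?exprn_ge0 ?(ltW x0)// lerXn2r ?nnegrE ?(ltW d0) ?(ltW x0).
rewrite E in h1; have := le_trans h1 h2.
rewrite -{1}(prednK m0) exprS leNgt; apply/negP; rewrite negbK.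
have xm : 0 < x ^+ m.-1 by rewrite exprn_gt0.
have := ltr_pM2r xm (2 * m%:R * d) x; rewrite dnu => h3.
have : 2 * m%:R * d * x ^+ m.-1 < x * x ^+ m.-1 by rewrite h3.
lra.
Qed.

(** This is where centering pays off. If all shifted coefficients below m were small, the one of
    order m - 1, which is w (m + T) since u_(m-1) = 0, would make w small. The shift would then
    hardly change u_(k0): its modulus would be at most (1 + (n + 1) 2^n) kap = 1/2 instead of 1. So
    the cluster at the root w has fewer than m elements. *)
Lemma cluster_splits (n m k0 : nat) (u : nat -> C) (w : C) (tau : R) : (1 < m <= n)%N ->
  u m = 1 -> u m.-1 = 0 -> (k0 < m)%N -> nm (u k0) = 1 ->
  (forall k, (k <= n)%N -> nm (u k) <= 1) ->
  (forall k, (m < k <= n)%N -> nm (u k * w ^+ (k - m)) <= tau) ->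
  0 <= tau -> n.+1%:R * (2 ^+ n * tau) <= 2^-1 -> shiftc n u w 0 = 0 ->
  exists2 k, (0 < k <= m.-1)%N & (2 * (1 + n.+1%:R * 2 ^+ n))^-1 <= nm (shiftc n u w k).
Proof.
move=> /andP[m1 mn] um um1 k0m uk0 u1 ut tau0 taun q0; set kap := _^-1.
have S0 : 0 <= n.+1%:R * 2 ^+ n :> R by rewrite mulr_ge0 ?exprn_ge0.
have kap0 : 0 < kap by rewrite invr_gt0; lra.
have kapE : (1 + n.+1%:R * 2 ^+ n) * kap = 2^-1.
  by rewrite /kap; field; rewrite gt_eqF//; lra.
have kap1 : kap <= 1.
  have : 0 <= n.+1%:R * 2 ^+ n * kap by rewrite mulr_ge0// ltW.
  by move: kapE; rewrite mulrDl mul1r; lra.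
have [//|nex] := pselect (exists2 k, (0 < k <= m.-1)%N & kap <= nm (shiftc n u w k)).
have {}nex k : (k <= m.-1)%N -> nm (shiftc n u w k) < kap.
  case: k => [|k] km; first by rewrite q0 nm0.
  by rewrite ltNge; apply/negP => h; apply: nex; exists k.+1.
have binB l k : (l <= n)%N -> 'C(l, k)%:R <= 2 ^+ n :> R.
  by move=> ln; rewrite -natrX ler_nat; apply: leq_trans (bin_le_expn l k) _; rewrite leq_exp2l.
have m1n : (m.-1 < n.+1)%N by rewrite ltnS (leq_trans (leq_pred m)).
have wk : nm w <= kap.
  pose T := \sum_(l < n.+1 | (m < l)%N) 'C(l, m.-1)%:R * (u l * w ^+ (l - m)).
  have Tb : nm T <= 2^-1.
    apply: le_trans taun; apply: le_trans (nm_sum _ _ _) _; rewrite big_mkcond.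
    apply: (@le_trans _ _ (\sum_(k < n.+1) 2 ^+ n * tau)); last first.
      by rewrite sumr_const card_ord -[_ *+ n.+1]mulr_natl.
    apply: ler_sum => k _; case: ifP => mk; last by rewrite mulr_ge0// exprn_ge0.
    have kn : (k <= n)%N by rewrite -ltnS.
    rewrite nmM nm_nat; apply: ler_pM; rewrite ?nm_ge0 ?binB//.
    by apply: ut; rewrite mk.
  have E : shiftc n u w m.-1 = w * (m%:R + T).
    rewrite /shiftc (bigID (fun l : 'I_n.+1 => (m < l)%N)) /= mulrDr addrC; congr (_ + _).
      rewrite (bigD1 (Ordinal (mn : (m < n.+1)%N))) /= ?ltnn//.
      rewrite big1 ?addr0 => [|l].
        rewrite um mulr1 -{2 3}(prednK (ltnW m1)) subSn// subnn expr1 -[in 'C(m, _)](prednK (ltnW m1)).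
        by rewrite binSn prednK ?(ltnW m1)// mulrC.
      rewrite -val_eqE /= -leqNgt => /andP[lm lneq].
      have lm' : (l <= m.-1)%N by rewrite -ltnS prednK ?(ltnW m1)// ltn_neqAle lneq.
      move: lm'; rewrite leq_eqVlt => /orP[/eqP ->|lm']; first by rewrite um1 mulr0 mul0r.
      by rewrite bin_small// !mul0r.
    rewrite mulr_sumr; apply: eq_bigr => l ml.
    have -> : (l - m.-1 = (l - m).+1)%N by rewrite -subSn ?(ltnW ml)// -{2}(prednK (ltnW m1)) subSS.
    by rewrite exprS; ring.
  have := nex m.-1 (leqnn _); rewrite E nmM => H.
  have h1 : 1 <= nm (m%:R + T).
    have := nmB (m%:R + T) T; rewrite addrK nm_nat.
    have : 2 <= m%:R :> R by rewrite ler_nat.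
    lra.
  have := ler_wpM2l (nm_ge0 w) h1; lra.
exfalso.
have k0n : (k0 < n.+1)%N by rewrite ltnS (leq_trans (ltnW k0m)).
have k0m1 : (k0 <= m.-1)%N by rewrite -ltnS prednK// ltnW.
have := nex k0 k0m1; rewrite /shiftc (bigD1 (Ordinal k0n)) //= binn subnn mul1r mulr1.
set Z := \sum_(_ < _ | _) _ => H.
have Zb : nm Z <= n.+1%:R * (2 ^+ n * kap).
  apply: le_trans (nm_sum _ _ _) _; rewrite big_mkcond.
  apply: (@le_trans _ _ (\sum_(k < n.+1) 2 ^+ n * kap)); last first.
    by rewrite sumr_const card_ord -[_ *+ n.+1]mulr_natl.
  have z0 : 0 <= 2 ^+ n * kap by rewrite mulr_ge0 ?exprn_ge0 ?(ltW kap0).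
  apply: ler_sum => l _; case: ifP => // /negbTE; rewrite -val_eqE /= => lk0.
  have ln : (l <= n)%N by rewrite -ltnS.
  have [lk|lk] := leqP l k0.
    by rewrite bin_small ?mul0r ?mul0r ?nm0// ltn_neqAle lk0.
  rewrite !nmM nm_nat; apply: ler_pM; rewrite ?mulr_ge0 ?nm_ge0//.
    by rewrite -[leRHS]mulr1; apply: ler_pM; rewrite ?nm_ge0 ?binB ?u1.
  have lk' : (0 < l - k0)%N by rewrite subn_gt0.
  rewrite -(prednK lk') exprS nmM -[leRHS]mulr1; apply: ler_pM; rewrite ?nm_ge0//.
  by apply: nm_exp_le1; apply: le_trans wk kap1.
have : nm (u k0) <= nm (u k0 + Z) + nm Z by have := nmB (u k0 + Z) Z; rewrite addrK.
by rewrite uk0; move: kapE; rewrite mulrDl mul1r; lra.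
Qed.

(* lam is one of the m roots near 0 of a small perturbation of z^m; the powers of
   z up to n >= m carry the influence of the other roots. *)
Definition root_cluster (m n : nat) (K tau : R) a b (c : nat -> R -> C) (lam : R -> C) : Prop :=
  [/\ a < b /\ b - a <= 1, forall k, (k <= n)%N -> Reg a b m.-1 K (c k),
    forall t, a <= t <= b -> c m t = 1 /\ forall k, (k <= n)%N -> k != m -> nm (c k t) <= tau,
    forall t, a <= t <= b -> nm (lam t) <= 1 /\ \sum_(k < n.+1) c k t * lam t ^+ k = 0
    & cont a b lam].

(** The order of the quantifiers drives the induction: smaller clusters are produced with any
    prescribed smallness tau, but with a regularity bound K that depends on tau. *)
Definition root_estimate (m n : nat) : Prop := exists2 tau : R, 0 < tau &
  forall K p, 0 <= K -> 1 <= p -> m.-1%:R * p < m%:R -> exists2 B : R, 0 <= B &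
  forall a b (c : nat -> R -> C) lam, root_cluster m n K tau a b c lam -> VB p lam a b B.

(** A simple root solves z = - sum of c_k z^k over k <> 1, a contraction for small tau, hence is
    Lipschitz; tau is chosen so that (n + 1)^2 tau = 1/2. *)
Lemma root_estimate1 n : (0 < n)%N -> root_estimate 1 n.
Proof.
move=> n0; have n10 : 0 < n.+1%:R :> R by rewrite ltr0n.
have E0 : 0 < 2 * (n.+1%:R * n.+1%:R) :> R by rewrite !mulr_gt0.
exists (2 * (n.+1%:R * n.+1%:R))^-1; first by rewrite invr_gt0.
move=> K p K0 p1 _; exists ((2 * n.+1%:R * K) `^ p); first exact: powR_ge0.
move=> a b c lam [[ab ab1] creg ct lamr _].
apply: VB_lip => //; first lra.
pose phi k t := if k == 1%N then 0 else - c k t.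
apply: (@implicit_lip R n.+1 K a b phi lam) => //.
- move=> k kn; have [_ cl] := creg k kn.
  move=> x y xab yab; rewrite /phi; case: eqP => _.
    by rewrite subrr nm0 mulr_ge0.
  by rewrite -opprD nmN; exact: cl.
- by move=> t /lamr[].
- move=> t tab; have [_ H] := lamr t tab; have [c1 _] := ct t tab.
  have i1 : (1 < n.+1)%N by rewrite ltnS.
  move: H; rewrite (bigD1 (Ordinal i1)) //= c1 mul1r expr1 => H.
  rewrite [RHS](bigD1 (Ordinal i1)) //= {1}/phi eqxx mul0r add0r /phi.
  move/eqP: H; rewrite addr_eq0 => /eqP H; rewrite [LHS]H -sumrN; apply: eq_bigr => k.
  by rewrite -val_eqE /= => /negbTE ->; rewrite mulNr.
- move=> t tab; have [c1 ctau] := ct t tab.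
  apply: (@le_trans _ _ (\sum_(i < n.+1) n.+1%:R * (2 * (n.+1%:R * n.+1%:R))^-1)).
    apply: ler_sum => i _; apply: ler_pM; rewrite ?nm_ge0//.
      by rewrite ler_nat ltnW.
    rewrite /phi; case: eqP => [_|/eqP i1]; first by rewrite nm0 invr_ge0 ltW.
    by rewrite nmN ctau// -ltnS.
  rewrite sumr_const card_ord -[_ *+ n.+1]mulr_natl.
  by rewrite le_eqVlt; apply/orP; left; apply/eqP; field; rewrite gt_eqF.
Qed.
End Variation.

(** * Splitting a cluster of roots *)

Section ChildEstimate.
Variable R : realType.
Local Notation C := (Rcomplex R).
Implicit Types (a b c d x y t K M p : R) (f g : R -> C) (L Q : seq (R * R)).

Lemma exists_lower (n : nat) (T : nat -> R) : (forall i, (i < n)%N -> 0 < T i) ->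
  exists2 tau : R, 0 < tau <= 1 & forall i, (i < n)%N -> tau <= T i.
Proof.
elim: n => [|n IH] T0; first by exists 1; rewrite ?ltr01 ?lexx.
have [i ni|tau /andP[t0 t1] Ht] := IH; first by apply: T0; apply: ltnW.
exists (Num.min tau (T n)); first by rewrite lt_min t0 T0//= ge_min t1.
move=> i; rewrite ltnS leq_eqVlt => /orP[/eqP ->|/Ht h]; first by rewrite ge_min lexx orbT.
by rewrite ge_min h.
Qed.

Lemma exists_upper (n : nat) (T : nat -> R) : exists2 M : R, 0 <= M & forall i, (i < n)%N -> T i <= M.
Proof.
elim: n => [|n [M M0 HM]]; first by exists 0.
exists (Num.max M (T n)); first by rewrite le_max M0.
move=> i; rewrite ltnS leq_eqVlt => /orP[/eqP ->|/HM h]; first by rewrite le_max lexx orbT.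
by rewrite le_max h.
Qed.

(** The critical exponent m / (m - 1) decreases with m. *)
Lemma child_exponent (m m' : nat) p : (0 < m' < m)%N -> 1 <= p -> m.-1%:R * p < m%:R ->
  m'.-1%:R * p < m'%:R.
Proof.
move=> /andP[m'0 m'm] p1 mp.
have E : m.-1%:R = m'.-1%:R + (m - m')%:R :> R.
  by rewrite -natrD; congr _%:R; lia.
have E2 : m%:R = m'%:R + (m - m')%:R :> R by rewrite -natrD subnKC// ltnW.
have : (m - m')%:R <= (m - m')%:R * p :> R by rewrite ler_peMr.
by move: mp; rewrite E E2 mulrDl; lra.
Qed.

(** Rescaling z by d and dividing by d^m multiplies the k-th coefficient by d^(k-m). For k < m - 1
    the time scale h compensates, for k >= m the factor is at most 1. The third case is the centered
    coefficient k = m - 1, on whose derivatives the scale h imposes nothing. *)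
Lemma rescaled_Reg (m : nat) K : (1 < m)%N -> 0 <= K -> exists2 K2 : R, 0 <= K2 &
  forall a b (F : nat -> R -> C) k t0 d h a' b', jets a b m.-1 K F -> a <= t0 <= b ->
  b' - a' <= 1 -> 0 < h -> h <= d -> d <= 1 ->
  (forall s, a' <= s <= b' -> a <= t0 + h * s <= b /\ `|s| <= 1) ->
  [\/ (k < m)%N /\ (forall l, (l < m)%N -> nm (F l t0) * h ^+ l <= d ^+ (m - k)),
      (m <= k)%N | forall t, a <= t <= b -> F 0%N t = 0] ->
  Reg a' b' m.-1 K2 (fun s => F 0%N (t0 + h * s) * cR (d ^+ k / d ^+ m)).
Proof.
move=> m1 K0; pose K' := 2 + K + m.-1%:R.
have m10 : 0 <= m.-1%:R :> R by [].
have K'0 : 0 <= K' by rewrite /K'; lra.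
have yK : 0 < 1 + K by lra.
have [M2 M20 HM2] := Reg_mul m.-1 (ltW yK) K'0.
exists (M2 + K'); first by lra.
move=> a b F k t0 d h a' b' Fj t0ab ba1 h0 hd d1 near cases.
have d0 : 0 < d by lra.
have dn0 : d != 0 by rewrite gt_eqF.
have hm1 : m.-1.+1 = m by rewrite prednK// ltnW.
have h1 : h <= 1 by lra.
case: cases => [[km Fh]|mk|F0].
- have y0 : 0 < d ^+ (m - k) by rewrite exprn_gt0.
  have hm : h ^+ m.-1.+1 <= d ^+ (m - k).
    rewrite hm1; apply: (@le_trans _ _ (d ^+ m)); first by rewrite lerXn2r ?nnegrE ?(ltW h0) ?(ltW d0).
    by apply: ler_wiXn2l; rewrite ?(ltW d0)// leq_subr.
  have lm' l : (l <= m.-1)%N -> (l < m)%N by rewrite -ltnS hm1.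
  have H := jets_Reg (jets_rescale K0 Fj t0ab h0 y0 hm (fun l lm => Fh l (lm' l lm)) near).
  apply: (Reg_mono (K := K')); first by lra.
  apply: eq_Reg H => s _; rewrite expr0 mulrC; congr (_ * cR _).
  have -> : d ^+ m = d ^+ (m - k) * d ^+ k by rewrite -exprD subnK// ltnW.
  by field; rewrite !expf_neq0.
- have hm : h ^+ m.-1.+1 <= 1 + K.
    by apply: le_trans (exprn_ile1 _ (ltW h0) h1) _; lra.
  have Fl l : (l <= m.-1)%N -> nm (F l t0) * h ^+ l <= 1 + K.
    move=> lm; have [Fb _ _] := Fj; have := Fb l lm t0 t0ab.
    have : nm (F l t0) * h ^+ l <= nm (F l t0) by rewrite ler_piMr ?nm_ge0// exprn_ile1// ltW.
    by lra.
  have H := jets_Reg (jets_rescale K0 Fj t0ab h0 yK hm Fl near).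
  have cb : nm (cR ((1 + K) * (d ^+ k / d ^+ m))) <= 1 + K.
    rewrite nm_cR ger0_norm; last by rewrite mulr_ge0 ?divr_ge0 ?exprn_ge0// ?(ltW d0) ?(ltW yK).
    rewrite ler_piMr ?(ltW yK)//.
    by rewrite ler_pdivrMr ?exprn_gt0// mul1r; apply: ler_wiXn2l; rewrite ?(ltW d0).
  have H' := HM2 _ _ _ _ ba1 (Reg_cst a' b' m.-1 cb) H.
  apply: (Reg_mono (K := M2)); first by lra.
  apply: eq_Reg H' => s _; rewrite expr0 mulrA [RHS]mulrC -rmorphM; congr (cR _ * _).
  by field; rewrite expf_neq0//= gt_eqF.
- apply: (eq_Reg (f := fun=> 0)); last by apply: Reg_cst; rewrite nm0; lra.
  by move=> s /near[sb _]; rewrite F0// mul0r.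
Qed.

(** Dominance at time 0 persists for a short time c1. Of the factor 4, one half is spent on the
    possible halving of |q m|, the other on the variation eta of q k. *)
Lemma dominant_normalization (n j : nat) K tau e0 : 0 <= K -> 0 < tau -> tau <= 1 ->
  0 < e0 -> e0 <= 1 -> exists c1 K6 : R, [/\ 0 < c1 <= 1, 0 <= K6 &
  forall a b (q : nat -> R -> C) m e, a <= 0 <= b -> b - a <= c1 ->
  (forall k, Reg a b j K (q k)) -> (m <= n)%N -> e0 <= e <= 1 -> e0 <= nm (q m 0) ->
  (forall k, (k <= n)%N -> k != m -> nm (q k 0) * e ^+ k <= tau / 4 * (nm (q m 0) * e ^+ m)) ->
  [/\ forall s, a <= s <= b -> q m s != 0,
     forall k, (k <= n)%N -> Reg a b j K6 (fun s => cR (e ^+ k / e ^+ m) * (q k s * (q m s)^-1))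
   & forall k s, a <= s <= b -> (k <= n)%N -> k != m ->
     nm (cR (e ^+ k / e ^+ m) * (q k s * (q m s)^-1)) <= tau]].
Proof.
move=> K0 tau0 tau1 e00 e01.
have e0n : 0 < e0 ^+ n by rewrite exprn_gt0.
have e0n1 : e0 ^+ n <= 1 by rewrite exprn_ile1// ltW.
have [eta [eta0 etaE etae]] : exists eta : R, [/\ 0 < eta, eta * 4 = tau * (e0 * e0 ^+ n) & eta <= e0 / 4].
  exists (tau * (e0 * e0 ^+ n) / 4); split.
  - by rewrite divr_gt0// mulr_gt0// mulr_gt0.
  - by rewrite divfK.
  - have h1 : e0 * e0 ^+ n <= e0 by rewrite ler_piMr// ltW.
    have h2 : tau * (e0 * e0 ^+ n) <= 1 * e0 by apply: ler_pM; rewrite ?mulr_ge0 ?(ltW e00) ?(ltW e0n) ?(ltW tau0).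
    by lra.
have [c1 [c10 c11 c1K]] : exists c1 : R, [/\ 0 < c1, c1 <= 1 & 2 * K * c1 <= eta].
  exists (Num.min 1 (eta / (2 * K + 1))); split.
  - by rewrite lt_min ltr01 divr_gt0//; lra.
  - by rewrite ge_min lexx.
  - apply: (@le_trans _ _ ((2 * K + 1) * Num.min 1 (eta / (2 * K + 1)))).
      rewrite ler_wpM2r; [by []| |lra].
      by rewrite le_min ler01 divr_ge0 ?(ltW eta0)//; lra.
    by rewrite mulrC -ler_pdivlMr ?ge_min ?lexx ?orbT//; lra.
have e02 : 0 < e0 / 2 by rewrite divr_gt0.
have [K5 K50 HK5] := Reg_inv j K0 e02.
have [K5' K5'0 HK5'] := Reg_mul j K0 K50.
have ien : 0 <= (e0 ^+ n)^-1 by rewrite invr_ge0 ltW.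
have [K6 K60 HK6] := Reg_mul j ien K5'0.
exists c1, K6; split=> //; first by rewrite c10.
move=> a b q m e zab ba1' qR mn /andP[e0e e1] qm qdom.
have ba1 : b - a <= 1 by lra.
have ep : 0 < e by lra.
have qclose k s : a <= s <= b -> nm (q k s - q k 0) <= eta.
  move=> sa; apply: le_trans (Reg_lip ba1 (qR k) zab sa) _.
  apply: le_trans c1K; rewrite ler_wpM2l//; first by order_lra.
  by rewrite subr0 ler_norml; lra.
have qlow s : a <= s <= b -> nm (q m 0) / 2 <= nm (q m s).
  move=> sa; have := qclose m s sa; have := nmB (q m s) (q m s - q m 0).
  have -> : q m s - (q m s - q m 0) = q m 0 by ring.
  by order_lra.
have qlow' s : a <= s <= b -> e0 / 2 <= nm (q m s) by move=> /qlow; order_lra.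
have qn0 s : a <= s <= b -> q m s != 0.
  by move=> sa; rewrite -nm_gt0; apply: lt_le_trans (qlow' s sa).
split=> // [k kn|k s sa kn km].
  apply: HK6 => //.
    apply: Reg_cst; rewrite nm_cR ger0_norm ?divr_ge0 ?exprn_ge0 ?(ltW ep)//.
    rewrite ler_pdivrMr ?exprn_gt0// mulrC ler_pdivlMr ?exprn_gt0//.
    apply: (@le_trans _ _ (1 * e0 ^+ n)).
      by rewrite ler_wpM2r ?exprn_ile1// ?(ltW e0n)// ltW.
    rewrite mul1r; apply: (@le_trans _ _ (e0 ^+ m)); first by apply: ler_wiXn2l; rewrite ?(ltW e00).
    by rewrite lerXn2r ?nnegrE ?(ltW e00) ?(ltW ep).
  by apply: HK5' => //; apply: HK5 => //; exact: qlow'.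
rewrite !nmM nmV nm_cR ger0_norm ?divr_ge0 ?exprn_ge0 ?(ltW ep)//.
have qs0 : 0 < nm (q m s) by rewrite nm_gt0 qn0.
have em0 : 0 < e ^+ m by rewrite exprn_gt0.
have -> : e ^+ k / e ^+ m * (nm (q k s) / nm (q m s)) = (nm (q k s) * e ^+ k) / (nm (q m s) * e ^+ m).
  by field; rewrite !gt_eqF.
rewrite ler_pdivrMr ?mulr_gt0//.
have h1 : nm (q k s) <= nm (q k 0) + eta.
  have := qclose k s sa; have := nmD (q k 0) (q k s - q k 0).
  by rewrite addrC subrK; order_lra.
have h2 : nm (q k s) * e ^+ k <= nm (q k 0) * e ^+ k + eta.
  apply: le_trans (ler_wpM2r (exprn_ge0 k (ltW ep)) h1) _.
  by rewrite mulrDl lerD2l ler_piMr ?(ltW eta0)// exprn_ile1// ltW.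
have h3 : nm (q m 0) / 2 * e ^+ m <= nm (q m s) * e ^+ m := ler_wpM2r (ltW em0) (qlow s sa).
have h4 : e0 * e0 ^+ n <= nm (q m 0) * e ^+ m.
  apply: ler_pM; rewrite ?(ltW e00) ?(ltW e0n)//.
  apply: (@le_trans _ _ (e0 ^+ m)); first by apply: ler_wiXn2l; rewrite ?(ltW e00).
  by rewrite lerXn2r ?nnegrE ?(ltW e00) ?(ltW ep).
have h5 := ler_wpM2l (ltW tau0) h4.
have h6 := ler_wpM2l (ltW tau0) h3.
have h7 := qdom k kn km.
rewrite -etaE in h5; move: h2 h5 h6 h7; clear; lra.
Qed.

(** Rescale by d and h, recenter at the rescaled root w0 at time t0, and zoom by the radius e of the
    dominant monomial. Its degree m' is at most m - 1 by [cluster_splits], and nu moves by d e times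
    a root of the smaller cluster. *)
Lemma rescaled_cluster (n m : nat) : (1 < m <= n)%N -> exists2 tau1 : R, 0 < tau1 <= 1 &
  forall K tau, 0 <= K -> 0 < tau -> n.+1%:R * tau < 1 -> exists c1 e0 K6 : R, [/\ 0 < c1 <= 1, 0 < e0 <= 1, 0 <= K6 &
  forall a b (F : nat -> nat -> R -> C) nu q1 q2 t0 d h, b - a <= 1 ->
  (forall k, (k <= n)%N -> jets a b m.-1 K (F k)) ->
  (forall t, a <= t <= b -> [/\ F m 0%N t = 1, F m.-1 0%N t = 0 &
     forall k, (k <= n)%N -> k != m -> nm (F k 0%N t) <= tau1]) ->
  cont a b nu -> (forall t, a <= t <= b -> nm (nu t) <= 2 /\ \sum_(k < n.+1) F k 0%N t * nu t ^+ k = 0) ->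
  a <= q1 -> q1 < q2 -> q2 <= b -> q1 <= t0 <= q2 -> q2 - q1 <= c1 * h -> 0 < h -> h <= d -> d <= 1 ->
  (forall k i, (k < m.-1)%N -> (i < m)%N -> nm (F k i t0) * h ^+ i <= d ^+ (m - k)) ->
  (exists2 k0, (k0 < m.-1)%N & nm (F k0 0%N t0) = d ^+ (m - k0)) ->
  exists m' e (c : nat -> R -> C) lam, [/\ (0 < m' < m)%N, e0 <= e <= 1,
     forall t, nu t = nu t0 + cR (d * e) * lam ((t - t0) / h) &
     root_cluster m' n K6 tau ((q1 - t0) / h) ((q2 - t0) / h) c lam]].
Proof.
move=> /andP[m1 mn].
pose B : R := 2 ^+ n; have B1 : 1 <= B by rewrite exprn_ege1// ler1n.
have B0 : 0 < B by order_lra.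
have n10 : 1 <= n.+1%:R :> R by rewrite ler1n.
have binB l k : (l <= n)%N -> 'C(l, k)%:R <= B.
  by move=> ln; rewrite /B -natrX ler_nat; apply: leq_trans (bin_le_expn l k) _; rewrite leq_exp2l.
(* [cluster_splits] is applied with B tau1, since |nu t0| <= 2 turns a coefficient above m into a
   term of size B tau1; this requires (n + 1) B (B tau1) <= 1/2. *)
pose tau1 := (2 * (n.+1%:R * (B * B)))^-1.
have D0 : 0 < 2 * (n.+1%:R * (B * B)) by rewrite !mulr_gt0//; order_lra.
have t10 : 0 < tau1 by rewrite invr_gt0.
have tE : n.+1%:R * (B * (B * tau1)) = 2^-1.
  rewrite /tau1; field; rewrite -/B; apply/andP; split; rewrite gt_eqF//; order_lra.
have BB : B * tau1 <= B * (B * tau1) by rewrite ler_peMl// mulr_ge0// ltW.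
have tB : tau1 <= B * tau1 by rewrite ler_peMl// ltW.
have tE' : n.+1%:R * (B * tau1) <= 2^-1 by rewrite -tE ler_wpM2l.
have nBB : B * tau1 <= n.+1%:R * (B * tau1) by rewrite ler_peMl// mulr_ge0// ltW.
have t11 : tau1 <= 1 by order_lra.
exists tau1; first by rewrite t10.
move=> K tau K0 tau0 ntau.
have taule1 : tau <= 1.
  have : 1 * tau <= n.+1%:R * tau by rewrite ler_wpM2r// ltW.
  order_lra.
have [K2 K20 HK2] := rescaled_Reg m1 K0.
pose Wc : R := B * (2 * m%:R) ^+ n.
have mR1 : 1 <= m%:R :> R by rewrite ler1n ltnW.
have Wc0 : 0 <= Wc by rewrite mulr_ge0 ?exprn_ge0 ?mulr_ge0// ltW.
have [K3 K30 HK3] := Reg_mul m.-1 K20 Wc0.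
pose K4 := n.+1%:R * K3 + 1.
have K40 : 0 <= n.+1%:R * K3 by rewrite mulr_ge0.
have K41 : 1 <= K4 by rewrite /K4; order_lra.
pose kap : R := (2 * (1 + n.+1%:R * 2 ^+ n))^-1.
have kap0 : 0 < kap by rewrite invr_gt0 mulr_gt0// addr_gt0// mulr_gt0// ?exprn_gt0//; order_lra.
have m1n : (m.-1 <= n)%N by apply: leq_trans (leq_pred m) mn.
have tau40 : 0 < tau / 4 by rewrite divr_gt0.
have tau41 : tau / 4 <= 1 by order_lra.
have [e0 /andP[e00 e01] dom] := dominant_index m1n kap0 tau40 tau41 K41.
have K40' : 0 <= K4 by order_lra.
have [c1 [K6' [/andP[c10 c11] K6'0 norm]]] := dominant_normalization n m.-1 K40' tau0 taule1 e00 e01.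
(* A cluster of m' roots asks for order m' - 1 only; each order given up doubles the constant. *)
have lowReg k : (k <= m.-1)%N -> exists2 Mk : R, 0 <= Mk & forall a b f, b - a <= 1 ->
    Reg a b m.-1 K6' f -> Reg a b k Mk f.
  elim: {k}(m.-1) K6' K6'0 {norm} => [|j IH] Kj Kj0 in k *.
    by rewrite leqn0 => /eqP ->; exists Kj.
  rewrite leq_eqVlt => /orP[/eqP ->|]; first by exists Kj.
  rewrite ltnS => kj; have [|M M0 HM] := IH (2 * Kj) _ k kj; first order_lra.
  by exists M => // a b f ab1 fR; apply: HM => //; apply: Reg_le fR.
have [Kl HKl] : exists Kl : nat -> R, forall k, 0 <= Kl k /\ ((k <= m.-1)%N -> forall a b f, b - a <= 1 ->
    Reg a b m.-1 K6' f -> Reg a b k (Kl k) f).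
  have : forall k, exists M : R, 0 <= M /\ ((k <= m.-1)%N -> forall a b f, b - a <= 1 ->
    Reg a b m.-1 K6' f -> Reg a b k M f).
    move=> k; have [km|] := leqP k m.-1; last by exists 0.
    by have [M M0 HM] := lowReg k km; exists M.
  by move/choice => [Kl HKl]; exists Kl.
have [K6 K60 HK6] := exists_upper m Kl.
exists c1, e0, K6; split=> //; [by rewrite c10|by rewrite e00|].
move=> a b F nu q1 q2 t0 d h ab1 Fj Ft nuc nur aq1 q12 q2b t0q qc h0 hd d1 Fh [k0 k0m Fk0].
have d0 : 0 < d by order_lra.
have dn0 : d != 0 by rewrite gt_eqF.
have t0ab : a <= t0 <= b by order_lra.
set a' := (q1 - t0) / h; set b' := (q2 - t0) / h.
have a'b' : a' < b' by rewrite ltr_pM2r ?invr_gt0//; order_lra.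
have ba' : b' - a' <= c1.
  have -> : b' - a' = (q2 - q1) / h by rewrite /a' /b'; field; rewrite gt_eqF.
  by rewrite ler_pdivrMr.
have ba1 : b' - a' <= 1 by order_lra.
have a'0 : a' <= 0 by rewrite ler_pdivrMr// mul0r; order_lra.
have b'0 : 0 <= b' by rewrite ler_pdivlMr// mul0r; order_lra.
have zab : a' <= 0 <= b' by rewrite a'0.
have sP s : a' <= s <= b' -> q1 <= t0 + h * s <= q2.
  rewrite ler_pdivrMr// ler_pdivlMr//; order_lra.
have sab s : a' <= s <= b' -> a <= t0 + h * s <= b by move=> /sP; order_lra.
pose u k s : C := F k 0%N (t0 + h * s) * cR (d ^+ k / d ^+ m).
have uR k : (k <= n)%N -> Reg a' b' m.-1 K2 (u k).
  move=> kn; apply: (HK2 a b (F k) k t0 d h a' b' (Fj k kn) t0ab ba1 h0 hd d1).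
    by move=> s sa; split; [exact: sab|rewrite ler_norml; order_lra].
  have [km|km|km] := ltngtP k m.-1.
  - apply: Or31; split; first exact: leq_trans km (leq_pred m).
    by move=> l lm; apply: Fh.
  - by apply: Or32; rewrite -(prednK (ltnW m1)).
  - by apply: Or33 => x xab; rewrite km; have [_ -> _] := Ft _ xab.
pose w0 : C := nu t0 / cR d.
have cRd0 : cR d != 0 by rewrite -nm_gt0 nm_cR normr_gt0.
have nu0 : nm (nu t0) <= 2 * m%:R * d.
  have [cm cm1 ct] := Ft t0 t0ab; have [nu2 nusum] := nur t0 t0ab.
  apply: (@root_bound R n m (fun k => F k 0%N t0) (nu t0) d tau1) => //.
  - by rewrite mn (ltnW m1).
  - move=> k km; have [km1|km1] := ltnP k m.-1.
      by have := Fh k 0%N km1 (ltnW m1); rewrite expr0 mulr1.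
    have -> : k = m.-1 by apply/eqP; rewrite eqn_leq km1 andbT -ltnS prednK// ltnW.
    by rewrite cm1 nm0 exprn_ge0// ltW.
  - by move=> k /andP[mk kn]; apply: ct; rewrite ?gtn_eqF.
  - exact: ltW.
have w0b : nm w0 <= 2 * m%:R by rewrite nm_div nm_cR gtr0_norm// ler_pdivrMr.
(* Shifting by the constant w0, rather than by the moving root, preserves the regularity in s and
   gives q 0 = 0 at s = 0. *)
pose q k s := shiftc n (fun l => u l s) w0 k.
have qR k : Reg a' b' m.-1 K4 (q k).
  apply: (Reg_mono (K := n.+1%:R * K3)); first by rewrite /K4; order_lra.
  apply: (Reg_sum (F := fun l s => 'C(l, k)%:R * u l s * w0 ^+ (l - k)) K30) => l ln.
  apply: (eq_Reg (f := fun s => u l s * ('C(l, k)%:R * w0 ^+ (l - k)))); first by move=> s _; ring.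
  apply: HK3 => //; first exact: uR.
  apply: Reg_cst; rewrite nmM nm_nat nmX; apply: ler_pM; rewrite ?exprn_ge0 ?nm_ge0 ?binB//.
  apply: (@le_trans _ _ ((2 * m%:R) ^+ (l - k))); first by rewrite lerXn2r ?nnegrE ?nm_ge0 ?mulr_ge0.
  by apply: ler_weXn2l; [order_lra|apply: leq_trans (leq_subr _ _) _].
have qroot s w : a' <= s <= b' -> nu (t0 + h * s) = cR d * (w0 + w) ->
    \sum_(k < n.+1) q k s * w ^+ k = 0.
  move=> /sab sb nuE; rewrite -shiftcE; have [_ Fs] := nur _ sb.
  have : (cR (d ^+ m))^-1 * (\sum_(k < n.+1) F k 0%N (t0 + h * s) * nu (t0 + h * s) ^+ k) = 0.
    by rewrite Fs mulr0.
  move=> H0; rewrite -[RHS]H0 mulr_sumr; apply: eq_bigr => k _; rewrite nuE exprMn /u.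
  rewrite rmorphM fmorphV !rmorphXn /=.
  by ring.
have q00 : q 0%N 0 = 0.
  have := qroot 0 0 zab; rewrite mulr0 !addr0 /w0 mulrC divfK// => /(_ erefl).
  by rewrite big_ord_recl expr0 mulr1 big1 ?addr0// => i _; rewrite exprS mul0r mulr0.
have u0 k : u k 0 = F k 0%N t0 * cR (d ^+ k / d ^+ m) by rewrite /u mulr0 addr0.
have [cm cm1 ct] := Ft t0 t0ab.
have dmk k : (k <= m)%N -> nm (F k 0%N t0) <= d ^+ (m - k) -> nm (u k 0) <= 1.
  move=> km H; rewrite u0 nmM nm_cR ger0_norm ?divr_ge0 ?exprn_ge0 ?(ltW d0)//.
  have -> : d ^+ m = d ^+ (m - k) * d ^+ k by rewrite -exprD subnK.
  rewrite mulrA ler_pdivrMr ?mulr_gt0 ?exprn_gt0// mul1r.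
  by rewrite ler_wpM2r// exprn_ge0// ltW.
have qk : exists2 k, (0 < k <= m.-1)%N & kap <= nm (q k 0).
  apply: (@cluster_splits R n m k0 (fun l => u l 0) w0 (B * tau1)) => //.
  - by rewrite m1.
  - by rewrite u0 cm divff ?expf_neq0// mul1r.
  - by rewrite u0 cm1 mul0r.
  - exact: leq_trans k0m (leq_pred m).
  - rewrite u0 nmM nm_cR Fk0 ger0_norm ?divr_ge0 ?exprn_ge0 ?(ltW d0)//.
    rewrite mulrA -exprD subnK ?divff ?expf_neq0//.
    exact: leq_trans (ltnW k0m) (leq_pred m).
  - move=> k kn; have [km|mk] := leqP k m.
      apply: dmk => //; have [km1|km1] := ltnP k m.-1.
        by have := Fh k 0%N km1 (ltnW m1); rewrite expr0 mulr1.
      move: km; rewrite leq_eqVlt => /orP[/eqP ->|km]; first by rewrite cm nm1 subnn.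
      have -> : k = m.-1 by apply/eqP; rewrite eqn_leq km1 andbT -ltnS prednK// ltnW.
      by rewrite cm1 nm0 exprn_ge0// ltW.
    rewrite u0 nmM nm_cR ger0_norm ?divr_ge0 ?exprn_ge0 ?(ltW d0)//.
    have h1 : nm (F k 0%N t0) <= 1 by apply: le_trans t11; apply: ct; rewrite ?gtn_eqF.
    have h2 : d ^+ k / d ^+ m <= 1.
      by rewrite ler_pdivrMr ?exprn_gt0// mul1r; apply: ler_wiXn2l; rewrite ?(ltW d0)// ltnW.
    rewrite -[leRHS]mulr1; apply: ler_pM; rewrite ?nm_ge0//.
    by rewrite divr_ge0 ?exprn_ge0 ?(ltW d0).
  - move=> k /andP[mk kn]; rewrite u0.
    have -> : F k 0%N t0 * cR (d ^+ k / d ^+ m) * w0 ^+ (k - m) = F k 0%N t0 * nu t0 ^+ (k - m).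
      rewrite -mulrA; congr (_ * _); rewrite /w0 expr_div_n.
      have -> : d ^+ k = d ^+ (k - m) * d ^+ m by rewrite -exprD subnK// ltnW.
      rewrite mulfK ?expf_neq0// rmorphXn /= mulrCA divff ?mulr1//.
      by rewrite expf_neq0.
    rewrite nmM mulrC; apply: ler_pM; rewrite ?nm_ge0//; last by apply: ct; rewrite ?gtn_eqF.
    have [nu2 _] := nur t0 t0ab.
    rewrite nmX; apply: (@le_trans _ _ (2 ^+ (k - m))); first by rewrite lerXn2r ?nnegrE ?nm_ge0.
    by apply: ler_weXn2l; rewrite ?ler1n//; apply: leq_trans (leq_subr _ _) _.
  - by rewrite mulr_ge0// ltW.
  - by rewrite tE.
have qK k : (k <= n)%N -> nm (q k 0) <= K4 by move=> _; exact: Reg_bdd (qR k) 0 zab.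
have [m' [e [/andP[m'0 m'm] /andP[e0e e1] qm' qdom]]] := dom (fun k => q k 0) qK q00 qk.
have ep : 0 < e by order_lra.
have m'lt : (m' < m)%N by rewrite -(prednK (ltnW m1)) ltnS.
have m'n : (m' <= n)%N by apply: leq_trans (ltnW m'lt) mn.
have [|qn0 cR' cs] := norm a' b' q m' e zab ba' qR m'n _ qm' qdom; first by rewrite e0e.
pose c k s : C := cR (e ^+ k / e ^+ m') * (q k s * (q m' s)^-1).
pose lam s : C := (nu (t0 + h * s) / cR d - w0) / cR e.
have cRe0 : cR e != 0 by rewrite -nm_gt0 nm_cR normr_gt0 gt_eqF.
have nuE s : nu (t0 + h * s) = cR d * (w0 + cR e * lam s).
  by rewrite /lam; field; rewrite cRd0 cRe0.
have cm's s : a' <= s <= b' -> c m' s = 1.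
  by move=> /qn0 h1; rewrite /c !divff ?mul1r ?rmorph1// expf_neq0// gt_eqF.
have croot s : a' <= s <= b' -> \sum_(k < n.+1) c k s * lam s ^+ k = 0.
  move=> sa; have := qroot s _ sa (nuE s) => H.
  have -> : \sum_(k < n.+1) c k s * lam s ^+ k =
     (cR (e ^+ m') * q m' s)^-1 * \sum_(k < n.+1) q k s * (cR e * lam s) ^+ k.
    rewrite mulr_sumr; apply: eq_bigr => k _; rewrite /c [(cR e * lam s) ^+ k]exprMn rmorphM fmorphV invfM !rmorphXn /=.
    by ring.
  by rewrite H mulr0.
have lam0 : lam 0 = 0 by rewrite /lam mulr0 addr0 subrr mul0r.
have lamc : cont a' b' lam.
  move=> x xa ee ee0.
  have de0 : 0 < ee * (d * e) by rewrite !mulr_gt0.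
  have [del del0 H] := nuc _ (sab x xa) _ de0.
  exists (del / h); first by rewrite divr_gt0.
  move=> y ya; rewrite ltr_pdivlMr// => yx.
  have := H _ (sab y ya); have -> : t0 + h * y - (t0 + h * x) = h * (y - x) by ring.
  rewrite normrM gtr0_norm// mulrC => /(_ yx).
  rewrite !nuE; have -> : cR d * (w0 + cR e * lam y) - cR d * (w0 + cR e * lam x) =
    cR (d * e) * (lam y - lam x) by rewrite rmorphM /=; ring.
  by rewrite nmM nm_cR gtr0_norm ?mulr_gt0// mulrC ltr_pM2r ?mulr_gt0.
(* If |lam| = 1, the equation would give 1 <= (n + 1) tau, contrary to the choice of tau. *)
have lam1 : forall s, a' <= s <= b' -> nm (lam s) <= 1.
  apply: (barrier lamc zab lam0) => s sa; apply/eqP => l1.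
  have := croot s sa; rewrite (bigD1 (Ordinal (m'n : (m' < n.+1)%N))) //= cm's// mul1r => /eqP.
  rewrite addr_eq0 => /eqP /(congr1 (@nm R)); rewrite nmN nmX l1 expr1n => H.
  have : 1 <= n.+1%:R * tau; last by rewrite leNgt ntau.
  rewrite {1}H; apply: le_trans (nm_sum _ _ _) _; rewrite big_mkcond.
  apply: (@le_trans _ _ (\sum_(k < n.+1) tau)); last by rewrite sumr_const card_ord mulr_natl.
  apply: ler_sum => k _; case: ifP => [|_]; last exact: ltW.
  rewrite -val_eqE /= => km; rewrite nmM nmX l1 expr1n mulr1.
  by apply: (cs k s) => //; rewrite -ltnS.
exists m', e, c, lam; split=> //.
- by rewrite m'0.
- by rewrite e0e.
- move=> t; have := nuE ((t - t0) / h).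
  have -> : t0 + h * ((t - t0) / h) = t by field; rewrite gt_eqF.
  move=> ->; rewrite /w0 rmorphM /=; field; exact: cRd0.
- split=> //.
  + move=> k kn; have [_ /(_ (leq_trans (leq_pred _) m'm)) Hk] := HKl m'.-1.
    apply: Reg_mono (Hk _ _ _ ba1 (cR' k kn)); apply: HK6.
    exact: leq_ltn_trans (leq_pred _) m'lt.
  + by move=> s sa; split; [exact: cm's|move=> k kn km; exact: (cs k s)].
  + by move=> s sa; split; [exact: lam1|exact: croot].
Qed.

End ChildEstimate.

(** * Induction on the size of the cluster *)

Section RootEstimate.
Variable R : realType.
Local Notation C := (Rcomplex R).
Implicit Types (a b c d x y t K M p : R) (f g : R -> C) (L Q : seq (R * R)).

Lemma sum_cover_fin (I : finType) (Q : seq (R * R)) (w : R * R -> R) (P0 : pred (R * R))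
    (P : I -> pred (R * R)) :
  (forall q, q \in Q -> 0 <= w q) ->
  (forall q, q \in Q -> P0 q \/ exists l, P l q) ->
  \sum_(q <- Q) w q <= \sum_(q <- Q | P0 q) w q + \sum_(l : I) \sum_(q <- Q | P l q) w q.
Proof.
move=> w0 cov; rewrite [X in X + _]big_mkcond /=.
under [X in _ + X]eq_bigr do rewrite big_mkcond.
rewrite exchange_big /= -big_split /= big_seq [leRHS]big_seq; apply: ler_sum => q qQ.
have pos l : 0 <= (if P l q then w q else 0) by case: ifP => // _; exact: w0.
have [->|[l Pl]] := cov q qQ; first by rewrite lerDl sumr_ge0.
apply: (@le_trans _ _ (\sum_l if P l q then w q else 0)).
  by rewrite (bigD1 l) //= Pl lerDl sumr_ge0.
by rewrite lerDr; case: ifP => // _; exact: w0.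
Qed.

Lemma powR_pred (x p : R) : 0 < x -> x `^ p = x `^ (p - 1) * x.
Proof.
move=> x0; rewrite -[in LHS](subrK 1 p) [LHS]powRD ?powRr1 ?(ltW x0)//.
by apply/implyP => _; rewrite gt_eqF.
Qed.

(** The summand A^p / u^(p - 1) decreases in u. *)
Lemma rvar_shrink p (A u v : R) : 1 <= p -> 0 <= A -> 0 < u -> u <= v ->
  v * (A / v) `^ p <= u * (A / u) `^ p.
Proof.
move=> p1 A0 u0 uv; have v0 : 0 < v by lra.
have E w : 0 < w -> w * (A / w) `^ p = A * (A / w) `^ (p - 1).
  move=> w0; have [->|An0] := eqVneq A 0.
    by rewrite !mul0r powR0 ?mulr0//; apply/eqP; lra.
  have Aw0 : 0 < A / w by rewrite divr_gt0// lt_def An0.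
  by rewrite powR_pred// mulrCA [w * _]mulrC divfK ?gt_eqF// mulrC.
rewrite !E// ler_wpM2l//; apply: ge0_ler_powR; rewrite ?nnegrE ?divr_ge0 ?(ltW u0) ?(ltW v0)//; first lra.
by rewrite ler_wpM2l// lef_pV2.
Qed.

(** Scales exist only where some coefficient below m is nonzero, and elsewhere the centered root
    vanishes. If [x, y] meets the zero set, it is replaced by an interval from x ending just before
    the first zero and one starting just after the last zero up to y. They retain half of |f x| and
    of |f y|: one factor 2^p pays for this, the other for splitting |f y - f x|. *)
Lemma positive_interval p f (pos : R -> Prop) x y : 1 <= p -> x < y -> cont x y f ->
  (forall t, x <= t <= y -> ~ pos t -> f t = 0) ->
  exists L, [/\ chain x y L, (forall q t, q \in L -> q.1 <= t <= q.2 -> pos t)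
    & rvar p f x y <= 2 `^ p * 2 `^ p * \sum_(q <- L) rvar p f q.1 q.2].
Proof.
move=> p1 xy fc f0.
have tp1 : 1 <= 2 `^ p :> R.
  by have := @ler_powR R 2 (ler1n _ 2) 0 p; rewrite powRr0; apply; lra.
have tp0 : 0 <= 2 `^ p :> R by lra.
have tpp : 1 <= 2 `^ p * 2 `^ p :> R by have := ler_pM ler01 ler01 tp1 tp1; rewrite mulr1.
pose Z := [set t | x <= t <= y /\ ~ pos t].
have [[z0 z0Z]|nZ] := pselect (Z !=set0); last first.
  exists [:: (x, y)]; split=> [|q t|]; first by rewrite /= !lexx xy.
    rewrite inE => /eqP -> /= txy; apply: contrapT => npos; apply: nZ; by exists t.
  rewrite big_seq1 ler_peMl//; apply: rvar_ge0; exact: ltW.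
have lowZ : has_inf Z by split; [exists z0|exists x => t [/andP[]]].
have supZ : has_sup Z by split; [exists z0|exists y => t [/andP[]]].
have iz0 := ge_inf (proj2 lowZ) z0Z.
have sz0 := ub_le_sup (proj2 supZ) z0Z.
have [z0xy z0n] := z0Z.
have xi : x <= inf Z by apply: lb_le_inf; [exists z0|move=> t [/andP[]]].
have sy : sup Z <= y by apply: ge_sup; [exists z0|move=> t [/andP[]]].
have ixy : x <= inf Z <= y by lra.
have sxy : x <= sup Z <= y by lra.
have approx z : x <= z <= y -> (forall e, 0 < e -> exists2 t, Z t & `|t - z| < e) -> f z = 0.
  move=> zxy H; apply/eqP; rewrite -nm_eq0; apply/eqP/le_anti; rewrite nm_ge0 andbT.
  rewrite leNgt; apply/negP => fz; have [d d0 Hd] := fc z zxy _ fz.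
  have [t [txy tn] td] := H d d0.
  by have := Hd t txy td; rewrite (f0 t txy tn) sub0r nmN ltxx.
have fi : f (inf Z) = 0.
  apply: approx => // e e0; have [t tZ te] := inf_adherent e0 lowZ.
  exists t => //; rewrite ger0_norm; first by lra.
  by rewrite subr_ge0; exact: (ge_inf (proj2 lowZ) tZ).
have fs : f (sup Z) = 0.
  apply: approx => // e e0; have [t tZ te] := sup_adherent e0 supZ.
  exists t => //; rewrite ler0_norm; first by lra.
  by rewrite subr_le0; exact: (ub_le_sup (proj2 supZ) tZ).
have posl t : x <= t -> t < inf Z -> pos t.
  move=> xt tz; apply: contrapT => npos.
  by have := ge_inf (proj2 lowZ) (conj _ npos : Z t); move=> /(_ ltac:(order_lra)); order_lra.
have posr t : sup Z < t -> t <= y -> pos t.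
  move=> tz ty; apply: contrapT => npos.
  by have := ub_le_sup (proj2 supZ) (conj _ npos : Z t); move=> /(_ ltac:(order_lra)); order_lra.
have yx0 : 0 < y - x by rewrite subr_gt0.
pose V w := (y - x) * (nm (f w) / (y - x)) `^ p.
have half w u v : x <= u -> u < v -> v <= y -> nm (f w) / 2 <= nm (f v - f u) -> V w <= 2 `^ p * rvar p f u v.
  move=> xu uv vy H; rewrite /rvar.
  have uv0 : 0 < v - u by rewrite subr_gt0.
  have H' : nm (f w) / (y - x) <= 2 * (nm (f v - f u) / (y - x)).
    by rewrite mulrA ler_wpM2r ?invr_ge0 ?(ltW yx0)//; lra.
  have uvxy : v - u <= y - x by lra.
  apply: (@le_trans _ _ ((y - x) * (2 * (nm (f v - f u) / (y - x))) `^ p)).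
    have A0 z : 0 <= nm z / (y - x) by rewrite divr_ge0 ?nm_ge0// ltW.
    have A1 z : 0 <= 2 * (nm z / (y - x)) by rewrite mulr_ge0.
    by rewrite /V ler_wpM2l ?(ltW yx0)//; apply: ge0_ler_powR; rewrite ?nnegrE//; order_lra.
  rewrite powRM ?divr_ge0 ?nm_ge0 ?(ltW yx0)// mulrCA ler_wpM2l//.
  by apply: rvar_shrink; rewrite ?nm_ge0.
have [L1 [ch1 po1 V1]] : exists L1, [/\ chain x (inf Z) L1,
    (forall q t, q \in L1 -> q.1 <= t <= q.2 -> pos t) & V x <= 2 `^ p * \sum_(q <- L1) rvar p f q.1 q.2].
  have [fx0|fx0] := eqVneq (f x) 0.
    exists [::]; split=> //; rewrite big_nil mulr0 /V fx0 nm0 mul0r powR0 ?mulr0//.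
    by apply/eqP; lra.
  have fxp : 0 < nm (f x) by rewrite nm_gt0.
  have [d d0 Hd] := fc (inf Z) ixy _ (ltac:(by rewrite divr_gt0) : 0 < nm (f x) / 2).
  have xi' : x < inf Z by rewrite lt_neqAle xi andbT; apply: contraNneq fx0 => ->; rewrite fi.
  pose v := Num.max ((x + inf Z) / 2) (inf Z - d / 2).
  have xv : x < v by rewrite lt_max; apply/orP; left; order_lra.
  have vi : v < inf Z by rewrite gt_max; apply/andP; split; order_lra.
  have vd : `|v - inf Z| < d.
    rewrite ltr0_norm; last by order_lra.
    have : inf Z - d / 2 <= v by rewrite le_max lexx orbT.
    order_lra.
  have vxy : x <= v <= y by order_lra.
  have := Hd v vxy vd; rewrite fi subr0 => fv.
  exists [:: (x, v)]; split=> [|q t|]; first by rewrite /= lexx xv (ltW vi).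
    by rewrite inE => /eqP -> /= /andP[xt tv]; apply: posl => //; order_lra.
  rewrite big_seq1 /=; apply: (half x); [order_lra|order_lra|order_lra|].
  have := nmB (f v) (f v - f x); rewrite opprB addrC subrK; order_lra.
have [L2 [ch2 po2 V2]] : exists L2, [/\ chain (sup Z) y L2,
    (forall q t, q \in L2 -> q.1 <= t <= q.2 -> pos t) & V y <= 2 `^ p * \sum_(q <- L2) rvar p f q.1 q.2].
  have [fx0|fx0] := eqVneq (f y) 0.
    exists [::]; split=> //; rewrite big_nil mulr0 /V fx0 nm0 mul0r powR0 ?mulr0//.
    by apply/eqP; lra.
  have fxp : 0 < nm (f y) by rewrite nm_gt0.
  have [d d0 Hd] := fc (sup Z) sxy _ (ltac:(by rewrite divr_gt0) : 0 < nm (f y) / 2).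
  have sy' : sup Z < y by rewrite lt_neqAle sy andbT; apply: contraNneq fx0 => <-; rewrite fs.
  pose v := Num.min ((y + sup Z) / 2) (sup Z + d / 2).
  have vy : v < y by rewrite gt_min; apply/orP; left; order_lra.
  have sv : sup Z < v by rewrite lt_min; apply/andP; split; order_lra.
  have vd : `|v - sup Z| < d.
    rewrite gtr0_norm; last by order_lra.
    have : v <= sup Z + d / 2 by rewrite ge_min lexx orbT.
    order_lra.
  have vxy : x <= v <= y by order_lra.
  have := Hd v vxy vd; rewrite fs subr0 => fv.
  exists [:: (v, y)]; split=> [|q t|]; first by rewrite /= (ltW sv) vy lexx.
    by rewrite inE => /eqP -> /= /andP[vt ty]; apply: posr => //; order_lra.
  rewrite big_seq1 /=; apply: (half y); [order_lra|order_lra|order_lra|].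
  have := nmD (f v) (f y - f v); rewrite addrC subrK; order_lra.
exists (L1 ++ L2); split.
- by apply: chain_cat ch1 (chain_widenl _ ch2); order_lra.
- by move=> q t; rewrite mem_cat => /orP[/po1|/po2]; apply.
rewrite big_cat /=; apply: (@le_trans _ _ (2 `^ p * (V x + V y))).
  rewrite /rvar /V -mulrDr mulrCA ler_wpM2l ?(ltW yx0)//.
  apply: le_trans (powRD_le _ _ (_ : 0 <= p)); rewrite ?divr_ge0 ?nm_ge0 ?(ltW yx0)//; last order_lra.
  apply: ge0_ler_powR; rewrite ?nnegrE ?addr_ge0 ?divr_ge0 ?nm_ge0 ?(ltW yx0)//; first order_lra.
  by rewrite -mulrDl ler_wpM2r ?invr_ge0 ?(ltW yx0)// [leRHS]addrC nmB.
by rewrite -mulrA ler_wpM2l// mulrDr; exact: lerD.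
Qed.

Lemma positive_chain p f (pos : R -> Prop) a b L : 1 <= p -> cont a b f ->
  (forall t, a <= t <= b -> ~ pos t -> f t = 0) -> chain a b L ->
  exists L', [/\ chain a b L', (forall q t, q \in L' -> q.1 <= t <= q.2 -> pos t)
    & \sum_(q <- L) rvar p f q.1 q.2 <= 2 `^ p * 2 `^ p * \sum_(q <- L') rvar p f q.1 q.2].
Proof.
move=> p1; elim: L a => [|q L IH] a fc f0 /=.
  by move=> ab; exists [::]; rewrite !big_nil mulr0.
case/and3P=> aq q12 chL; have qb := chain_le chL.
have [||L2 [ch2 po2 H2]] := IH q.2 _ _ chL.
- move=> x xq e e0; have [|d d0 Hd] := fc x _ e e0; first lra.
  by exists d => // y yq; apply: Hd; lra.
- by move=> t tq; apply: f0; lra.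
have [||L1 [ch1 po1 H1]] := @positive_interval p f pos q.1 q.2 p1 q12.
- move=> x xq e e0; have [|d d0 Hd] := fc x _ e e0; first lra.
  by exists d => // y yq; apply: Hd; lra.
- by move=> t tq; apply: f0; lra.
exists (L1 ++ L2); split.
- by apply: chain_widenl aq (chain_cat ch1 ch2).
- by move=> r t; rewrite mem_cat => /orP[/po1|/po2]; apply.
by rewrite big_cons big_cat /= mulrDr lerD.
Qed.

(* the scale at t0: d is the size of the cluster and h the time during which it keeps that size *)
Definition jet_scale (m : nat) (F : nat -> nat -> R -> C) t0 d h : Prop := [/\ 0 < h /\ h <= d, d <= 1,
  forall k i, (k < m.-1)%N -> (i < m)%N -> nm (F k i t0) * h ^+ i <= d ^+ (m - k),
  (exists2 k0, (k0 < m.-1)%N & nm (F k0 0%N t0) = d ^+ (m - k0)) &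
  h = d \/ exists k i, [/\ (k < m.-1)%N, (0 < i < m)%N & nm (F k i t0) * h ^+ i = d ^+ (m - k)]].

(** [exists_scale] yields the largest scales, and d is the smallest number with |F k| <= d^(m-k), so
    it is applied to 1/d. The starting value h0 violates the constraint of k1, which forces an
    equality. *)
Lemma jet_scale_exists m F t0 : (forall k, (k < m.-1)%N -> nm (F k 0%N t0) <= 1) ->
  (exists2 k, (k < m.-1)%N & F k 0%N t0 != 0) -> exists d h, jet_scale m F t0 d h.
Proof.
move=> F1 [k1 k1m Fk1].
have mk k : (k < m.-1)%N -> (0 < m - k)%N.
  by move=> km; rewrite subn_gt0 (leq_trans km) ?leq_pred.
have n1 : 0 < nm (F k1 0%N t0) by rewrite nm_gt0.
pose h0 := 1 + (nm (F k1 0%N t0))^-1.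
have h01 : 1 < h0 by rewrite ltrDl invr_gt0.
have h00 : 0 < h0 by lra.
have [|g [g0 gh gs gE]] := @exists_scale R [seq ((m - k)%N, nm (F k 0%N t0)) | k <- iota 0 m.-1] h0 h00.
  by move=> q /mapP[k]; rewrite mem_iota add0n /= => km -> /=; split; [exact: mk|exact: nm_ge0].
have gk k : (k < m.-1)%N -> nm (F k 0%N t0) * g ^+ (m - k) <= 1.
  by move=> km; apply: (gs ((m - k)%N, nm (F k 0%N t0))); apply/mapP; exists k; rewrite ?mem_iota.
pose d := g^-1; have d0 : 0 < d by rewrite invr_gt0.
have gd j : g ^+ j = (d ^+ j)^-1 by rewrite /d exprVn invrK.
have dk k : (k < m.-1)%N -> nm (F k 0%N t0) <= d ^+ (m - k).
  by move=> km; have := gk k km; rewrite gd ler_pdivrMr ?exprn_gt0// mul1r.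
have [k0 k0m k0E] : exists2 k0, (k0 < m.-1)%N & nm (F k0 0%N t0) = d ^+ (m - k0).
  case: gE => [gE|[q /mapP[k + ->] /=]].
    have := gk k1 k1m; rewrite gE leNgt => /negP[].
    apply: (@lt_le_trans _ _ (nm (F k1 0%N t0) * h0)).
      by rewrite /h0 mulrDr divff ?gt_eqF//; lra.
    by rewrite ler_wpM2l ?nm_ge0// ler_eXnr ?mk// ltW.
  rewrite mem_iota add0n /= => km /eqP; rewrite gd => H; exists k => //; apply/eqP.
  by move: H; rewrite -(inj_eq (mulIf (_ : d ^+ (m - k) != 0))) ?mulfVK ?mul1r// expf_neq0// gt_eqF.
have d1 : d <= 1.
  by have := F1 k0 k0m; rewrite k0E expr_le1 ?mk// ltW.
have [|h [hp hd hs hE]] := @exists_scale R [seq (ki.2, nm (F ki.1 ki.2 t0) / d ^+ (m - ki.1)) |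
    ki <- [seq (k, i) | k <- iota 0 m.-1, i <- iota 1 m.-1]] d d0.
  move=> q /mapP[ki /allpairsP[[k i] /= [_ + ->]] -> /=]; rewrite mem_iota => /andP[i0 _].
  by split=> //; rewrite divr_ge0 ?nm_ge0// exprn_ge0// ltW.
have m0 : (0 < m.-1)%N by apply: leq_ltn_trans k1m.
have mE : m.-1.+1 = m by rewrite prednK// (leq_trans m0) ?leq_pred.
exists d, h; split=> //.
- move=> k [|i] km im; first by rewrite expr0 mulr1 dk.
  have := hs (i.+1, nm (F k i.+1 t0) / d ^+ (m - k)).
  rewrite /= mulrAC ler_pdivrMr ?exprn_gt0// mul1r; apply.
  apply/mapP; exists (k, i.+1) => //; apply/allpairsP; exists (k, i.+1); split=> //.
    by rewrite mem_iota.
  by rewrite mem_iota /= add1n mE.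
- by exists k0.
case: hE => [->|[q /mapP[ki /allpairsP[[k i] /= [+ + ->]] -> /=]]]; [by left|].
rewrite !mem_iota add0n add1n mE /= => km im hE; right; exists k, i; split=> //.
by move: hE; rewrite mulrAC => /(canRL (mulfVK _)); rewrite mul1r => ->//; rewrite expf_neq0// gt_eqF.
Qed.

(** An active constraint of order i gives (d/h)^i d^(m-k) <= K d^i. If i >= m - k this bounds d/h,
    so a large ratio comes from some i < m - k, the range of the weak-type bounds. The first
    conclusion limits how small h can be in terms of d. *)
Lemma jet_scale_ratio m F t0 d h K : 0 <= K -> jet_scale m F t0 d h ->
  (forall k i, (k < m.-1)%N -> (i < m)%N -> nm (F k i t0) <= K) ->
  d / h * d ^+ m.-1 <= 1 + K /\ (d / h <= 1 + K \/
    exists k i, [/\ (k < m.-1)%N, (0 < i < m - k)%N & nm (F k i t0) * h ^+ i = d ^+ (m - k)]).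
Proof.
move=> K0 [[h0 hd] d1 Fh _ hE] FK.
have d0 : 0 < d by lra.
have dh1 : 1 <= d / h by rewrite ler_pdivlMr// mul1r.
case: hE => [hE|[k [i [km im hE]]]].
  rewrite hE divff ?gt_eqF// mul1r; split; last by left; lra.
  by apply: (@le_trans _ _ 1); [rewrite exprn_ile1// ltW|lra].
have [i0 im'] := andP im.
have si : (d / h) ^+ i * d ^+ (m - k) <= K * d ^+ i.
  have -> : (d / h) ^+ i * d ^+ (m - k) = nm (F k i t0) * d ^+ i.
    by rewrite -hE expr_div_n; field; rewrite expf_neq0// gt_eqF.
  by rewrite ler_wpM2r ?exprn_ge0 ?(ltW d0)// FK.
have s1 : d / h <= (d / h) ^+ i by rewrite ler_eXnr.
have mk : (m - k <= m)%N by rewrite leq_subr.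
have [ij|ji] := leqP (m - k) i.
  have sK : d / h <= K.
    apply: le_trans s1 _; have dj : 0 < d ^+ (m - k) by rewrite exprn_gt0.
    rewrite -(ler_pM2r dj); apply: le_trans si _; rewrite ler_wpM2l//.
    by apply: ler_wiXn2l; rewrite ?(ltW d0).
  split; last by left; lra.
  apply: (@le_trans _ _ (d / h)); last lra.
  by rewrite ler_piMr ?exprn_ile1 ?(ltW d0)//; lra.
split; last by right; exists k, i; rewrite i0 ji.
have e1 : (d / h) ^+ i * d ^+ (m - k - i) <= K.
  have di : 0 < d ^+ i by rewrite exprn_gt0.
  by rewrite -(ler_pM2r di) -mulrA -exprD subnK// ltnW.
apply: (@le_trans _ _ K); last lra.
apply: le_trans e1; apply: ler_pM; rewrite ?exprn_ge0 ?divr_ge0 ?(ltW d0) ?(ltW h0)//.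
apply: ler_wiXn2l; rewrite ?(ltW d0)//.
by rewrite -subn1; apply: leq_trans (leq_sub2r _ mk) _; apply: leq_sub2l.
Qed.

(** The weight of an undivided interval is d (d/h)^(p-1), and d <= (d^(m-1))^(p-1) because (m - 1)(p
    - 1) <= 1 and d <= 1. *)
Lemma root_weight m d h K p : (0 < m)%N -> 1 <= p -> m.-1%:R * p < m%:R -> 0 < h -> h <= d -> d <= 1 ->
  1 <= K -> d / h * d ^+ m.-1 <= K -> h * (d / h) `^ p <= K `^ p.
Proof.
move=> m0 p1 mp h0 hd d1 K1 H.
have d0 : 0 < d by lra.
have s0 : 0 < d / h by rewrite divr_gt0.
rewrite powR_pred// mulrCA [h * _]mulrC divfK ?gt_eqF//.
have pm0 : 0 <= p - 1 by lra.
have e1 : (d / h) `^ (p - 1) * (d ^+ m.-1) `^ (p - 1) <= K `^ (p - 1).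
  rewrite -powRM ?(ltW s0) ?exprn_ge0 ?(ltW d0)//.
  have q0 : 0 <= d / h * d ^+ m.-1 by rewrite mulr_ge0 ?exprn_ge0// ltW.
  have k0 : 0 <= K by lra.
  by apply: ge0_ler_powR; rewrite ?nnegrE.
have e2 : d <= (d ^+ m.-1) `^ (p - 1).
  rewrite -powR_mulrn ?(ltW d0)// -powRrM -{1}(powRr1 (ltW d0)).
  apply: ger_powR; first by rewrite d0.
  have : m%:R = 1 + m.-1%:R :> R by rewrite -{1}(prednK m0) -natr1 addrC.
  by move: mp => /[swap] ->; lra.
apply: (@le_trans _ _ (K `^ (p - 1))).
  by apply: le_trans e1; rewrite ler_wpM2l// powR_ge0.
by apply: ler_powR => //; lra.
Qed.

End RootEstimate.

(** * Summation over the Whitney intervals and the inductive step *)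

Section RootEstimateP.
Variable R : realType.
Local Notation C := (Rcomplex R).
Implicit Types (a b c d x y t K M p : R) (f g : R -> C) (L Q : seq (R * R)).

(** The intervals with d/h <= 1 + K contribute at most (1 + K)^p. The others are sorted by their
    active constraint (k, i), and each class is handled by [weak_type_sum] for F k with index m - k.
    The bound 2 K pays for truncating the jets to order m - k - 1; the condition on c2 carries the
    relations at t0 to the whole interval up to a factor 2. *)
Lemma scale_sum (m : nat) K p c2 : (0 < m)%N -> 0 <= K -> 1 <= p -> m.-1%:R * p < m%:R ->
  0 < c2 -> c2 <= 1 -> 2 * (1 + K + m.-1%:R) * c2 <= 1 ->
  exists2 S : R, 0 <= S & forall a b (F : nat -> nat -> R -> C) Q (t0 dd hh : R * R -> R), b - a <= 1 ->
  (forall k, (k < m.-1)%N -> jets a b m.-1 K (F k)) -> chain a b Q ->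
  (forall q, q \in Q -> [/\ q.1 <= t0 q <= q.2, jet_scale m F (t0 q) (dd q) (hh q) &
     q.2 - q.1 <= c2 * hh q]) ->
  \sum_(q <- Q) (q.2 - q.1) * (dd q / hh q) `^ p <= S.
Proof.
move=> m0 K0 p1 mp c20 c21 Kc2.
have p0 : 0 <= p by lra.
have K20 : 0 <= 2 * K by lra.
have /choice[B HB] : forall l : 'I_m * 'I_m, exists B : R, 0 <= B /\
  ((0 < l.2 < m - l.1)%N -> forall a b (F : nat -> R -> C) Q (dd hh : R * R -> R), b - a <= 1 ->
   jets a b (m - l.1).-1 (2 * K) F -> chain a b Q ->
   (forall q, q \in Q -> [/\ 0 < dd q, 0 < hh q & forall t, q.1 <= t <= q.2 ->
     nm (F 0%N t) <= 2 * dd q ^+ (m - l.1) /\ dd q ^+ (m - l.1) <= 2 * nm (F l.2 t) * hh q ^+ l.2]) ->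
   \sum_(q <- Q) (q.2 - q.1) * (dd q / hh q) `^ p <= B).
  move=> [k i] /=; have [ik|_] := boolP (0 < i < m - k)%N; last by exists 0.
  have jp : (m - k).-1%:R * p < (m - k)%:R.
    have [->|k0] := posnP k; first by rewrite subn0.
    by apply: (@child_exponent R m) => //; rewrite subn_gt0 ltn_ord /= ltn_subrL k0.
  have [B B0 H] := weak_type_sum ik (@weak_typeP R _ _ ik) p0 jp K20.
  by exists B.
exists ((1 + K) `^ p + \sum_l B l).
  by rewrite addr_ge0 ?powR_ge0// sumr_ge0// => l _; have [] := HB l.
move=> a b F Q t0 dd hh ab1 Fj chQ Qs.
have pos q : q \in Q -> [/\ 0 < dd q, 0 < hh q, hh q <= dd q & a <= t0 q <= b].
  move=> qQ; have [tq [[h0 hd] _ _ _ _] _] := Qs q qQ; have [aq _ qb] := chain_mem chQ qQ.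
  by split=> //; [exact: lt_le_trans h0 hd|case/andP: tq => q1 q2; rewrite (le_trans aq q1) (le_trans q2 qb)].
pose P (l : 'I_m * 'I_m) (q : R * R) := [&& (l.1 < m.-1)%N, (0 < l.2 < m - l.1)%N &
  nm (F l.1 l.2 (t0 q)) * hh q ^+ l.2 == dd q ^+ (m - l.1)].
apply: le_trans (sum_cover_fin (P0 := fun q => dd q / hh q <= 1 + K) (P := P) _ _) _.
- move=> q qQ; rewrite mulr_ge0 ?powR_ge0// subr_ge0 ltW//.
  by have [] := chain_mem chQ qQ.
- move=> q qQ; have [tq js _] := Qs q qQ; have [_ _ _ tab] := pos q qQ.
  have [|_ [H|[k [i [km im H]]]]] := jet_scale_ratio K0 js.
  + move=> k i km im; have [Fb _ _] := Fj k km; apply: Fb => //.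
    by rewrite -ltnS prednK.
  + by left.
  + have km' : (k < m)%N by apply: leq_trans km (leq_pred m).
    have im' : (i < m)%N by case/andP: im => _ /leq_trans; apply; exact: leq_subr.
    by right; exists (Ordinal km', Ordinal im'); rewrite /P /= km im H eqxx.
apply: lerD.
  apply: (@le_trans _ _ (\sum_(q <- Q) (q.2 - q.1) * (1 + K) `^ p)).
    rewrite big_mkcond /= big_seq [leRHS]big_seq; apply: ler_sum => q qQ.
    have [_ q12 _] := chain_mem chQ qQ; have q0 : 0 <= q.2 - q.1 by rewrite subr_ge0 ltW.
    have [d0 h0 _ _] := pos q qQ.
    case: ifP => H; last by rewrite mulr_ge0 ?powR_ge0.
    rewrite ler_wpM2l//; apply: ge0_ler_powR; rewrite ?nnegrE ?divr_ge0 ?(ltW d0) ?(ltW h0)//.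
    by lra.
  rewrite -mulr_suml ler_piMl ?powR_ge0//.
  exact: le_trans (chain_tot chQ) ab1.
apply: ler_sum => -[k i] _; rewrite -big_filter.
have [B0 H] := HB (k, i).
have [|nP] := boolP ((k < m.-1) && (0 < i < m - k))%N; last first.
  rewrite (_ : [seq _ <- _ | _] = [::]) ?big_nil//; apply/eqP; rewrite -[_ == _]negbK -has_filter.
  apply/negP => /hasP[q _]; rewrite /P /= => /and3P[h1 h2 _].
  by move: nP; rewrite h1 h2.
move=> /andP[km ik]; have [i0 imk] := andP ik; apply: (H ik a b (F k)) => //.
- apply: jets_trunc (Fj k km) _ => //.
  by rewrite -!subn1 leq_sub2r// leq_subr.
- exact: chain_filter.
move=> q; rewrite mem_filter => /andP[/and3P[_ _ /= /eqP Fe] qQ].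
have [d0 h0 hd tab] := pos q qQ; have [tq [_ d1 Fh _ _] qc] := Qs q qQ; have [aq _ qb] := chain_mem chQ qQ.
split=> // t tqq.
set y := dd q ^+ (m - k) in Fe *.
have y0 : 0 <= y by rewrite exprn_ge0// ltW.
have hm : hh q ^+ m.-1.+1 <= y.
  rewrite prednK//; apply: (@le_trans _ _ (dd q ^+ m)); first by rewrite lerXn2r ?nnegrE ?(ltW h0) ?(ltW d0).
  by apply: ler_wiXn2l; rewrite ?(ltW d0)// leq_subr.
have th : `|t - t0 q| <= c2 * hh q.
  apply: le_trans qc; move: tqq tq => /andP[? ?] /andP[? ?]; rewrite ler_norml; apply/andP; split; order_lra.
have th' : `|t - t0 q| <= hh q by apply: le_trans th _; rewrite ler_piMl// ltW.
have tab' : a <= t <= b by move: tqq => /andP[? ?]; apply/andP; split; order_lra.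
have F0 l : (0 < l)%N -> (l <= m.-1)%N -> nm (F k l (t0 q)) * hh q ^+ l <= y.
  by move=> _ lm; apply: Fh => //; rewrite -(prednK m0).
have t0t0 : `|t0 q - t0 q| <= hh q by rewrite subrr normr0 ltW.
have [_ HL] := jets_local K0 (Fj k km) tab h0 y0 hm F0 tab' tab th' t0t0.
have close l : (l <= m.-1)%N -> nm (F k l t - F k l (t0 q)) * hh q ^+ l <= y / 2.
  move=> lm; have := HL l lm.
  have K'0 : 0 <= (1 + K + m.-1%:R) * y by rewrite mulr_ge0// addr_ge0//; order_lra.
  move=> /le_trans /(_ (ler_wpM2l K'0 th)); rewrite exprSr !mulrA ler_pM2r// => /le_trans; apply.
  rewrite mulrAC; have -> : y / 2 = 2^-1 * y by rewrite mulrC.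
  by rewrite ler_wpM2r//; order_lra.
split.
- have := close 0%N isT; rewrite expr0 mulr1.
  have := Fh k 0%N km m0; rewrite expr0 mulr1 -/y.
  have := nmD (F k 0%N t - F k 0%N (t0 q)) (F k 0%N (t0 q)); rewrite subrK.
  by move: y0; clear; lra.
- have im' : (i <= m.-1)%N by rewrite -ltnS prednK.
  have := close i im'.
  have := ler_wpM2r (exprn_ge0 i (ltW h0)) (nmB (F k i t) (F k i t - F k i (t0 q))).
  rewrite opprB addrC subrK mulrDl Fe.
  by move: y0; clear; lra.
Qed.

Lemma root_cluster_mono (m n : nat) K tau tau' a b (c : nat -> R -> C) lam : tau <= tau' ->
  root_cluster m n K tau a b c lam -> root_cluster m n K tau' a b c lam.
Proof.
move=> tt [ab cr ct lr lc]; split=> // t tab; have [c1 ck] := ct t tab.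
by split=> // k kn km; apply: le_trans tt; exact: ck.
Qed.

Lemma cont_lip a b K f : lip a b K f -> cont a b f.
Proof.
move=> fl x xab e e0; have K0 : 0 < 1 + `|K| by rewrite ltr_pwDl.
exists (e / (1 + `|K|)); first by rewrite divr_gt0.
move=> y yab; rewrite ltr_pdivlMr// => yx; apply: le_lt_trans yx.
apply: le_trans (fl x y xab yab) _; rewrite mulrC ler_wpM2l//.
by have := ler_norm K; lra.
Qed.

Lemma cont_sub a b f g : cont a b f -> cont a b g -> cont a b (fun t => f t - g t).
Proof.
move=> fc gc x xab e e0; have e2 : 0 < e / 2 by rewrite divr_gt0.
have [d1 d10 H1] := fc x xab _ e2; have [d2 d20 H2] := gc x xab _ e2.
exists (Num.min d1 d2); first by rewrite lt_min d10.
move=> y yab; rewrite lt_min => /andP[y1 y2].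
have -> : f y - g y - (f x - g x) = (f y - f x) - (g y - g x) by ring.
apply: le_lt_trans (nmB _ _) _.
by have := H1 y yab y1; have := H2 y yab y2; lra.
Qed.

(** Makes the bisection stop: where the coefficients below m - 1 are not all small, neither d nor,
    by [jet_scale_ratio], h is small. *)
Lemma scale_lower (m : nat) (F : nat -> nat -> R -> C) K t0 d h eta : (0 < m)%N -> 0 <= K ->
  jet_scale m F t0 d h -> (forall k i, (k < m.-1)%N -> (i < m)%N -> nm (F k i t0) <= K) ->
  0 < eta -> eta <= \sum_(k < m.-1) nm (F k 0%N t0) -> (eta / m%:R) ^+ m / (1 + K) <= h.
Proof.
move=> m0 K0 js FK eta0 etaG.
have [rat _] := jet_scale_ratio K0 js FK.
have [[h0 hd] d1 Fh _ _] := js.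
have d0 : 0 < d by lra.
have mR0 : 0 < m%:R :> R by rewrite ltr0n.
have md : eta / m%:R <= d.
  rewrite ler_pdivrMr//; apply: le_trans etaG _.
  apply: (@le_trans _ _ (\sum_(k < m.-1) d)).
    apply: ler_sum => k _; have := Fh k 0%N (ltn_ord k) m0; rewrite expr0 mulr1 => /le_trans; apply.
    have mk : (0 < m - k)%N by rewrite subn_gt0 (leq_trans (ltn_ord k))// leq_pred.
    rewrite -[leRHS]expr1; apply: ler_wiXn2l; rewrite ?(ltW d0)//.
  by rewrite sumr_const card_ord -[_ *+ _]mulr_natr ler_wpM2l ?(ltW d0)// ler_nat leq_pred.
rewrite ler_pdivrMr; last lra.
apply: (@le_trans _ _ (d ^+ m)).
  by rewrite lerXn2r ?nnegrE ?divr_ge0 ?(ltW eta0) ?(ltW mR0) ?(ltW d0).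
have -> : d ^+ m = h * (d / h * d ^+ m.-1).
  by rewrite -{1}(prednK m0) exprS; field; rewrite gt_eqF.
by rewrite ler_wpM2l// ltW.
Qed.

Lemma csum_irrel (phi : R -> R -> R) L c d :
  (forall q t, q \in L -> q.1 <= t <= q.2 -> c <= t <= d -> False) -> csum phi L c d = 0.
Proof.
move=> H; rewrite /csum; case E: (clip c d L) => [|r s]; first by rewrite big_nil.
have [|q qL [h1 h2 h3 h4 h5]] := @mem_clip R c d L r; first by rewrite E mem_head.
by exfalso; apply: (H q r.1 qL); apply/andP; split => //; lra.
Qed.

Lemma root_estimateP n m : (0 < m <= n)%N -> root_estimate R m n.
Proof.
elim/ltn_ind: m => m IH /andP[m0 mn].
have [m1|m1] := leqP m 1.
  by have -> : m = 1%N by [apply/eqP; rewrite eqn_leq m1]; apply: root_estimate1; rewrite (leq_trans m0).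
have [tau1 /andP[t10 t11] HC] := @rescaled_cluster R n m (introT andP (conj m1 mn)).
(* The second term is the smallness needed for [root_bound]. *)
pose tau2 := Num.min tau1 (2 * (n.+1%:R * 2 ^+ n))^-1.
have E0 : 0 < 2 * (n.+1%:R * 2 ^+ n) :> R by rewrite !mulr_gt0// exprn_gt0.
have t20 : 0 < tau2 by rewrite lt_min t10 invr_gt0.
have t21 : tau2 <= tau1 by rewrite ge_min lexx.
have t22 : n.+1%:R * (2 ^+ n * tau2) <= 2^-1.
  apply: (@le_trans _ _ (n.+1%:R * (2 ^+ n * (2 * (n.+1%:R * 2 ^+ n))^-1))).
    by rewrite ler_wpM2l// ler_wpM2l ?exprn_ge0// ge_min lexx orbT.
  rewrite le_eqVlt; apply/orP; left; apply/eqP; field.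
  by rewrite nat1r pnatr_eq0 expf_neq0.
have [tauc tc0 Hcen] := @tschirnhaus R n m tau2 (introT andP (conj m1 mn)) t20.
have /choice[T HT] : forall m', exists T : R, 0 < T /\ ((0 < m' < m)%N ->
    forall K p, 0 <= K -> 1 <= p -> m'.-1%:R * p < m'%:R -> exists2 B : R, 0 <= B &
    forall a b (c : nat -> R -> C) lam, root_cluster m' n K T a b c lam -> VB p lam a b B).
  move=> m'; have [/andP[m'0 m'm]|_] := boolP (0 < m' < m)%N; last by exists 1.
  have [|T T0 H] := IH m' m'm; first by rewrite m'0 (leq_trans (ltnW m'm)).
  by exists T.
have [|tau0 /andP[tau00 tau01] Htau0] := @exists_lower R m T; first by move=> i _; have [] := HT i.
(* Below the thresholds of all smaller clusters, and with (n + 1) tau < 1 for the barrier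
   argument. *)
pose tau := tau0 / n.+2%:R.
have n20 : 0 < n.+2%:R :> R by rewrite ltr0n.
have tau_gt0 : 0 < tau by rewrite divr_gt0.
have tauT i : (i < m)%N -> tau <= T i.
  move=> /Htau0; apply: le_trans; rewrite ler_pdivrMr// ler_peMr ?(ltW tau00)//.
  by rewrite ler1n.
have ntau : n.+1%:R * tau < 1.
  rewrite /tau mulrA ltr_pdivrMr// mul1r.
  have : n.+1%:R < n.+2%:R :> R by rewrite ltr_nat.
  by apply: le_lt_trans; rewrite -[leRHS]mulr1 ler_wpM2l.
exists tauc => // K p K0 p1 mp.
have p0 : 0 <= p by order_lra.
have [K1 K10 {}Hcen] := Hcen K K0.
have [c1 [e0 [K6 [/andP[c10 c11] /andP[e00 e01] K60 {}HC]]]] := HC K1 tau K10 tau_gt0 ntau.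
have /choice[B HB] : forall m', exists B : R, 0 <= B /\ ((0 < m' < m)%N ->
    forall a b (c : nat -> R -> C) lam, root_cluster m' n K6 (T m') a b c lam -> VB p lam a b B).
  move=> m'; have [m'm|_] := boolP (0 < m' < m)%N; last by exists 0.
  have [_ /(_ m'm K6 p K60 p1 (child_exponent m'm p1 mp))[B B0 H]] := HT m'.
  by exists B.
have [B0 B00 {}HB'] := exists_upper m B.
have [c2 [c20 c21 c2K]] : exists c2 : R, [/\ 0 < c2, c2 <= c1 & 2 * (1 + K1 + m.-1%:R) * c2 <= 1].
  have D0 : 0 < 2 * (1 + K1 + m.-1%:R) by rewrite mulr_gt0// ltr_wpDr//; order_lra.
  exists (Num.min c1 (2 * (1 + K1 + m.-1%:R))^-1); split.
  - by rewrite lt_min c10 invr_gt0.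
  - by rewrite ge_min lexx.
  - by rewrite mulrC -ler_pdivlMr// div1r ge_min lexx orbT.
have c21' : c2 <= 1 by exact: le_trans c21 c11.
have [S S0 HS] := scale_sum m0 K10 p1 mp c20 c21' c2K.
(* The first term is for an undivided interval ([root_weight]), the second for Whitney intervals,
   where h <= (2 / c2) |Q|. *)
pose C2 := B0 * ((1 + K1) `^ p + 2 / c2 * S).
have C20 : 0 <= C2 by rewrite mulr_ge0// addr_ge0 ?powR_ge0// mulr_ge0// divr_ge0// ltW.
pose C3 := 2 `^ p * 2 `^ p * C2.
have C30 : 0 <= C3 by rewrite mulr_ge0// mulr_ge0 ?powR_ge0.
exists (2 `^ p * (C3 + (2 * K1) `^ p)); first by rewrite mulr_ge0 ?addr_ge0 ?powR_ge0.
move=> a b c lam [[ab ab1] cr ct lamr lamc].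
have [mu [c' [muR cR' c't mu1 c'root]]] := Hcen a b c ab1 cr ct.
pose nu t := lam t - mu t.
have -> : lam = fun t => nu t + mu t by apply/funext => t; rewrite /nu subrK.
have mul := Reg_lip ab1 muR.
apply: (VB_add p0 _ (VB_lip p0 ab1 mul)).
have nuc : cont a b nu by apply: cont_sub lamc (cont_lip mul).
have /choice[F HF] : forall k, exists Fk : nat -> R -> C, (k <= n)%N -> jets a b m.-1 K1 Fk /\ Fk 0%N = c' k.
  move=> k; have [kn|_] := boolP (k <= n)%N; last by exists (fun _ _ => 0).
  by have [Fk h1 h2] := Reg_jets (cR' k kn); exists Fk.
have F0 k : (k <= n)%N -> F k 0%N = c' k by move=> /HF[].
have Fj k : (k <= n)%N -> jets a b m.-1 K1 (F k) by move=> /HF[].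
have m1n : (m.-1 <= n)%N by apply: leq_trans (leq_pred m) mn.
have kn' k : (k < m.-1)%N -> (k <= n)%N by move=> km; apply: leq_trans (ltnW km) m1n.
have Ft t : a <= t <= b -> [/\ F m 0%N t = 1, F m.-1 0%N t = 0 &
   forall k, (k <= n)%N -> k != m -> nm (F k 0%N t) <= tau2].
  move=> tab; have [h1 h2 h3] := c't t tab; rewrite !F0//; split=> // k kn km.
  by rewrite F0//; exact: h3.
have nur t : a <= t <= b -> nm (nu t) <= 2 /\ \sum_(k < n.+1) F k 0%N t * nu t ^+ k = 0.
  move=> tab; have [l1 l2] := lamr t tab; split.
    by apply: le_trans (nmB _ _) _; have := mu1 t tab; order_lra.
  rewrite -[RHS](c'root t (lam t) tab l2); apply: eq_bigr => k _.
  by rewrite F0// -ltnS.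
have FK k i t : a <= t <= b -> (k < m.-1)%N -> (i < m)%N -> nm (F k i t) <= K1.
  move=> tab km im; have [Fb _ _] := Fj k (kn' k km); apply: Fb => //.
  by rewrite -ltnS prednK.
have child q t0 d h : a <= q.1 -> q.1 < q.2 -> q.2 <= b -> q.1 <= t0 <= q.2 -> jet_scale m F t0 d h ->
    q.2 - q.1 <= c2 * h -> VB p nu q.1 q.2 (B0 * (h * (d / h) `^ p)).
  move=> aq q12 qb tq [[h0 hd] d1 Fh Fk0 _] qc.
  have d0 : 0 < d by order_lra.
  have qc1 : q.2 - q.1 <= c1 * h by apply: le_trans qc _; rewrite ler_wpM2r// ltW.
  have Ft' t : a <= t <= b -> [/\ F m 0%N t = 1, F m.-1 0%N t = 0 &
      forall k, (k <= n)%N -> k != m -> nm (F k 0%N t) <= tau1].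
    by move=> /Ft[h1 h2 h3]; split=> // k kn km; apply: le_trans t21; exact: h3.
  have [m' [e [cc [la [m'm /andP[e0e e1] nuE rc]]]]] := HC a b F nu q.1 q.2 t0 d h ab1 Fj Ft' nuc nur
     aq q12 qb tq qc1 h0 hd d1 Fh Fk0.
  have m'lt : (m' < m)%N by case/andP: m'm.
  have e_gt0 : 0 < e by order_lra.
  have [_ HBm] := HB m'; have V := HBm m'm _ _ _ _ (root_cluster_mono (tauT m' m'lt) rc).
  have V' : VB p la ((q.1 - t0) / h) ((q.2 - t0) / h) B0.
    by move=> L /V /le_trans; apply; exact: HB'.
  apply: (@VB_affine R p nu la q.1 q.2 t0 h d B0 p0 h0 (ltW d0) _ V') => x y _ _.
  rewrite [nu y]nuE [nu x]nuE opprD addrACA subrr add0r -mulrBr nmM nm_cR.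
  rewrite ger0_norm ?mulr_ge0 ?(ltW d0) ?(ltW e_gt0)// ler_wpM2r ?nm_ge0//.
  by rewrite ler_piMr// ltW.
move=> L chL.
pose pos t := exists2 k, (k < m.-1)%N & F k 0%N t != 0.
have nu0 t : a <= t <= b -> ~ pos t -> nu t = 0.
  move=> tab npos; apply/eqP; rewrite -nm_eq0; apply/eqP/le_anti; rewrite nm_ge0 andbT.
  rewrite leNgt; apply/negP => nup.
  have [cm cm1 ctt] := Ft t tab; have [nu2 nusum] := nur t tab.
  (* All coefficients below m vanish at t, so [root_bound] holds for any d > 0; this one gives |nu
     t| <= |nu t| / 2. *)
  pose d := nm (nu t) / (2 * m%:R) / 2.
  have mR0 : 0 < 2 * m%:R :> R by rewrite mulr_gt0// ltr0n.
  have d0 : 0 < d by rewrite divr_gt0// divr_gt0.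
  have : nm (nu t) <= 2 * m%:R * d.
    apply: (@root_bound R n m (fun k => F k 0%N t) (nu t) d tau2) => //; first by rewrite m0.
    - move=> k km; have -> : F k 0%N t = 0.
        have [km1|km1] := ltnP k m.-1.
          by apply: contrapT => /eqP Fk; apply: npos; exists k.
        by have -> : k = m.-1 by apply/eqP; rewrite eqn_leq km1 andbT -ltnS prednK.
      by rewrite nm0 exprn_ge0// ltW.
    - by move=> k /andP[mk kn]; apply: ctt; rewrite ?gtn_eqF.
    - exact: ltW.
  have -> : 2 * m%:R * d = nm (nu t) / 2 by rewrite /d; field; rewrite gt_eqF// ltr0n.
  by move: nup; clear; lra.
have [L' [chL' posL' sumL]] := positive_chain p1 nuc nu0 chL.
apply: le_trans sumL _; rewrite /C3 ler_wpM2l ?mulr_ge0 ?powR_ge0//.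
(* A Lipschitz function, positive on the chosen chain; its minimum there yields the threshold
   [delta] of the bisection. *)
pose G t : R := \sum_(k < m.-1) nm (F k 0%N t).
have G0 t : 0 <= G t by apply: sumr_ge0 => k _; exact: nm_ge0.
have nmG t : nm (cR (G t)) = G t by rewrite nm_cR ger0_norm.
have Gl : lip a b (m.-1%:R * (2 * K1)) (fun t => cR (G t)).
  move=> x y xab yab; rewrite -rmorphB nm_cR /G -sumrB.
  apply: le_trans (ler_norm_sum _ _ _) _.
  apply: (@le_trans _ _ (\sum_(k < m.-1) 2 * K1 * `|y - x|)).
    apply: ler_sum => k _; apply: (@le_trans _ _ (nm (F k 0%N y - F k 0%N x))); first exact: ler_dist_dist.
    exact: (jets_lip ab1 (Fj k (kn' k (ltn_ord k))) (leq0n _)).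
  by rewrite sumr_const card_ord -[_ *+ _]mulr_natl mulrA.
have posG t : pos t -> 0 < G t.
  move=> [k km Fk]; rewrite /G (bigD1 (Ordinal km))//= ltr_pwDl ?nm_gt0//.
  by apply: sumr_ge0 => i _; exact: nm_ge0.
have [|eta eta0 Heta] := lip_min_seq Gl chL'.
  by move=> q t qL tq; rewrite nmG; apply: posG; exact: posL' tq.
have mR0 : 0 < m%:R :> R by rewrite ltr0n.
have K11 : 0 < 1 + K1 by order_lra.
pose delta := c2 * ((eta / m%:R) ^+ m / (1 + K1)).
have delta0 : 0 < delta by rewrite mulr_gt0// divr_gt0// exprn_gt0// divr_gt0.
pose stop c d := exists t0 dd hh, [/\ c <= t0 <= d, a <= t0 <= b, jet_scale m F t0 dd hh & d - c <= c2 * hh].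
pose irrel c d := forall q t, q \in L' -> q.1 <= t <= q.2 -> c <= t <= d -> False.
have [|Q [chQ stQ rootQ WQ]] := @whitney R stop irrel delta a b delta0 ab.
  move=> u v au uv vb uvd; have [H|H] := pselect (irrel u v); [by right|left].
  have [q [t [qL tq tuv]]] : exists q t, [/\ q \in L', q.1 <= t <= q.2 & u <= t <= v].
    by apply: contrapT => nex; apply: H => q t qL tq tuv; apply: nex; exists q, t.
  have tab : a <= t <= b.
    by case/andP: tuv => ut tv; rewrite (le_trans au ut) (le_trans tv vb).
  have [|d [h js]] := @jet_scale_exists R m F t _ (posL' q t qL tq).
    move=> k km; have [_ _ ctt] := Ft t tab; apply: le_trans (le_trans t21 t11).
    by apply: ctt; rewrite ?kn'// ltn_eqF// (leq_trans km)// leq_pred.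
  exists t, d, h; split=> //; apply: le_trans uvd _.
  rewrite ler_wpM2l ?(ltW c20)//; apply: (scale_lower m0 K10 js _ eta0).
    by move=> k i; exact: FK.
  by rewrite -/(G t) -nmG; exact: Heta tq.
have Wab : \sum_(q <- L') rvar p nu q.1 q.2 = csum (rvar p nu) L' a b by rewrite /csum clip_id.
rewrite Wab; apply: le_trans (WQ (csum (rvar p nu) L') _ _) _.
- move=> u v w uv vw; apply: csum_split => //.
  + by move=> x y xy; apply: rvar_ge0; exact: ltW.
  + by move=> x y z xy yz; exact: rvar_split.
- by move=> u v _ H; rewrite csum_irrel.
have /choice[T0 HT0] : forall q : R * R, exists th : R * (R * R), q \in Q ->
    [/\ q.1 <= th.1 <= q.2, a <= th.1 <= b, jet_scale m F th.1 th.2.1 th.2.2 & q.2 - q.1 <= c2 * th.2.2].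
  move=> q; have [qQ|] := boolP (q \in Q); last by exists (0, (0, 0)).
  by have [t0 [d [h H]]] := stQ q qQ; exists (t0, (d, h)).
apply: (@le_trans _ _ (\sum_(q <- Q) B0 * ((T0 q).2.2 * ((T0 q).2.1 / (T0 q).2.2) `^ p))).
  rewrite big_seq [leRHS]big_seq; apply: ler_sum => q qQ.
  have [tq tab js qc] := HT0 q qQ; have [aq q12 qb] := chain_mem chQ qQ.
  apply: (@csum_VB R p nu a b) => //; last exact: ltW.
  exact: child js qc.
rewrite -mulr_sumr ler_wpM2l//.
case: rootQ => [QE|nroot].
  rewrite QE big_seq1; have [|tq tab js _] := HT0 (a, b); first by rewrite QE mem_head.
  have [[h0 hd] d1 _ _ _] := js.
  have [rat _] := jet_scale_ratio K10 js (fun k i => @FK k i _ tab).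
  have K11' : 1 <= 1 + K1 by order_lra.
  apply: le_trans (root_weight m0 p1 mp h0 hd d1 K11' rat) _.
  by rewrite lerDl mulr_ge0// divr_ge0// ltW.
apply: (@le_trans _ _ (2 / c2 * \sum_(q <- Q) (q.2 - q.1) * ((T0 q).2.1 / (T0 q).2.2) `^ p)).
  rewrite mulr_sumr big_seq [leRHS]big_seq; apply: ler_sum => q qQ.
  have [tq tab js qc] := HT0 q qQ; have [u [v [uq qv uv nst]]] := nroot q qQ.
  rewrite mulrA ler_wpM2r ?powR_ge0// mulrAC ler_pdivlMr// -uv mulrC ltW// ltNge.
  apply/negP => H; apply: nst; exists (T0 q).1, (T0 q).2.1, (T0 q).2.2; split=> //.
  by case/andP: tq => h1 h2; rewrite (le_trans uq h1) (le_trans h2 qv).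
apply: (@le_trans _ _ (2 / c2 * S)); last by rewrite lerDr powR_ge0.
rewrite ler_wpM2l ?divr_ge0 ?(ltW c20)//.
apply: (HS a b F Q (fun q => (T0 q).1) (fun q => (T0 q).2.1) (fun q => (T0 q).2.2)) => //.
- by move=> k km; apply: Fj; exact: kn'.
- by move=> q qQ; have [tq _ js qc] := HT0 q qQ.
Qed.

End RootEstimateP.

(** * Roots of monic polynomials *)

Section GlobalEstimate.
Variable R : realType.
Local Notation C := (Rcomplex R).
Implicit Types (a b c d x y t K M p : R) (f g : R -> C) (L Q : seq (R * R)).

Lemma derivable_nm f t : derivable f t 1 -> forall e, 0 < e -> exists2 d, 0 < d &
  forall h, h != 0 -> `|h| < d -> nm (cR h^-1 * (f (h + t) - f t) - derive1 f t) < e.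
Proof.
move=> fd e e0; rewrite /derivable in fd; have /cvgrPdist_lt/(_ _ e0)[d /= d0 Hd] := fd.
exists d => // h h0 hd.
have := Hd h _ h0; rewrite /= sub0r normrN /= => /(_ hd).
rewrite derive1E /derive -scale_cR [h%:A]mulr1 => H.
by rewrite nm_distC; exact: H.
Qed.

Lemma derivable_part (P : C -> R) f t : (forall z w, P (z - w) = P z - P w) ->
  (forall r z, P (cR r * z) = r * P z) -> (forall z, `|P z| <= nm z) ->
  derivable f t 1 -> is_derive t 1 (P \o f) (P (derive1 f t)).
Proof.
move=> PB PZ Pn fd.
have cv : (h^-1 *: ((P \o f) (h *: 1 + t) - (P \o f) t)) @[h --> 0^'] --> P (derive1 f t).
  apply/cvgrPdist_lt => e e0; have [d d0 H] := derivable_nm fd e0.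
  exists d => //= h hd h0; rewrite /= sub0r normrN in hd.
  have := H h h0 hd; rewrite nm_distC; apply: le_lt_trans; apply: le_trans (Pn _).
  by rewrite PB PZ PB [h%:A]mulr1.
have pd : derivable (P \o f) t 1 by apply: cvgP cv.
by apply: (DeriveDef pd); apply: cvg_lim cv.
Qed.

(** The factor 2 comes from applying the real mean value theorem to the real and imaginary parts
    separately. *)
Lemma mean_value_bound f x y (z : C) M : x <= y -> (forall t, x <= t <= y -> derivable f t 1) ->
  (forall t, x <= t <= y -> nm (derive1 f t - z) <= M) ->
  nm (f y - f x - cR (y - x) * z) <= 2 * M * (y - x).
Proof.
rewrite le_eqVlt => /orP[/eqP <-|xy] fd fM.
  by rewrite !subrr rmorph0 mul0r subr0 nm0 mulr0.
have part (P : C -> R) : (forall z w, P (z - w) = P z - P w) ->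
    (forall r z, P (cR r * z) = r * P z) -> (forall z, `|P z| <= nm z) ->
    `|P (f y - f x - cR (y - x) * z)| <= M * (y - x).
  move=> PB PZ Pn.
  have der t : x <= t <= y -> is_derive t 1 (P \o f) (P (derive1 f t)).
    by move=> txy; apply: derivable_part => //; exact: fd.
  have [||c cxy E] := @MVT R (P \o f) (fun t => P (derive1 f t)) x y xy.
  - by move=> t; rewrite in_itv /= => /andP[? ?]; apply: der; rewrite !ltW.
  - by apply: derivable_within_continuous => t; rewrite in_itv /= => /der[].
  rewrite !PB PZ; move: E => /= ->; rewrite mulrC -mulrBr -PB normrM mulrC [`|y - x|]ger0_norm; last by lra.
  rewrite ler_wpM2r ?subr_ge0 ?(ltW xy)//; apply: le_trans (Pn _) _; apply: fM.
  by move: cxy; rewrite in_itv /= => /andP[? ?]; rewrite !ltW.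
apply: le_trans (nm_le_ReIm _) _.
have h1 := part (@complex.Re R) (fun z w => etrans (ReD _ _) (congr1 _ (ReN _))) (@Re_cRM R) (@Re_le_nm R).
have ImZ r (w : C) : complex.Im (cR r * w) = r * complex.Im w.
  by case: w => u v /=; rewrite mul0r addr0.
have ImB (u v : C) : complex.Im (u - v) = complex.Im u - complex.Im v by case: u v => [? ?] [? ?].
have h2 := part (@complex.Im R) ImB ImZ (@Im_le_nm R).
by rewrite -mulrA mulrDl mul1r; exact: lerD.
Qed.

Lemma mean_value_bound_sym a b f x y (z : C) M : a <= x <= b -> a <= y <= b ->
  (forall t, a <= t <= b -> derivable f t 1) ->
  (forall t, a <= t <= b -> `|t - x| <= `|y - x| -> nm (derive1 f t - z) <= M) ->
  nm (f y - f x - cR (y - x) * z) <= 2 * M * `|y - x|.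
Proof.
move=> /andP[ax xb] /andP[ay yb] fd fM; have [xy|/ltW yx] := leP x y.
  rewrite ger0_norm ?subr_ge0//; apply: mean_value_bound => // t /andP[xt ty].
    by apply: fd; rewrite (le_trans ax xt) (le_trans ty yb).
  apply: fM; first by rewrite (le_trans ax xt) (le_trans ty yb).
  by rewrite !ger0_norm ?subr_ge0// lerD2r.
rewrite ler0_norm ?subr_le0// opprB.
have -> : f y - f x - cR (y - x) * z = - (f x - f y - cR (x - y) * z).
  by rewrite -[x - y]opprB rmorphN /=; ring.
rewrite nmN; apply: mean_value_bound => // t /andP[yt tx].
  by apply: fd; rewrite (le_trans ay yt) (le_trans tx xb).
apply: fM; first by rewrite (le_trans ay yt) (le_trans tx xb).
by rewrite !ler0_norm ?subr_le0// !opprB lerD2l lerN2.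
Qed.

Lemma within_bounded (alpha beta : R) (g : R -> C) : {within `[alpha, beta], continuous g} ->
  exists M, forall t, alpha <= t <= beta -> nm (g t) <= M.
Proof.
move=> gc; have [M [_ HM]] := compact_bounded (continuous_compact gc (@segment_compact R alpha beta)).
exists (M + 1) => t tab; apply: (HM (M + 1)); first by rewrite ltrDl.
by exists t => //=; rewrite in_itv.
Qed.

(** Real suprema are informative only on nonempty bounded sets: boundedness comes from the
    continuous extensions and the Lipschitz condition, and the points m and m' make both suprema
    nonnegative. *)
Lemma Ck1_norm_bounds (k : nat) (alpha beta : R) (f : R -> C) : alpha < beta -> Ck1 k alpha beta f ->
  (forall i t, (i <= k)%N -> alpha < t < beta -> nm (derive1n i f t) <= Ck1_norm k alpha beta f) /\
  (forall x y, alpha < x < beta -> alpha < y < beta ->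
     nm (derive1n k f y - derive1n k f x) <= Ck1_norm k alpha beta f * `|y - x|).
Proof.
move=> ab [fd fe fl].
set S1 := [set r | exists i t, [/\ (i <= k)%N, t \in `]alpha, beta[ & r = `|derive1n i f t|]].
set S2 := [set r | exists x y, [/\ `]alpha, beta[%classic x, `]alpha, beta[%classic y, x != y &
   r = `|derive1n k f x - derive1n k f y| / `|x - y|]].
have S1b : has_ubound S1.
  have /choice[B HB] : forall i, exists B : R, (i <= k)%N -> forall t, alpha < t < beta -> nm (derive1n i f t) <= B.
    move=> i; have [ik|_] := boolP (i <= k)%N; last by exists 0.
    have [g gc gE] := fe i ik; have [M HM] := within_bounded gc.
    exists M => _ t tab; rewrite gE ?in_itv//; apply: HM.
    by case/andP: tab => ? ?; rewrite !ltW.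
  have [M M0 HM] := exists_upper k.+1 B.
  exists M => _ [i [t [ik tab ->]]]; apply: le_trans (HM i _) => //; exact: HB.
have S2b : has_ubound S2.
  have [M [_ HM]] := fl; exists (M + 1) => _ [x [y [xa ya xy ->]]].
  have := HM (M + 1) _ (x, y) (conj xa ya) => /= H.
  rewrite ler_pdivrMr ?normr_gt0 ?subr_eq0//; apply: H.
  by rewrite ltrDl.
have S1p r : S1 r -> r <= sup S1 by move=> Sr; apply: ub_le_sup.
have S2p r : S2 r -> r <= sup S2 by move=> Sr; apply: ub_le_sup.
pose m := (alpha + beta) / 2; pose m' := (alpha + m) / 2.
have mab : alpha < m < beta by rewrite /m; apply/andP; split; lra.
have m'ab : alpha < m' < beta by rewrite /m' /m; apply/andP; split; lra.
have mm' : m != m' by rewrite /m' /m; apply/eqP; lra.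
have s1 : 0 <= sup S1.
  apply: le_trans (S1p `|derive1n 0 f m| _); first exact: normr_ge0.
  by exists 0%N, m; rewrite in_itv.
have s2 : 0 <= sup S2.
  apply: le_trans (S2p (`|derive1n k f m - derive1n k f m'| / `|m - m'|) _).
    by rewrite divr_ge0 ?normr_ge0.
  by exists m, m'; split=> //=; rewrite in_itv.
have nE : Ck1_norm k alpha beta f = sup S1 + sup S2 by [].
split=> [i t ik tab|x y xab yab]; rewrite nE.
  apply: (@le_trans _ _ (sup S1)); last by rewrite lerDl.
  by apply: S1p; exists i, t; rewrite in_itv.
have [->|xy] := eqVneq x y; first by rewrite !subrr normr0 nm0 mulr0.
rewrite -ler_pdivrMr; last by rewrite normr_gt0 subr_eq0 eq_sym.
apply: (@le_trans _ _ (sup S2)); last by rewrite lerDr.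
apply: S2p; exists y, x; split=> //=; rewrite ?in_itv// eq_sym//.
Qed.

(** The constant is 4 N because the factor 2 of [mean_value_bound] occurs twice: for the Lipschitz
    constants of the derivatives, then for the expansions. *)
Lemma Ck1_jets (k : nat) (alpha beta N : R) (f : R -> C) a b : alpha < beta -> Ck1 k alpha beta f ->
  Ck1_norm k alpha beta f <= N -> alpha < a -> b < beta -> jets a b k (4 * N) (fun i => derive1n i f).
Proof.
move=> ab fC fN aa bb; have [Fb Fl] := Ck1_norm_bounds ab fC; have [fd _ _] := fC.
have inab t : a <= t <= b -> alpha < t < beta.
  by case/andP=> at_ tb; rewrite (lt_le_trans aa at_) (le_lt_trans tb bb).
have bd i t : (i <= k)%N -> a <= t <= b -> nm (derive1n i f t) <= N.
  by move=> ik /inab tab; apply: le_trans (Fb i t ik tab) fN.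
have N0 t : a <= t <= b -> 0 <= N.
  by move=> tab; apply: le_trans (bd 0%N t isT tab); exact: nm_ge0.
have lipk x y : a <= x <= b -> a <= y <= b -> nm (derive1n k f y - derive1n k f x) <= N * `|y - x|.
  move=> /inab xab /inab yab; apply: le_trans (Fl x y xab yab) _.
  by rewrite ler_wpM2r.
have lipi i x y : (i <= k)%N -> a <= x <= b -> a <= y <= b ->
    nm (derive1n i f y - derive1n i f x) <= 2 * N * `|y - x|.
  rewrite leq_eqVlt => /orP[/eqP ->|ik] xab yab.
    apply: le_trans (lipk _ _ xab yab) _; rewrite ler_wpM2r//.
    by have := N0 x xab; lra.
  have := @mean_value_bound_sym a b (derive1n i f) x y 0 N xab yab.
  rewrite mulr0 subr0; apply=> [t tab|t tab _]; first by apply: fd; rewrite // in_itv /= inab.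
  by rewrite subr0; exact: (bd i.+1).
split.
- move=> i ik t tab; have := bd i t ik tab; have := N0 t tab; lra.
- move=> i ik x y xab yab; apply: le_trans (mean_value_bound_sym (M := 2 * N * `|y - x|) xab yab _ _) _.
  + by move=> t tab; apply: fd; rewrite // in_itv /= inab.
  + move=> t tab tx; apply: le_trans (lipi i.+1 x t ik xab tab) _.
    by rewrite ler_wpM2l// mulr_ge0//; exact: N0 xab.
  + by rewrite -[(y - x) ^+ 2]real_normK ?num_real// le_eqVlt; apply/orP; left; apply/eqP; ring.
- move=> x y xab yab; apply: le_trans (lipk _ _ xab yab) _; rewrite ler_wpM2r//.
  by have := N0 x xab; lra.
Qed.

Lemma jets_cmul a b k K F (z : C) : jets a b k K F -> jets a b k (K * nm z) (fun i t => F i t * z).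
Proof.
move=> [Fb Fd Fl]; split.
- by move=> i ik t tab; rewrite nmM ler_wpM2r ?nm_ge0//; exact: Fb.
- move=> i ik x y xab yab; have := Fd i ik x y xab yab.
  have -> : F i y * z - F i x * z - cR (y - x) * (F i.+1 x * z) = (F i y - F i x - cR (y - x) * F i.+1 x) * z by ring.
  by rewrite nmM mulrAC => H; rewrite ler_wpM2r ?nm_ge0.
- move=> x y xab yab; rewrite -mulrBl nmM mulrAC ler_wpM2r ?nm_ge0//; exact: Fl.
Qed.

Lemma VB_cat p f a c b A B : 1 <= p -> a <= c -> c <= b -> VB p f a c A -> VB p f c b B ->
  VB p f a b (A + B).
Proof.
move=> p1 ac cb fA fB L chL; have := clip_id chL => cL.
have -> : \sum_(q <- L) rvar p f q.1 q.2 = csum (rvar p f) L a b by rewrite /csum cL.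
apply: (le_trans (csum_split (d := c) _ ac cb _ _)).
- by move=> x y xy; apply: rvar_ge0; exact: ltW.
- by move=> x y z xy yz; exact: rvar_split.
apply: lerD; exact: csum_VB chL _.
Qed.

Lemma small_coef_root (n : nat) (c : nat -> C) (z : C) tau : c n = 1 -> 0 <= tau -> n.+1%:R * tau < 1 ->
  (forall k, (k < n)%N -> nm (c k) <= tau) -> \sum_(k < n.+1) c k * z ^+ k = 0 -> nm z <= 1.
Proof.
move=> cn t0 nt ck; rewrite big_ord_recr /= cn mul1r => /eqP; rewrite addrC addr_eq0 => /eqP zE.
rewrite leNgt; apply/negP => z1.
have zn : 0 < nm z ^+ n by rewrite exprn_gt0//; lra.
have : nm z ^+ n <= n%:R * tau * nm z ^+ n.
  rewrite -{1}nmX zE nmN; apply: le_trans (nm_sum _ _ _) _.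
  apply: (@le_trans _ _ (\sum_(k < n) tau * nm z ^+ n)).
    apply: ler_sum => k _; rewrite nmM nmX; apply: ler_pM; rewrite ?nm_ge0 ?exprn_ge0 ?nm_ge0 ?ck//.
    by apply: ler_weXn2l; rewrite ?(ltW z1)// ltnW.
  by rewrite sumr_const card_ord -[_ *+ n]mulr_natl mulrA.
rewrite ler_pMl//.
move: nt; rewrite -natr1 mulrDl mul1r; lra.
Qed.

Lemma monic_poly_horner (n : nat) (a : nat -> R -> C) t z :
  (monic_poly n a t).[z] = z ^+ n + \sum_(1 <= j < n.+1) a j t * z ^+ (n - j).
Proof.
rewrite /monic_poly hornerD hornerXn horner_sum; congr (_ + _).
by apply: eq_bigr => j _; rewrite hornerZ hornerXn.
Qed.

(** With z divided by s = rho / u, the coefficient a_j becomes a_j / s^j of size at most u^j <= u,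
    so all n roots form a single cluster. Undoing the scaling produces rho^p. *)
Lemma root_local_VB (n : nat) p : (0 < n)%N -> 1 <= p -> n.-1%:R * p < n%:R ->
  exists2 B : R, 0 <= B & forall (alpha beta : R) (a : nat -> R -> C) (lambda : R -> C) rho a' b',
  alpha < beta -> (forall j, (1 <= j <= n)%N -> Ck1 n.-1 alpha beta (a j)) ->
  {in `]alpha, beta[, continuous lambda} ->
  (forall t, t \in `]alpha, beta[ -> root (monic_poly n a t) (lambda t)) ->
  0 < rho -> (forall j, (1 <= j <= n)%N -> Ck1_norm n.-1 alpha beta (a j) <= rho ^+ j) ->
  alpha < a' -> a' < b' -> b' < beta -> b' - a' <= 1 -> VB p lambda a' b' (B * rho `^ p).
Proof.
move=> n0 p1 np; have [|tau tau0 H] := @root_estimateP R n n; first by rewrite n0 leqnn.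
(* The bound 4 is that of [Ck1_jets] after the scaling, which brings the norms below u <= 1. *)
have [B B0 HB] := H 4 p (ler0n _ 4) p1 np.
pose u := Num.min tau (n.+2%:R)^-1.
have n20 : 0 < n.+2%:R :> R by rewrite ltr0n.
have u0 : 0 < u by rewrite lt_min tau0 invr_gt0.
have utau : u <= tau by rewrite ge_min lexx.
have un : n.+2%:R * u <= 1 by rewrite mulrC -ler_pdivlMr// div1r ge_min lexx orbT.
have nu1 : n.+1%:R * u < 1.
  apply: lt_le_trans un; rewrite ltr_pM2r// ltr_nat//.
have u1 : u <= 1.
  by apply: le_trans un; rewrite ler_peMl ?(ltW u0)// ler1n.
exists (B * u^-1 `^ p); first by rewrite mulr_ge0 ?powR_ge0.
move=> alpha beta a lambda rho a' b' ab aC lc lroot rho0 aN aa' ab' bb' len.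
pose s := rho / u; have s0 : 0 < s by rewrite divr_gt0.
have cRs0 : cR s != 0 by rewrite -nm_gt0 nm_cR normr_gt0 gt_eqF.
have cRs j : cR (s ^+ j)^-1 = (cR s ^+ j)^-1 by rewrite fmorphV rmorphXn.
pose lam t : C := lambda t / cR s.
pose c k t : C := if k == n then 1 else a (n - k)%N t * cR (s ^+ (n - k))^-1.
have inab t : a' <= t <= b' -> alpha < t < beta.
  by case/andP=> at_ tb; rewrite (lt_le_trans aa' at_) (le_lt_trans tb bb').
have scale j : (0 < j)%N -> rho ^+ j * nm (cR (s ^+ j)^-1) <= u.
  move=> j0; rewrite nm_cR ger0_norm ?invr_ge0 ?exprn_ge0 ?(ltW s0)//.
  rewrite /s expr_div_n invf_div mulrCA divff ?mulr1 ?expf_neq0 ?gt_eqF//.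
  by rewrite -[leRHS]expr1; apply: ler_wiXn2l; rewrite ?(ltW u0).
have jk k : (k <= n)%N -> k != n -> (1 <= n - k <= n)%N.
  by move=> kn kn'; rewrite subn_gt0 ltn_neqAle kn' kn leq_subr.
have cu k t : a' <= t <= b' -> (k <= n)%N -> k != n -> nm (c k t) <= u.
  move=> tab kn kn'; rewrite /c (negbTE kn') nmM.
  have /andP[j0 jn] := jk k kn kn'.
  apply: le_trans (scale _ j0); rewrite ler_wpM2r ?nm_ge0//.
  have [Fb _] := Ck1_norm_bounds ab (aC _ (jk k kn kn')).
  by apply: le_trans (Fb 0%N t _ (inab t tab)) _ => //; apply: aN; exact: jk.
have rt t : a' <= t <= b' -> \sum_(k < n.+1) c k t * lam t ^+ k = 0.
  move=> tab; have := lroot t; rewrite in_itv /= inab// => /(_ isT) /rootP.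
  rewrite monic_poly_horner => H0.
  have E : (cR s ^+ n)^-1 * (lambda t ^+ n + \sum_(1 <= j < n.+1) a j t * lambda t ^+ (n - j)) = 0.
    by rewrite H0 mulr0.
  rewrite -[RHS]E big_ord_recr /= mulrDr addrC; congr (_ + _).
    by rewrite /c eqxx mul1r /lam expr_div_n mulrC.
  rewrite big_add1 /= big_mkord mulr_sumr (reindex_inj rev_ord_inj) /=; apply: eq_bigr => i _.
  have iE : (n - (n - i.+1) = i.+1)%N by rewrite subKn.
  rewrite /c iE ifF; last by apply/negbTE; rewrite neq_ltn ltn_subrL n0.
  have -> : (cR s ^+ n)^-1 = (cR s ^+ (n - i.+1))^-1 * (cR s ^+ i.+1)^-1.
    by rewrite -invfM -exprD subnK.
  by rewrite /lam [(lambda t / cR s) ^+ _]expr_div_n cRs; ring.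
have clu : root_cluster n n 4 tau a' b' c lam.
  split=> //.
  - move=> k kn; have [kE|kn'] := eqVneq k n.
      apply: (eq_Reg (f := fun=> 1)); first by move=> t _; rewrite /c kE eqxx.
      by apply: Reg_cst; rewrite nm1 ler1n.
    have /andP[j0 jn] := jk k kn kn'.
    have := jets_Reg (jets_cmul (cR (s ^+ (n - k))^-1) (Ck1_jets ab (aC _ (jk k kn kn')) (aN _ (jk k kn kn')) aa' bb')).
    move=> /(Reg_mono (L := 4)) Rk; apply: eq_Reg (Rk _); first by move=> t _; rewrite /c (negbTE kn').
    rewrite -mulrA -[leRHS]mulr1 ler_wpM2l//; apply: le_trans u1; exact: scale.
  - move=> t tab; split; first by rewrite /c eqxx.
    by move=> k kn kn'; apply: le_trans (cu k t tab kn kn') utau.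
  - move=> t tab; split; last exact: rt.
    apply: (small_coef_root (n := n) (c := fun k => c k t) (tau := u)); rewrite ?(ltW u0) ?rt//.
      by rewrite /c eqxx.
    by move=> k kn; apply: cu => //; [exact: ltnW|rewrite ltn_eqF].
  - move=> x xab e e0; have xI : x \in `]alpha, beta[ by rewrite in_itv /= inab.
    have es0 : 0 < e * s by rewrite mulr_gt0.
    have /cvgrPdist_lt/(_ _ es0)[d /= d0 Hd] := lc x xI.
    exists d => // y yab yx; have := Hd y; rewrite /= distrC => /(_ yx).
    rewrite /lam -mulrBl nm_div nm_cR gtr0_norm// ltr_pdivrMr// -/(nm _) nm_distC.
    exact.
have V := HB _ _ _ _ clu.
have p0 : 0 <= p by lra.
have -> : B * u^-1 `^ p * rho `^ p = B * (1 * (s / 1) `^ p).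
  by rewrite divr1 mul1r /s powRM ?invr_ge0 ?(ltW u0) ?(ltW rho0)//; ring.
have V' : VB p lam ((a' - 0) / 1) ((b' - 0) / 1) B by rewrite !subr0 !divr1.
apply: (VB_affine p0 ltr01 (ltW s0) _ V') => x y _ _.
rewrite !subr0 !divr1 /lam -mulrBl nm_div nm_cR gtr0_norm// mulrC divfK ?gt_eqF//.
Qed.

(** The interval is cut into N pieces of length at most 1, with N <= 2 max{1, beta - alpha}. *)
Lemma root_VB (n : nat) p : (0 < n)%N -> 1 <= p -> n.-1%:R * p < n%:R ->
  exists2 B : R, 0 <= B & forall (alpha beta : R) (a : nat -> R -> C) (lambda : R -> C) rho a' b',
  alpha < beta -> (forall j, (1 <= j <= n)%N -> Ck1 n.-1 alpha beta (a j)) ->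
  {in `]alpha, beta[, continuous lambda} ->
  (forall t, t \in `]alpha, beta[ -> root (monic_poly n a t) (lambda t)) ->
  0 < rho -> (forall j, (1 <= j <= n)%N -> Ck1_norm n.-1 alpha beta (a j) <= rho ^+ j) ->
  alpha < a' -> a' < b' -> b' < beta -> VB p lambda a' b' (B * rho `^ p * Num.max 1 (beta - alpha)).
Proof.
move=> n0 p1 np; have [B B0 HB] := root_local_VB n0 p1 np.
exists (2 * B); first by rewrite mulr_ge0.
move=> alpha beta a lambda rho a' b' ab aC lc lroot rho0 aN aa' ab' bb'.
pose B1 := B * rho `^ p; have B10 : 0 <= B1 by rewrite mulr_ge0 ?powR_ge0.
pose N := (Num.truncn (b' - a')).+1.
have N0 : 0 < N%:R :> R by rewrite ltr0n.
have lN : b' - a' < N%:R by apply: truncnS_gt.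
have Nl : N%:R <= 2 * Num.max 1 (beta - alpha) :> R.
  have : (Num.truncn (b' - a'))%:R <= b' - a' by rewrite truncn_le// subr_ge0 ltW.
  have : 1 <= Num.max 1 (beta - alpha) by rewrite le_max lexx.
  have : beta - alpha <= Num.max 1 (beta - alpha) by rewrite le_max lexx orbT.
  by rewrite /N -natr1; lra.
pose d := (b' - a') / N%:R.
have d0 : 0 < d by rewrite divr_gt0// subr_gt0.
have d1 : d <= 1 by rewrite ler_pdivrMr// mul1r ltW.
have dN : d * N%:R = b' - a' by rewrite divfK// gt_eqF.
have P i : (0 < i <= N)%N -> VB p lambda a' (a' + d * i%:R) (i%:R * B1).
  elim: i => // i IH /andP[_ iN].
  have iN' : d * i.+1%:R <= b' - a' by rewrite -dN ler_wpM2l ?(ltW d0)// ler_nat.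
  have i0 : 0 <= d * i%:R by rewrite mulr_ge0// ltW.
  have st : a' + d * i.+1%:R = a' + d * i%:R + d by rewrite -natr1; ring.
  have Vi : VB p lambda (a' + d * i%:R) (a' + d * i.+1%:R) B1.
    apply: (HB alpha beta a) => //; rewrite ?st; lra.
  have [i00|ip] := posnP i.
    by move: Vi; rewrite i00 mulr0 addr0 mul1r.
  have -> : i.+1%:R * B1 = i%:R * B1 + B1 by rewrite -natr1 mulrDl mul1r.
  apply: (VB_cat (c := a' + d * i%:R) p1 _ _ _ Vi).
  - by lra.
  - by rewrite st; lra.
  - by apply: IH; rewrite ip ltnW.
move=> L chL; have := P N; rewrite leqnn andbT => /(_ isT); rewrite dN subrKC => V.
apply: le_trans (V L chL) _; rewrite [leRHS](_ : _ = 2 * Num.max 1 (beta - alpha) * B1); last by rewrite /B1; ring.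
by rewrite ler_wpM2r.
Qed.

End GlobalEstimate.

(** * Absolutely continuous functions *)

Section AbsoluteContinuity.
Variable R : realType.
Implicit Types (a b c d x y t K M p : R) (u v H : R -> R) (L Q : seq (R * R)).
Local Notation mu := (@lebesgue_measure R).
Local Notation tot L := (\sum_(q <- L) (q.2 - q.1)).

Definition var u L : R := \sum_(q <- L) `|u q.2 - u q.1|.

(* absolute continuity and bounded variation in one *)
Definition acont a b u := forall e, 0 < e -> exists2 K, 0 <= K &
  forall L, chain a b L -> var u L <= e + K * tot L.

Lemma var_ge0 u L : 0 <= var u L.
Proof. by apply: sumr_ge0 => q _; exact: normr_ge0. Qed.

Lemma var_cat u L Q : var u (L ++ Q) = var u L + var u Q.
Proof. by rewrite /var big_cat. Qed.

Lemma eq_acont a b u v : (forall t, a <= t <= b -> u t = v t) -> acont a b u -> acont a b v.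
Proof.
move=> uv ac e /ac[K K0 HK]; exists K => // L chL; apply: le_trans (HK L chL).
rewrite /var big_seq [leRHS]big_seq; apply: ler_sum => q /(chain_mem chL)[aq q12 qb].
by rewrite !uv//; lra.
Qed.

Lemma acontD a b u v : acont a b u -> acont a b v -> acont a b (fun t => u t + v t).
Proof.
move=> ua va e e0; have e2 : 0 < e / 2 by rewrite divr_gt0.
have [K K0 HK] := ua _ e2; have [M M0 HM] := va _ e2.
exists (K + M); first exact: addr_ge0.
move=> L chL; apply: (@le_trans _ _ (var u L + var v L)); last first.
  by have := HK L chL; have := HM L chL; rewrite mulrDl; lra.
rewrite /var -big_split /=; apply: ler_sum => q _.
have -> : u q.2 + v q.2 - (u q.1 + v q.1) = (u q.2 - u q.1) + (v q.2 - v q.1) by ring.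
exact: ler_normD.
Qed.

Lemma acont_mul a b u phi M K0 : 0 <= M -> 0 <= K0 -> acont a b u ->
  (forall t, a <= t <= b -> `|u t| <= M) -> (forall t, a <= t <= b -> `|phi t| <= M) ->
  (forall x y, a <= x <= b -> a <= y <= b -> `|phi y - phi x| <= K0 * `|y - x|) ->
  acont a b (fun t => phi t * u t).
Proof.
move=> M0 K00 ua uM pM pl e e0; have e1 : 0 < e / (M + 1) by rewrite divr_gt0//; lra.
have [K Kp HK] := ua _ e1; exists (M * K + K0 * M); first by rewrite addr_ge0// mulr_ge0.
move=> L chL; apply: (@le_trans _ _ (M * var u L + K0 * M * tot L)).
  rewrite /var !mulr_sumr -big_split /= big_seq [leRHS]big_seq; apply: ler_sum => q qL.
  have [aq q12 qb] := chain_mem chL qL.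
  have q1 : a <= q.1 <= b by lra.
  have q2 : a <= q.2 <= b by lra.
  have -> : phi q.2 * u q.2 - phi q.1 * u q.1 = phi q.2 * (u q.2 - u q.1) + (phi q.2 - phi q.1) * u q.1 by ring.
  apply: le_trans (ler_normD _ _) _; rewrite !normrM; apply: lerD.
    by rewrite ler_wpM2r// pM.
  rewrite mulrAC; apply: ler_pM; rewrite ?uM//.
  by have := pl q.1 q.2 q1 q2; rewrite [`|q.2 - q.1|]ger0_norm//; lra.
have h1 := ler_wpM2l M0 (HK L chL).
have h2 : M * (e / (M + 1)) <= e.
  have M1 : 0 < M + 1 by lra.
  by rewrite mulrA ler_pdivrMr// mulrC ler_wpM2l ?(ltW e0)//; lra.
by move: h1 h2; rewrite mulrDr !mulrDl !mulrA; clear; lra.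
Qed.

Lemma acont_cont a b u : acont a b u -> forall x, a <= x <= b -> forall e, 0 < e -> exists2 d, 0 < d &
  forall y, a <= y <= b -> `|y - x| < d -> `|u y - u x| < e.
Proof.
move=> ua x xab e e0; have e2 : 0 < e / 2 by rewrite divr_gt0.
have [K K0 HK] := ua _ e2; have K1 : 0 < 2 * (K + 1) by lra.
exists (e / (2 * (K + 1))); first by rewrite divr_gt0.
have key y z : a <= y -> y < z -> z <= b -> z - y < e / (2 * (K + 1)) -> `|u z - u y| < e.
  move=> ay yz zb; rewrite ltr_pdivlMr// => zy.
  have := HK [:: (y, z)]; rewrite /= ay yz zb => /(_ isT); rewrite /var !big_seq1 /=.
  have : (z - y) * K <= (z - y) * (K + 1) by rewrite ler_wpM2l//; lra.
  by move: zy; rewrite mulrCA [K * _]mulrC; lra.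
move=> y yab yx'; case: (ltgtP x y) yx' => [xy|yx|->]; last by rewrite !subrr normr0.
- by rewrite ger0_norm; [move=> h; apply: key; lra|lra].
- by rewrite ler0_norm; [rewrite opprB distrC => h; apply: key; lra|lra].
Qed.

Section TotalVariation.
Variables (a b : R) (u : R -> R).
Hypothesis ua : acont a b u.

Definition tvar x y : R := sup [set s | exists2 L, chain x y L & s = var u L].

Lemma tvar_has_sup x y : a <= x -> x <= y -> y <= b ->
  has_sup [set s | exists2 L, chain x y L & s = var u L].
Proof.
move=> ax xy yb; split.
  by exists (var u [::]), [::].
have [K K0 HK] := ua ltr01; exists (1 + K * (y - x)) => _ [L chL ->].
apply: le_trans (HK L (chain_widenl ax (chain_widenr yb chL))) _.
by rewrite lerD2l ler_wpM2l// (chain_tot chL).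
Qed.

Lemma var_le_tvar x y L : a <= x -> x <= y -> y <= b -> chain x y L -> var u L <= tvar x y.
Proof.
move=> ax xy yb chL; have [_ ub] := tvar_has_sup ax xy yb.
by apply: ub_le_sup ub _ _; exists L.
Qed.

Lemma tvar_approx x y e : a <= x -> x <= y -> y <= b -> 0 < e ->
  exists2 L, chain x y L & tvar x y - e < var u L.
Proof.
move=> ax xy yb e0; have [_ [L chL ->] H] := sup_adherent e0 (tvar_has_sup ax xy yb).
by exists L.
Qed.

Lemma tvar_split x y z : a <= x -> x <= y -> y <= z -> z <= b -> tvar x z = tvar x y + tvar y z.
Proof.
move=> ax xy yz zb; apply/le_anti/andP; split.
  apply: ge_sup; first by case: (tvar_has_sup ax (le_trans xy yz) zb).
  move=> _ [L chL ->]; have -> : var u L = csum (fun s t => `|u t - u s|) L x z.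
    by rewrite /csum (clip_id chL).
  apply: le_trans (csum_split (d := y) _ xy yz _ _) _.
  - by move=> s t _; exact: normr_ge0.
  - move=> s t w _ _; have -> : u w - u s = (u t - u s) + (u w - u t) by ring.
    exact: ler_normD.
  apply: lerD; apply: var_le_tvar => //; try exact: le_trans yz zb; try exact: le_trans ax xy.
    exact: chain_clip_itv chL xy.
  exact: chain_clip_itv chL yz.
apply/ler_addgt0Pr => e e0; have e2 : 0 < e / 2 by rewrite divr_gt0.
have [L1 ch1 H1] := tvar_approx ax xy (le_trans yz zb) e2.
have [L2 ch2 H2] := tvar_approx (le_trans ax xy) yz zb e2.
have := var_le_tvar ax (le_trans xy yz) zb (chain_cat ch1 ch2).
by rewrite var_cat; lra.
Qed.

(** The approximating chain is built inside the intervals of [Q]. Its total length does not grow, so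
    absolute continuity passes from u to its variation function. *)
Lemma var_tvar_approx c d Q e : a <= c -> d <= b -> chain c d Q -> 0 < e ->
  exists L, [/\ chain c d L, tot L <= tot Q & \sum_(q <- Q) tvar q.1 q.2 <= var u L + e].
Proof.
elim: Q c e => [|q Q IH] c e ac db /=.
  by move=> cd e0; exists [::]; split=> //; rewrite /var !big_nil; lra.
case/and3P=> cq q12 chQ e0; have qd := chain_le chQ.
have e2 : 0 < e / 2 by rewrite divr_gt0.
have aq : a <= q.1 by exact: le_trans cq.
have [L1 ch1 H1] := tvar_approx aq (ltW q12) (le_trans qd db) e2.
have [L2 [ch2 tot2 H2]] := IH q.2 _ (le_trans aq (ltW q12)) db chQ e2.
exists (L1 ++ L2); split.
- exact: chain_widenl cq (chain_cat ch1 ch2).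
- by rewrite big_cat big_cons /=; have := chain_tot ch1; lra.
- by rewrite big_cons var_cat; lra.
Qed.

Lemma norm_le_tvar x y : a <= x -> x <= y -> y <= b -> `|u y - u x| <= tvar x y.
Proof.
move=> ax; rewrite le_eqVlt => /orP[/eqP <-|xy] yb.
  rewrite subrr normr0; apply: le_trans (var_ge0 u [::]) _.
  by apply: var_le_tvar => //=.
have := @var_le_tvar x y [:: (x, y)] ax (ltW xy) yb.
by rewrite /= !lexx xy => /(_ isT); rewrite /var big_seq1.
Qed.

Lemma tvarB x y : a <= x -> x <= y -> y <= b -> tvar a y - tvar a x = tvar x y.
Proof. by move=> ax xy yb; rewrite (@tvar_split a x y)//; ring. Qed.

Lemma acont_tvar : acont a b (tvar a).
Proof.
move=> e e0; have e2 : 0 < e / 2 by rewrite divr_gt0.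
have [K K0 HK] := ua e2; exists K => // Q chQ.
have [L [chL tL sL]] := var_tvar_approx (lexx a) (lexx b) chQ e2.
have -> : var (tvar a) Q = \sum_(q <- Q) tvar q.1 q.2.
  rewrite /var; apply: eq_big_seq => q /(chain_mem chQ)[aq q12 qb].
  rewrite tvarB ?(ltW q12)// ger0_norm//.
  exact: le_trans (normr_ge0 _) (norm_le_tvar aq (ltW q12) qb).
apply: le_trans sL _; have := HK L chL; have := ler_wpM2l K0 tL; lra.
Qed.

End TotalVariation.

End AbsoluteContinuity.

(** * Absolutely continuous functions are integrals of their derivatives *)

Section LebesgueStieltjes.
Variable R : realType.
Implicit Types (a b c d x y t K M p : R) (u v H : R -> R) (L Q : seq (R * R)).
Local Notation mu := (@lebesgue_measure R).
Local Notation tot L := (\sum_(q <- L) (q.2 - q.1)).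

Lemma measure_chain (nu : {measure set (measurableTypeR R) -> \bar R}) a b L : chain a b L ->
  nu (\big[setU/set0]_(q <- L) `]q.1, q.2]%classic) = (\sum_(q <- L) nu `]q.1, q.2]%classic)%E.
Proof.
elim: L a => [|q L IH] a /=; first by rewrite !big_nil measure0.
case/and3P=> aq q12 chL; rewrite !big_cons measureU /=; [|exact: measurable_itv| |].
- by congr (_ + _)%E; exact: IH chL.
- by apply: bigsetU_measurable => r _; exact: measurable_itv.
rewrite -subset0 => t [/=]; rewrite in_itv /= => /andP[_ tq].
rewrite -bigcup_seq => -[r /= rL]; rewrite in_itv /= => /andP[rt _].
have [qr _ _] := chain_mem chL rL.
by have := le_lt_trans (le_trans tq qr) rt; rewrite ltxx.
Qed.

Definition grid a d n : seq (R * R) := [seq (a + d * i%:R, a + d * i.+1%:R) | i <- iota 0 n].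

Lemma chain_grid a d n : 0 < d -> chain a (a + d * n%:R) (grid a d n).
Proof.
move=> d0; rewrite /grid; suff H k : chain (a + d * k%:R) (a + d * (k + n)%:R)
    [seq (a + d * i%:R, a + d * i.+1%:R) | i <- iota k n].
  by have := H 0%N; rewrite mulr0 addr0 add0n.
elim: n k => [|n IH] k /=; first by rewrite addn0.
by rewrite lexx ltrD2l ltr_pM2l// ltr_nat ltnSn /= -addSnnS IH.
Qed.

Lemma grid_cell a d n x : 0 < d -> a < x -> x <= a + d * n%:R ->
  exists2 q, q \in grid a d n & q.1 < x <= q.2.
Proof.
move=> d0 ax xn; have ex : exists k, x <= a + d * k%:R by exists n.
have [k xk kmin] := ex_minnP ex.
have [k0|kp] := posnP k; first by move: xk; rewrite k0 mulr0 addr0 leNgt ax.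
exists (a + d * k.-1%:R, a + d * k%:R).
  apply/mapP; exists k.-1; last by rewrite prednK.
  by rewrite mem_iota /= add0n prednK// kmin.
rewrite /= xk andbT ltNge; apply/negP => /kmin.
by rewrite leqNgt prednK// leqnn.
Qed.

Lemma grid_len a d n q : q \in grid a d n -> q.2 - q.1 = d.
Proof. by move=> /mapP[i _ ->] /=; rewrite -natr1; ring. Qed.

Lemma lebesgue_stieltjes_oc (H : cumulative R R) x y : x <= y ->
  lebesgue_stieltjes_measure H `]x, y]%classic = (H y - H x)%:E.
Proof.
move=> xy; rewrite /lebesgue_stieltjes_measure /= /measure_extension /=.
rewrite measurable_mu_extE//; last exact: is_ocitv.
exact: wlength_itv_bnd.
Qed.

(** N is covered by an open set U of small Lebesgue measure. The cells of a uniform grid that lie in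
    U form a chain, on which [acont] bounds the variation of H by e, and every point of U in ]a, b]
    is in such a cell once the grid is fine. *)
Lemma lebesgue_stieltjes_null (H : cumulative R R) a b (N : set R) : a < b -> acont a b H ->
  measurable N -> mu N = 0%E -> lebesgue_stieltjes_measure H (N `&` `]a, b]) = 0%E.
Proof.
move=> ab Ha mN N0; set nu := lebesgue_stieltjes_measure H.
have mNab : measurable (N `&` `]a, b]) by apply: measurableI => //; exact: measurable_itv.
apply/eqP; rewrite eq_le measure_ge0 andbT; apply/lee_addgt0Pr => e e0; rewrite add0e.
have e2 : 0 < e / 2 by rewrite divr_gt0.
have [K K0 HK] := Ha _ e2; have K1 : 0 < 2 * (K + 1) by lra.
have de0 : 0 < e / (2 * (K + 1)) by rewrite divr_gt0.
have finN : (mu N < +oo)%E by rewrite N0.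
have [U [oU NU mUN]] := lebesgue_regularity_outer mN finN de0.
have mU : measurable U by exact: measurable_realfun.open_measurable.
have U1 : (mu U < (e / (2 * (K + 1)))%:E)%E.
  rewrite -(setDUK NU); apply: le_lt_trans (@measureU2 _ _ _ mu _ _ mN (measurableD mU mN)) _.
  by rewrite [X in (X + _)%E]N0 add0e.
pose d (n : nat) : R := (b - a) / n.+1%:R.
have ba0 : 0 < b - a by rewrite subr_gt0.
have d0 n : 0 < d n by rewrite divr_gt0.
have dn n : a + d n * n.+1%:R = b by rewrite divfK//; ring.
pose L n := [seq q <- grid a (d n) n.+1 | asbool (`]q.1, q.2]%classic `<=` U)].
have chL n : chain a b (L n) by apply: chain_filter; rewrite -[X in chain _ X _](dn n); exact: chain_grid.
pose V n := \big[setU/set0]_(q <- L n) `]q.1, q.2]%classic.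
have mV n : measurable (V n) by apply: bigsetU_measurable => q _; exact: measurable_itv.
have VU n : V n `<=` U.
  rewrite /V -bigcup_seq => t [q /=]; rewrite mem_filter => /andP[/asboolP qU _]; exact: qU.
have nuV n : (nu (V n) <= e%:E)%E.
  have -> : nu (V n) = (\sum_(q <- L n) nu `]q.1, q.2]%classic)%E.
    exact: (measure_chain (lebesgue_stieltjes_measure H) (chL n)).
  rewrite (eq_big_seq (fun q : R * R => (`|H q.2 - H q.1|)%:E)); last first.
    move=> q /(chain_mem (chL n))[_ q12 _]; rewrite ger0_norm.
      exact: lebesgue_stieltjes_oc (ltW q12).
    by rewrite subr_ge0 (cumulative_is_nondecreasing H)// ltW.
  rewrite sumEFin lee_fin; apply: le_trans (HK _ (chL n)) _.
  have : ((tot (L n))%:E <= mu U)%E.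
    apply: (@le_trans _ _ (mu (V n))); last by apply: le_measure; rewrite ?inE; [exact: mV|exact: mU|exact: VU].
    have -> : mu (V n) = (\sum_(q <- L n) mu `]q.1, q.2]%classic)%E.
      exact: (measure_chain (@lebesgue_measure R) (chL n)).
    rewrite -sumEFin le_eqVlt; apply/orP; left; apply/eqP.
    apply: eq_big_seq => q /(chain_mem (chL n))[_ q12 _].
    by rewrite lebesgue_measure_itv /= lte_fin q12.
  move=> /le_lt_trans/(_ U1); rewrite lte_fin ltr_pdivlMr// => tn.
  have t0 : 0 <= tot (L n).
    rewrite big_seq; apply: sumr_ge0 => q /(chain_mem (chL n))[_ q12 _].
    by rewrite subr_ge0 ltW.
  by move: tn t0; rewrite mulrCA mulrDr mulr1 [K * _]mulrC; lra.
(* The grids are not nested, so continuity from below is applied to these tail intersections instead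
   of V. *)
pose W n := \bigcap_(k in [set k | (n <= k)%N]) V k.
have mW n : measurable (W n) by apply: bigcap_measurable => [|k _]; [exists n => /=|exact: mV].
have ndW : nondecreasing_seq W.
  move=> n k nk; apply/subsetPset => t Wt i /= ki; apply: Wt; exact: leq_trans nk ki.
have mW' : measurable (\bigcup_n W n) by exact: bigcupT_measurable.
have NW : N `&` `]a, b] `<=` \bigcup_n W n.
  move=> t [/NU Ut]; rewrite /= in_itv /= => /andP[at_ tb].
  have /nbhs_ballP[r /= r0 rU] : nbhs t U by exact: open_nbhs_nbhs.
  have [n nr] : exists n, forall k, (n <= k)%N -> d k < r.
    exists (Num.truncn ((b - a) / r)) => k nk; rewrite /d ltr_pdivrMr// mulrC -ltr_pdivrMr//.
    apply: lt_le_trans (truncnS_gt _) _.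
    by rewrite ler_nat ltnS.
  exists n => // k nk; rewrite /V -bigcup_seq.
  have [q qg tq] : exists2 q, q \in grid a (d k) k.+1 & q.1 < t <= q.2.
    by apply: grid_cell => //; rewrite dn.
  exists q => /=; last by rewrite in_itv.
  rewrite mem_filter qg andbT; apply/asboolP => s /=; rewrite in_itv /= => sq.
  apply: rU; rewrite /ball /=; have := nr k nk; rewrite -(grid_len qg).
  by rewrite ltr_norml; lra.
apply: (@le_trans _ _ (nu (\bigcup_n W n))); first by apply: le_measure; rewrite ?inE.
have cv := nondecreasing_cvg_mu (mu := nu) mW mW' ndW.
have E := cvg_lim (@ereal_hausdorff R) cv.
rewrite [X in (X <= _)%E](_ : _ = limn (nu \o W)); last exact: esym (E _).
apply: lime_le; first by apply: cvgP cv.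
near=> n; apply: le_trans (nuV n).
by apply: le_measure; rewrite ?inE; [exact: mW|exact: mV|move=> t; apply => /=].
Unshelve. all: by end_near.
Qed.

(** u is extended by constants outside [a, b] to a cumulative function on the line; h is the
    Radon-Nikodym derivative of its Lebesgue-Stieltjes measure restricted to ]a, b]. *)
Lemma acont_nd_integral a b u : a < b -> acont a b u ->
  (forall x y, a <= x -> x <= y -> y <= b -> u x <= u y) ->
  exists2 h : R -> R, mu.-integrable setT (EFin \o h) &
  forall x, a <= x <= b -> (\int[mu]_(t in `]a, x]) (h t)%:E = (u x - u a)%:E)%E.
Proof.
move=> ab ua und; pose clamp x := Num.max a (Num.min x b).
have cl x : a <= clamp x <= b by rewrite le_max lexx ge_max (ltW ab) ge_min lexx orbT.
have clid x : a <= x <= b -> clamp x = x.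
  by case/andP=> ax xb; rewrite /clamp (min_idPl xb) (max_idPr ax).
have clnd x y : x <= y -> clamp x <= clamp y by move=> xy; rewrite /clamp; minmax.
have cld x y : `|clamp y - clamp x| <= `|y - x|.
  wlog xy : x y / x <= y.
    by move=> W; have [/W|/ltW/W] := leP x y => //; rewrite distrC [leRHS]distrC.
  rewrite !ger0_norm ?subr_ge0 ?clnd// /clamp; minmax.
pose Hf x := u (clamp x).
have Hnd : nondecreasing Hf.
  move=> x y xy; apply: und; [by case/andP: (cl x)|exact: clnd|by case/andP: (cl y)].
have Hrc : right_continuous Hf.
  apply: right_continuousW => x; apply/cvgrPdist_lt => e e0.
  have [d d0 Hd] := acont_cont ua (cl x) e0.
  exists d => //= y xy; rewrite /Hf distrC; apply: Hd => //.
  by apply: le_lt_trans (cld x y) _; rewrite distrC.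
pose H : cumulative R R := HB.pack_for (cumulative R R) Hf (isCumulative.Build R _ R Hf Hnd Hrc).
have HE x : a <= x <= b -> H x = u x by move=> xab; rewrite /= /Hf clid.
have Ha : acont a b H by apply: eq_acont ua => t tab; rewrite HE.
set nu0 := lebesgue_stieltjes_measure H.
have mD : measurable (`]a, b]%classic : set (measurableTypeR R)) by exact: measurable_itv.
have nfin : (nu0 `]a, b]%classic < +oo)%E by rewrite /nu0 lebesgue_stieltjes_oc ?(ltW ab)// ltry.
pose nu := charge_of_finite_measure (mfrestr mD nfin).
have dom : nu `<< mu.
  move=> N N0 A mA AN; rewrite /nu /charge_of_finite_measure /mfrestr /mrestr.
  by apply: lebesgue_stieltjes_null => //; exact: N0.
pose h t := fine (Radon_Nikodym nu mu t).
have hE : EFin \o h = Radon_Nikodym nu mu.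
  by apply/funext => t; rewrite /= fineK// Radon_Nikodym_fin_num.
exists h; first by rewrite hE; exact: Radon_Nikodym_integrable.
move=> x xab; transitivity (\int[mu]_(t in `]a, x]) Radon_Nikodym nu mu t)%E; first by rewrite -hE.
rewrite -(Radon_Nikodym_integral dom (measurable_itv _)).
transitivity (nu0 (`]a, x]%classic `&` `]a, b]%classic)); first by [].
rewrite (_ : _ `&` _ = `]a, x]%classic).
  have [ax xb] := andP xab.
  by rewrite /nu0 (lebesgue_stieltjes_oc H ax) !HE// lexx ltW.
apply/seteqP; split=> t /=; rewrite !in_itv /=; [by case|].
by case/andP: xab => _ xb /andP[at_ tx]; rewrite at_ tx (le_trans tx xb).
Qed.

(** Jordan decomposition: u = (T + u) - T with T the variation function, both terms being
    nondecreasing. *)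
Lemma acont_integral a b u : a < b -> acont a b u ->
  exists2 h : R -> R, mu.-integrable setT (EFin \o h) &
  forall x, a <= x <= b -> (\int[mu]_(t in `]a, x]) (h t)%:E = (u x - u a)%:E)%E.
Proof.
move=> ab ua; have Ta := acont_tvar ua.
have T1 x y : a <= x -> x <= y -> y <= b -> `|u y - u x| <= tvar u a y - tvar u a x.
  by move=> ax xy yb; rewrite (tvarB ua)// (norm_le_tvar ua).
have [h1 i1 H1] := acont_nd_integral ab Ta (fun x y ax xy yb =>
  (ltac:(by rewrite -subr_ge0; exact: le_trans (normr_ge0 _) (T1 x y ax xy yb)) : tvar u a x <= tvar u a y)).
have [|h2 i2 H2] := acont_nd_integral ab (acontD Ta ua).
  move=> x y ax xy yb; have := T1 x y ax xy yb.
  by rewrite ler_norml; lra.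
exists (fun t => h2 t - h1 t).
  rewrite (_ : EFin \o _ = (EFin \o h2) \- (EFin \o h1))%E; first exact: integrableB.
  by apply/funext => t; rewrite /= EFinB.
move=> x xab; under eq_integral do rewrite EFinB.
rewrite integralB_EFin; [|exact: measurable_itv| |]; last 2 first.
- by apply: integrableS i2 => //; exact: measurable_itv.
- by apply: integrableS i1 => //; exact: measurable_itv.
by rewrite H1// H2// -EFinB; congr EFin; ring.
Qed.

Lemma acont_derivable a b u (h : R -> R) : a < b -> mu.-integrable setT (EFin \o h) ->
  (forall x, a <= x <= b -> (\int[mu]_(t in `]a, x]) (h t)%:E = (u x - u a)%:E)%E) ->
  {ae mu, forall t, t \in `]a, b[ -> is_derive t 1 u (h t)}.
Proof.
move=> ab hi Hu; pose f := h \_ `]a, b].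
have mI : measurable (`]a, b]%classic : set (measurableTypeR R)) by exact: measurable_itv.
have fi : mu.-integrable setT (EFin \o f).
  by rewrite /f -restrict_EFin; apply/(integrable_restrict _ mI); rewrite ?setTI //; exact: integrableS hi.
have loc : locally_integrable setT f by apply: open_integrable_locally => //; exact: openT.
have fiy y : mu.-integrable [set` Interval -oo%O (BRight y)] (EFin \o f).
  by apply: (integrableS measurableT _ _ fi) => //; exact: measurable_itv.
have := FTC1Ny fiy loc.
apply: filterS; first exact: (ae_filter_ringOfSetsType mu).
move=> t [Fd FE] tab; move: (tab); rewrite in_itv /= => /andP[at_ tb].
set F := (fun x : R => _) in Fd FE.
have uF : {near t, F =1 (fun x => u x - u a)}.
  near=> x; have xab : a < x < b.
    apply/andP; split; near: x; [exact: lt_nbhsr|exact: lt_nbhsl].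
  have /andP[ax xb] := xab.
  rewrite /F /Rintegral /=; under eq_integral do rewrite /f.
  rewrite (_ : (\int[mu]_(s in `]-oo, x]) (EFin \o f) s)%E = (u x - u a)%:E)//.
  rewrite -Hu ?(ltW ax) ?(ltW xb)// /f -restrict_EFin -integral_mkcondr; congr (integral _ _ _).
  apply/seteqP; split=> s /=; rewrite !in_itv /=; first by case=> -> /andP[-> _].
  by case/andP=> as_ sx; rewrite sx as_ (le_trans sx (ltW xb)).
have Fis : is_derive t 1 F (h t).
  apply: DeriveDef => //; rewrite -derive1E FE /f patchE ifT// inE /= in_itv /=.
  by rewrite at_ ltW.
have : is_derive t 1 (fun x => u x - u a) (h t) by apply: near_eq_is_derive Fis.
move=> /is_deriveD /(_ (is_derive_cst (u a) t 1)); rewrite addr0.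
by rewrite (_ : _ + _ = u)//; apply/funext => x; exact: subrK.
Unshelve. all: by end_near.
Qed.

End LebesgueStieltjes.

(** * From bounded p-variation inside an open interval to absolute continuity *)

Section InteriorVariation.
Variable R : realType.
Local Notation C := (Rcomplex R).
Implicit Types (a b c d x y t K M p : R) (f g : R -> C) (u v : R -> R) (L Q : seq (R * R)).
Local Notation tot L := (\sum_(q <- L) (q.2 - q.1)).

(** For the slope s this is s <= e s^p + K: with K = e^(-1/(p-1)), either s <= K or e s^(p-1) >=
    1. *)
Lemma rvar_young p e : 1 < p -> 0 < e -> exists2 K, 0 <= K & forall f x y, x < y ->
  nm (f y - f x) <= e * rvar p f x y + K * (y - x).
Proof.
move=> p1 e0; pose K := (e^-1) `^ (p - 1)^-1.
have K0 : 0 < K by rewrite powR_gt0// invr_gt0.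
exists K; first exact: ltW.
move=> f x y xy; have xy0 : 0 < y - x by rewrite subr_gt0.
rewrite /rvar; set s := nm (f y - f x) / (y - x).
have s0 : 0 <= s by rewrite divr_ge0 ?nm_ge0// ltW.
have -> : nm (f y - f x) = s * (y - x) by rewrite divfK// gt_eqF.
rewrite mulrCA [(y - x) * _]mulrC -mulrDl ler_wpM2r ?(ltW xy0)//.
have [sK|Ks] := leP s K; first by rewrite ler_wpDl// mulr_ge0 ?powR_ge0// ltW.
rewrite ler_wpDr ?(ltW K0)// powR_pred ?(lt_trans K0)// mulrA ler_peMl// -ler_pdivrMl// mulr1.
have -> : e^-1 = K `^ (p - 1).
  by rewrite /K -powRrM mulVf ?powRr1 ?invr_ge0 ?(ltW e0)//; apply/eqP; lra.
by apply: ge0_ler_powR; rewrite ?nnegrE ?(ltW K0) ?(ltW Ks)//; lra.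
Qed.

Lemma VB_variation p V e : 1 < p -> 0 <= V -> 0 < e -> exists2 K, 0 <= K & forall f a b L,
  VB p f a b V -> chain a b L -> \sum_(q <- L) nm (f q.2 - f q.1) <= e + K * tot L.
Proof.
move=> p1 V0 e0; have V1 : 0 < V + 1 by lra.
have [|K K0 HK] := @rvar_young p (e / (V + 1)) p1; first by rewrite divr_gt0.
exists K => // f a b L fV chL.
apply: (@le_trans _ _ (\sum_(q <- L) (e / (V + 1) * rvar p f q.1 q.2 + K * (q.2 - q.1)))).
  by rewrite big_seq [leRHS]big_seq; apply: ler_sum => q /(chain_mem chL)[_ q12 _]; exact: HK.
rewrite big_split /= -!mulr_sumr lerD2r.
apply: (@le_trans _ _ (e / (V + 1) * V)); first by rewrite ler_wpM2l ?divr_ge0 ?(ltW e0) ?(ltW V1)//; exact: fV.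
by rewrite mulrAC ler_pdivrMr// ler_wpM2l ?(ltW e0)//; lra.
Qed.

Lemma seq_lower (I : Type) (s : seq I) (x : I -> R) c d : c < d -> (forall i, c < x i) ->
  exists2 a, c < a < d & all (fun i => a <= x i) s.
Proof.
move=> cd cx; elim: s => [|i s [a /andP[ca ad] as_]].
  by exists ((c + d) / 2) => //; apply/andP; split; lra.
exists (Num.min a (x i)); first by rewrite lt_min ca cx gt_min ad.
rewrite /= ge_min lexx orbT /=; apply: sub_all as_ => j aj.
by rewrite ge_min aj.
Qed.

Lemma seq_upper (I : Type) (s : seq I) (x : I -> R) c d : c < d -> (forall i, x i < d) ->
  exists2 b, c < b < d & all (fun i => x i <= b) s.
Proof.
move=> cd xd; have [||a /andP[a1 a2] H] := @seq_lower I s (fun i => - x i) (- d) (- c).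
- by rewrite ltrN2.
- by move=> i; rewrite ltrN2.
exists (- a); first by rewrite ltrNr a2 ltrNl.
by apply: sub_all H => i; rewrite lerNr.
Qed.

Lemma chain_sorted (I : eqType) (s : seq I) (x y : I -> R) a b : a <= b ->
  (forall i, i \in s -> [/\ a <= x i, x i < y i & y i <= b]) ->
  pairwise (fun i j => y i <= x j) s -> chain a b [seq (x i, y i) | i <- s].
Proof.
elim: s a => [|i s IH] a //= ab sP /andP[yi ps].
have [ax xy yb] := sP i (mem_head _ _); rewrite ax xy /=; apply: IH => // j js.
have [_ xyj ybj] := sP j (ltac:(by rewrite inE js orbT)).
by split=> //; exact: (allP yi).
Qed.

Lemma abs_continuous_VB p V (alpha beta : R) f : 1 < p -> 0 <= V -> alpha < beta ->
  (forall a b, alpha < a -> a < b -> b < beta -> VB p f a b V) ->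
  abs_continuous `]alpha, beta[%classic f.
Proof.
move=> p1 V0 ab fV e e0; have e2 : 0 < e / 2 by rewrite divr_gt0.
have [K K0 HK] := VB_variation p1 V0 e2.
have K1 : 0 < 2 * (K + 1) by lra.
exists (e / (2 * (K + 1))); first by rewrite divr_gt0.
move=> m x y xyA xyT xyd.
have xy i : x i < y i by case: (xyA i).
have xab i : alpha < x i.
  have [_ /(_ (x i))] := xyA i; rewrite /= !in_itv /= lexx (ltW (xy i)) => /(_ isT).
  by case/andP.
have yab i : y i < beta.
  have [_ /(_ (y i))] := xyA i; rewrite /= !in_itv /= lexx (ltW (xy i)) => /(_ isT).
  by case/andP.
(* Sorted by left endpoint, disjoint open intervals do not overlap, so the family is a chain in a
   compact subinterval, where the uniform bound V is available. *)
pose s := sort (fun i j => x i <= x j) (enum 'I_m).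
have [a1 /andP[aa1 a1b] H1] := seq_lower (enum 'I_m) ab xab.
have [b1 /andP[a1b1 b1b] H2] := seq_upper (enum 'I_m) a1b yab.
have ps : pairwise (fun i j => y i <= x j) s.
  have tr : transitive (fun i j : 'I_m => x i <= x j) by move=> j i k; exact: le_trans.
  have tt : total (fun i j : 'I_m => x i <= x j) by move=> i j; exact: le_total.
  have p1' : pairwise (fun i j => x i <= x j) s by rewrite -sorted_pairwise// sort_sorted.
  have p2' : pairwise (fun i j => i != j) s.
    by rewrite -uniq_pairwise sort_uniq enum_uniq.
  have : pairwise (fun i j => (x i <= x j) && (i != j)) s by rewrite pairwise_relI p1' p2'.
  apply: sub_pairwise => i j /andP[xij ij]; rewrite leNgt; apply/negP => xjy.
  move/eqP: ij; apply; apply: (xyT i j Logic.I Logic.I).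
  have jl : x j < Num.min (y i) (y j) by rewrite lt_min xjy xy.
  exists ((x j + Num.min (y i) (y j)) / 2).
  have m1 : Num.min (y i) (y j) <= y i by rewrite ge_min lexx.
  have m2 : Num.min (y i) (y j) <= y j by rewrite ge_min lexx orbT.
  by split; rewrite /= in_itv /=; apply/andP; split; order_lra.
have chL : chain a1 b1 [seq (x i, y i) | i <- s].
  apply: chain_sorted => // [|i _]; first exact: ltW.
  split=> //; [apply: (allP H1)|apply: (allP H2)]; exact: mem_enum.
have := HK f a1 b1 _ (fV a1 b1 aa1 a1b1 b1b) chL.
rewrite !big_map /=; have perm_s : perm_eq s (enum 'I_m) by rewrite perm_sort.
have E (F : 'I_m -> R) : \sum_(i <- enum 'I_m) F i = \sum_i F i by rewrite big_enum.
rewrite !(perm_big _ perm_s) /= !E => H.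
apply: le_lt_trans H _; move: xyd; rewrite ltr_pdivlMr//.
have : 0 <= \sum_(i < m) (y i - x i) by apply: sumr_ge0 => i _; rewrite subr_ge0 ltW.
set S := \sum_(i < m) _ => S0 xyd.
have : S * K <= S * (K + 1) by rewrite ler_wpM2l//; lra.
by move: xyd; rewrite mulrCA [K * _]mulrC; lra.
Qed.

Lemma acont_VB (P : C -> R) p V f : 1 < p -> 0 <= V -> (forall z w, P (z - w) = P z - P w) ->
  (forall z, `|P z| <= nm z) -> forall e, 0 < e -> exists2 K, 0 <= K & forall a b L,
  VB p f a b V -> chain a b L -> var (P \o f) L <= e + K * tot L.
Proof.
move=> p1 V0 PB Pn e e0; have [K K0 HK] := VB_variation p1 V0 e0.
exists K => // a1 b1 L fV chL; apply: le_trans (HK f a1 b1 L fV chL).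
by apply: ler_sum => q _; rewrite /= -PB.
Qed.

Section Extension.
Variables (alpha beta : R) (u : R -> R).
Hypothesis ab : alpha < beta.
Hypothesis ui : forall e, 0 < e -> exists2 K, 0 <= K & forall a b L,
  alpha < a -> b < beta -> chain a b L -> var u L <= e + K * tot L.

Lemma interior_unif e : 0 < e -> exists2 d, 0 < d & forall x y, alpha < x < beta -> alpha < y < beta ->
  `|y - x| < d -> `|u y - u x| <= e.
Proof.
move=> e0; have e2 : 0 < e / 2 by rewrite divr_gt0.
have [K K0 HK] := ui e2; have K1 : 0 < 2 * (K + 1) by lra.
exists (e / (2 * (K + 1))); first by rewrite divr_gt0.
have key y z : alpha < y -> y < z -> z < beta -> z - y < e / (2 * (K + 1)) -> `|u z - u y| <= e.
  move=> ay yz zb; rewrite ltr_pdivlMr// => zy.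
  have := HK y z [:: (y, z)] ay zb; rewrite /= !lexx yz => /(_ isT); rewrite /var !big_seq1 /=.
  have : (z - y) * K <= (z - y) * (K + 1) by rewrite ler_wpM2l//; lra.
  by move: zy; rewrite mulrCA [K * _]mulrC; lra.
move=> x y /andP[ax xb] /andP[ay yb] yx'; case: (ltgtP x y) yx' => [xy|yx|->]; last by rewrite !subrr normr0 (ltW e0).
- by rewrite ger0_norm; [move=> h; apply: key; order_lra|order_lra].
- by rewrite ler0_norm; [rewrite opprB distrC => h; apply: key; order_lra|order_lra].
Qed.

(** Uniform continuity makes the values Cauchy at c; the limit is obtained as the supremum of the
    eventual lower bounds. *)
Lemma endpoint_limit c : (forall d, 0 < d -> exists2 x, alpha < x < beta & `|x - c| < d) ->
  exists l, forall e, 0 < e -> exists2 d, 0 < d & forall x, alpha < x < beta -> `|x - c| < d -> `|u x - l| <= e.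
Proof.
move=> cab.
pose S := [set r | exists2 d, 0 < d & forall x, alpha < x < beta -> `|x - c| < d -> r <= u x].
have near e : 0 < e -> exists2 d, 0 < d & forall x, alpha < x < beta -> `|x - c| < d ->
    S (u x - e) /\ forall r, S r -> r <= u x + e.
  move=> e0; have [d d0 Hd] := interior_unif e0.
  have Hd' x y : alpha < x < beta -> alpha < y < beta -> `|x - c| < d / 2 -> `|y - c| < d / 2 -> `|u y - u x| <= e.
    move=> xab yab xc yc; apply: Hd => //; have := ler_distD c y x.
    by rewrite [`|c - x|]distrC; lra.
  exists (d / 2); first by rewrite divr_gt0.
  move=> x xab xc; split.
    exists (d / 2); first by rewrite divr_gt0.
    by move=> y yab yc; have := Hd' x y xab yab xc yc; rewrite ler_norml; lra.
  move=> r [d' d'0 Hr]; have [y yab] := cab (Num.min d' (d / 2)) (ltac:(by rewrite lt_min d'0 divr_gt0)).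
  rewrite lt_min => /andP[y1 y2]; have := Hr y yab y1; have := Hd' x y xab yab xc y2.
  by rewrite ler_norml; order_lra.
exists (sup S) => e e0; have [d d0 Hd] := near e e0; exists d => // x xab xc.
have [Sx Sr] := Hd x xab xc.
have h1 : u x - e <= sup S by apply: ub_le_sup => //; exists (u x + e).
have h2 : sup S <= u x + e by apply: ge_sup => //; exists (u x - e).
by rewrite ler_norml; lra.
Qed.

Lemma acont_extension : exists2 v : R -> R, acont alpha beta v & forall t, alpha < t < beta -> v t = u t.
Proof.
have ba0 : 0 < beta - alpha by rewrite subr_gt0.
have [|la Hla] := @endpoint_limit alpha.
  move=> d d0; exists (alpha + Num.min d (beta - alpha) / 2).
    have : 0 < Num.min d (beta - alpha) by rewrite lt_min d0.
    have : Num.min d (beta - alpha) <= beta - alpha by rewrite ge_min lexx orbT.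
    by move=> ? ?; apply/andP; split; lra.
  have : 0 < Num.min d (beta - alpha) by rewrite lt_min d0.
  have : Num.min d (beta - alpha) <= d by rewrite ge_min lexx.
  by move=> ? ?; rewrite ger0_norm; lra.
have [|lb Hlb] := @endpoint_limit beta.
  move=> d d0; exists (beta - Num.min d (beta - alpha) / 2).
    have : 0 < Num.min d (beta - alpha) by rewrite lt_min d0.
    have : Num.min d (beta - alpha) <= beta - alpha by rewrite ge_min lexx orbT.
    by move=> ? ?; apply/andP; split; lra.
  have : 0 < Num.min d (beta - alpha) by rewrite lt_min d0.
  have : Num.min d (beta - alpha) <= d by rewrite ge_min lexx.
  by move=> ? ?; rewrite ler0_norm; lra.
pose v x := if x <= alpha then la else if beta <= x then lb else u x.
have vu t : alpha < t < beta -> v t = u t.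
  by case/andP=> at_ tb; rewrite /v leNgt at_ /= leNgt tb.
exists v => // e e0; have e2 : 0 < e / 2 by rewrite divr_gt0.
have [K K0 HK] := ui e2; exists K => // L chL.
(* The chain is already fixed, so eta may depend on its number of intervals. Moving all endpoints
   into [c1, c2] changes each increment by at most 4 eta, hence the variation by at most e / 2. *)
pose eta := e / 2 / (4 * (size L).+1%:R).
have sz0 : 0 < 4 * (size L).+1%:R :> R by rewrite mulr_gt0.
have eta0 : 0 < eta by rewrite divr_gt0.
have [da da0 Ha] := Hla eta eta0; have [db db0 Hb] := Hlb eta eta0.
pose m := Num.min (Num.min da db) (beta - alpha).
have m0 : 0 < m by rewrite !lt_min da0 db0.
have ma : m <= da by rewrite /m !ge_min lexx.
have mb : m <= db by rewrite /m !ge_min lexx orbT.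
have mba : m <= beta - alpha by rewrite /m !ge_min lexx orbT.
pose d := m / 3; have d0 : 0 < d by rewrite divr_gt0.
have d3 : d * 3 = m by rewrite /d divfK.
pose c1 := alpha + d; pose c2 := beta - d.
have c1ab : alpha < c1 < beta by rewrite /c1; apply/andP; split; order_lra.
have c2ab : alpha < c2 < beta by rewrite /c2; apply/andP; split; order_lra.
have c12 : c1 < c2 by rewrite /c1 /c2; order_lra.
have na x : alpha <= x -> x <= c1 -> `|v x - la| <= eta.
  rewrite le_eqVlt => /orP[/eqP <- _|ax xc]; first by rewrite /v lexx subrr normr0 ltW.
  have xab : alpha < x < beta by case/andP: c1ab => _ /(le_lt_trans xc) ->; rewrite ax.
  by rewrite vu//; apply: Ha => //; rewrite ger0_norm; move: xc; rewrite /c1; order_lra.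
have nb x : c2 <= x -> x <= beta -> `|v x - lb| <= eta.
  move=> cx; rewrite le_eqVlt => /orP[/eqP ->|xb].
    by rewrite /v [beta <= alpha]leNgt ab /= lexx subrr normr0 ltW.
  have xab : alpha < x < beta by case/andP: c2ab => /lt_le_trans/(_ cx) -> _; rewrite xb.
  by rewrite vu//; apply: Hb => //; rewrite ler0_norm; move: cx; rewrite /c2; order_lra.
pose cl x := Num.max c1 (Num.min x c2).
have clv x : alpha <= x <= beta -> `|v x - v (cl x)| <= 2 * eta.
  case/andP=> ax xb; rewrite /cl; have [xc1|c1x] := leP x c1.
    have -> : Num.max c1 (Num.min x c2) = c1.
      by rewrite (min_idPl (le_trans xc1 (ltW c12))) (max_idPl xc1).
    have := na x ax xc1; have := na c1 (ltW (ltac:(by case/andP: c1ab) : alpha < c1)) (lexx _).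
    by rewrite !ler_norml; order_lra.
  have [c2x|xc2] := leP c2 x.
    rewrite (max_idPr (ltW c12)).
    have := nb x c2x xb; have := nb c2 (lexx _) (ltW (ltac:(by case/andP: c2ab) : c2 < beta)).
    by rewrite !ler_norml; order_lra.
  by rewrite (max_idPr (ltW c1x)) subrr normr0 mulr_ge0// ltW.
have chc : chain c1 c2 (clip c1 c2 L) by apply: chain_clip_itv chL (ltW c12).
have S1 : \sum_(q <- L) `|v (cl q.2) - v (cl q.1)| <= var u (clip c1 c2 L).
  have -> : var u (clip c1 c2 L) = var v (clip c1 c2 L).
    apply: eq_big_seq => q /(chain_mem chc)[h1 h2 h3].
    by rewrite !vu//; move: c1ab c2ab => /andP[? ?] /andP[? ?]; apply/andP; split; order_lra.
  rewrite /var /clip big_filter big_map [leRHS]big_mkcond big_seq [leRHS]big_seq /=.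
  apply: ler_sum => q /(chain_mem chL)[aq q12 qb]; case: ifPn => [h|].
    move: (h); rewrite gt_max !lt_min => /andP[/andP[_ q1c] /andP[cq2 _]].
    have hc : c1 <= Num.min q.2 c2 by rewrite le_min (ltW cq2) ltW.
    by rewrite /cl (min_idPl (ltW q1c)) (max_idPr hc) maxC.
  rewrite -leNgt ge_min !le_max -!orbA => /or4P[h|h|h|h].
  - by move: q12; rewrite ltNge h.
  - have hc : Num.min q.2 c2 <= c1 by rewrite ge_min h.
    have hc' : Num.min q.1 c2 <= c1 by rewrite ge_min (le_trans (ltW q12) h).
    by rewrite /cl (max_idPl hc) (max_idPl hc') subrr normr0.
  - by rewrite /cl (min_idPr h) (min_idPr (le_trans h (ltW q12))) subrr normr0.
  - by move: c12; rewrite ltNge h.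
have S2 : tot (clip c1 c2 L) <= tot L.
  rewrite /clip big_filter big_map big_mkcond big_seq [leRHS]big_seq /=.
  apply: ler_sum => q /(chain_mem chL)[aq q12 qb]; case: ifP => _; last by rewrite subr_ge0 ltW.
  by apply: lerB; rewrite ?ge_min ?le_max lexx.
have S3 : var v L <= \sum_(q <- L) (`|v (cl q.2) - v (cl q.1)| + 4 * eta).
  rewrite /var big_seq [leRHS]big_seq; apply: ler_sum => q /(chain_mem chL)[aq q12 qb].
  have h1 := clv q.1 (ltac:(by apply/andP; split; order_lra)).
  have h2 := clv q.2 (ltac:(by apply/andP; split; order_lra)).
  have -> : v q.2 - v q.1 = (v (cl q.2) - v (cl q.1)) + ((v q.2 - v (cl q.2)) - (v q.1 - v (cl q.1))) by ring.
  apply: le_trans (ler_normD _ _) _; rewrite lerD2l; apply: le_trans (ler_normB _ _) _; order_lra.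
have S4 : \sum_(q <- L) 4 * eta <= e / 2.
  rewrite big_const_seq count_predT iter_addr_0 -[_ *+ size L]mulr_natr /eta.
  have -> : 4 * (e / 2 / (4 * (size L).+1%:R)) * (size L)%:R = e / 2 * ((size L)%:R / (size L).+1%:R).
    by field; rewrite nat1r pnatr_eq0.
  by rewrite ler_piMr ?(ltW e2)// ler_pdivrMr// mul1r ler_nat.
move: S3; rewrite big_split /= => S3.
have /andP[ac1 _] := c1ab; have /andP[_ c2b] := c2ab.
have S5 := HK c1 c2 _ ac1 c2b chc.
have S6 := ler_wpM2l K0 S2.
by move: S1 S3 S4 S5 S6; clear; lra.
Qed.

End Extension.
End InteriorVariation.

(** * The derivative *)

Section DerivativeNorm.
Variable R : realType.
Local Notation C := (Rcomplex R).
Implicit Types (a b c d x y t K M p : R) (f g : R -> C) (u v : R -> R) (L Q : seq (R * R)).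
Local Notation mu := (@lebesgue_measure R).

Definition has_slope f t (z : C) := forall e, 0 < e -> exists2 d, 0 < d &
  forall h, `|h| < d -> nm (f (h + t) - f t - cR h * z) <= e * `|h|.

Lemma has_slope_chord f t z e : has_slope f t z -> 0 < e -> exists2 d, 0 < d &
  forall x y, x < t -> t <= y -> y - x < d -> nm z - e <= nm (f y - f x) / (y - x).
Proof.
move=> fz e0; have [d d0 Hd] := fz e e0; exists d => // x y xt ty yx.
have yx0 : 0 < y - x by lra.
have h1 := Hd (y - t); rewrite subrK ger0_norm in h1; last lra.
have h2 := Hd (x - t); rewrite subrK ler0_norm in h2; last lra.
have {}h1 := h1 (ltac:(lra)); have {}h2 := h2 (ltac:(lra)).
rewrite ler_pdivlMr//.
have : nm (cR (y - x) * z) <= nm (f y - f x) + e * (y - x).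
  have -> : cR (y - x) * z = (f y - f x) - ((f y - f t - cR (y - t) * z) - (f x - f t - cR (x - t) * z)).
    by have -> : y - x = (y - t) - (x - t) by [ring]; rewrite rmorphB /=; ring.
  apply: le_trans (nmB _ _) _; rewrite lerD2l; apply: le_trans (nmB _ _) _.
  by move: h1 h2; clear; lra.
by rewrite nmM nm_cR ger0_norm ?(ltW yx0)//; lra.
Qed.

Lemma le_limn_einf (w : nat -> \bar R) (x : \bar R) N :
  (forall k, (N <= k)%N -> (x <= w k)%E) -> (x <= limn_einf w)%E.
Proof.
move=> H; rewrite limn_einf_lim; apply: lime_ge; first exact: is_cvg_einfs.
near=> n; apply: le_ereal_inf_tmp => _ [k /= nk <-]; apply: H.
by apply: leq_trans nk; near: n; exists N.
Unshelve. all: by end_near. Qed.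

Lemma limn_einf_le (w : nat -> \bar R) (x : \bar R) : (forall k, (w k <= x)%E) -> (limn_einf w <= x)%E.
Proof.
move=> H; rewrite limn_einf_lim; apply: lime_le; first exact: is_cvg_einfs.
near=> n; apply: le_trans (H n); apply: ereal_inf_lbound; exists n => //=.
Unshelve. all: by end_near. Qed.

(* No measurability of g is required: the integral of a nonnegative function is
   the supremum of the integrals of the simple functions below it. *)
Lemma Lp_norm_le_integral p (D : set (measurableTypeR R)) (l : R -> \bar R) V g : 1 <= p -> 0 <= V ->
  (forall t, D t -> (0 <= l t)%E) -> (forall t, D t -> ((nm (g t) `^ p)%:E <= l t)%E) ->
  (\int[mu]_(t in D) l t <= V%:E)%E -> (Lp_norm p D g <= (V `^ p^-1)%:E)%E.
Proof.
move=> p1 V0 l0 gl lV; have p0 : 0 < p by lra.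
rewrite /Lp_norm Lnorm.unlock -poweR_EFin.
set F := (fun t => `|g t|%:E) \_ D.
have I0 : (0 <= \int[mu]_x `|F x| `^ p)%E by apply: integral_ge0 => t _; exact: poweR_ge0.
apply: gt0_ler_poweR; [by rewrite invr_ge0 ltW|by rewrite in_itv /= I0 leey|by rewrite in_itv /= lee_fin V0 leey|].
apply: le_trans lV.
rewrite [leRHS]integral_mkcond !ge0_integralE//; first last.
- by move=> t _; apply: poweR_ge0.
- by move=> t _; apply: erestrict_ge0 => s Ds; exact: l0.
apply: le_ereal_sup => _ [h hle <-]; exists h => // t; apply: le_trans (hle t) _.
rewrite !patch_setT /= /F !patchE; case: ifPn => [tA|_]; last first.
  by rewrite abse0 poweR0r// gt_eqF.
by rewrite abse_EFin poweR_EFin normr_id; apply: gl; move: tA; rewrite inE.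
Qed.

Section Fatou.
Variables (alpha beta : R).
Hypothesis ab : alpha < beta.
Let A := (`]alpha, beta[%classic : set (measurableTypeR R)).
(** Of k + 3 equal cells the two outermost are dropped, so that the grid stays in the open interval,
    where the variation is bounded. *)
Let d k : R := (beta - alpha) / k.+3%:R.
Let grd k := grid (alpha + d k) (d k) k.+1.

Definition chord_fun p f k t : R :=
  \sum_(q <- grd k) (nm (f q.2 - f q.1) / (q.2 - q.1)) `^ p * \1_(`]q.1, q.2]%classic) t.

Lemma grid_step k : 0 < d k.
Proof. by rewrite divr_gt0// subr_gt0. Qed.

Lemma grid_end k : alpha + d k + d k * k.+1%:R = beta - d k.
Proof.
have : d k * k.+3%:R = beta - alpha by rewrite divfK// pnatr_eq0.
by rewrite -[k.+3%:R]natr1 -[k.+2%:R]natr1 !mulrDr mulr1; lra.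
Qed.

Lemma chain_grd k : chain (alpha + d k) (beta - d k) (grd k).
Proof. by rewrite -grid_end; apply: chain_grid; exact: grid_step. Qed.

Lemma measurable_chord_fun p f k : measurable_fun A (chord_fun p f k).
Proof.
by apply: measurable_sum => q; apply: measurable_funM.
Qed.

Lemma chord_fun_ge0 p f k t : 0 <= chord_fun p f k t.
Proof. by apply: sumr_ge0 => q _; rewrite mulr_ge0 ?powR_ge0. Qed.

Lemma integral_chord_fun p f V k : (forall a b, alpha < a -> a < b -> b < beta -> VB p f a b V) ->
  (\int[mu]_(t in A) (chord_fun p f k t)%:E <= V%:E)%E.
Proof.
move=> fV; have dk := grid_step k; have chk := chain_grd k.
have mA : measurable A by exact: measurable_itv.
under eq_integral do rewrite -sumEFin.
have mq (q : R * R) : measurable_fun A (fun t : R =>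
    ((nm (f q.2 - f q.1) / (q.2 - q.1)) `^ p * \1_(`]q.1, q.2]%classic) t)%:E).
  by apply/measurable_EFinP; apply: measurable_funM.
rewrite ge0_integral_sum//; last by move=> q t _; rewrite lee_fin mulr_ge0 ?powR_ge0.
have V1 : VB p f (alpha + d k) (beta - d k) V.
  have := grid_end k; have : 0 < d k * k.+1%:R by rewrite mulr_gt0.
  by move=> h1 h2; apply: fV; lra.
apply: (@le_trans _ _ (\sum_(q <- grd k) rvar p f q.1 q.2)%:E); last by rewrite lee_fin V1.
rewrite -sumEFin big_seq [leRHS]big_seq; apply: lee_sum => q /(chain_mem chk)[aq q12 qb].
under eq_integral do rewrite EFinM.
rewrite ge0_integralZl_EFin//; first last.
- exact: powR_ge0.
- by apply/measurable_EFinP; apply: measurable_indic; exact: measurable_itv.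
have mI : measurable (`]q.1, q.2]%classic : set (measurableTypeR R)) by exact: measurable_itv.
rewrite integral_indic// /rvar [in leRHS]mulrC EFinM.
apply: lee_wpmul2l; first by rewrite lee_fin powR_ge0.
have muI : mu `]q.1, q.2]%classic = (q.2 - q.1)%:E by rewrite lebesgue_measure_itv /= lte_fin q12.
rewrite -muI; apply: le_measure; rewrite ?inE//; exact: measurableI.
Qed.

Definition slope_pow p f t : \bar R := limn_einf (fun k => (chord_fun p f k t)%:E).

Lemma slope_pow_ge0 p f t : (0 <= slope_pow p f t)%E.
Proof. by apply: (@le_limn_einf _ _ 0%N) => k _; rewrite lee_fin chord_fun_ge0. Qed.

Lemma integral_slope_pow p f V : (forall a b, alpha < a -> a < b -> b < beta -> VB p f a b V) ->
  (\int[mu]_(t in A) slope_pow p f t <= V%:E)%E.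
Proof.
move=> fV; apply: (le_trans (fatou _ _ _ _)).
- exact: measurable_itv.
- by move=> k; apply/measurable_EFinP; exact: measurable_chord_fun.
- by move=> k t _; rewrite lee_fin chord_fun_ge0.
- by apply: limn_einf_le => k; exact: integral_chord_fun.
Qed.

(** The cell containing t shrinks to t, and its chord has slope at least any r < |z| in the end; r
    is chosen with r^p = |z|^p - e. *)
Lemma slope_pow_le p f t z : 1 <= p -> alpha < t < beta -> has_slope f t z ->
  ((nm z `^ p)%:E <= slope_pow p f t)%E.
Proof.
move=> p1 /andP[at_ tb] fz; have p0 : 0 < p by lra.
apply/lee_addgt0Pr => e e0.
have [small|big] := leP (nm z `^ p) e.
  apply: (@le_trans _ _ e%:E); first by rewrite lee_fin.
  by rewrite -[leLHS]add0e leeD2r// slope_pow_ge0.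
have be : 0 <= nm z `^ p - e by lra.
pose r := (nm z `^ p - e) `^ p^-1.
have r0 : 0 <= r by exact: powR_ge0.
have rp : r `^ p = nm z `^ p - e by rewrite /r -powRrM mulVf ?gt_eqF// powRr1.
have rz : r < nm z.
  rewrite ltNge; apply/negP => zr.
  have : nm z `^ p <= r `^ p by apply: ge0_ler_powR; rewrite ?nnegrE ?nm_ge0// ltW.
  by rewrite rp; lra.
have [dd dd0 Hd] := has_slope_chord fz (ltac:(by rewrite subr_gt0) : 0 < nm z - r).
have small (s : R) : 0 < s -> exists N, forall k, (N <= k)%N -> d k < s.
  move=> s0; exists (Num.truncn ((beta - alpha) / s)) => k nk.
  rewrite /d ltr_pdivrMr// mulrC -ltr_pdivrMr//.
  apply: lt_le_trans (truncnS_gt _) _.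
  by rewrite ler_nat ltnS (leq_trans nk)// -addn2 leq_addr.
pose m := Num.min dd (Num.min (t - alpha) (beta - t)).
have [|N HN] := small m; first by rewrite !lt_min dd0 !subr_gt0 at_.
rewrite -leeBlDr// -EFinB -rp; apply: (@le_limn_einf _ _ N) => k Nk; rewrite lee_fin.
have := HN k Nk; rewrite !lt_min => /and3P[k1 k2 k3].
have [|| q qg tq] := @grid_cell R (alpha + d k) (d k) k.+1 t (grid_step k).
- by rewrite -ltrBrDl.
- by rewrite grid_end; lra.
have [aq q12 qb] := chain_mem (chain_grd k) qg.
have /andP[q1t tq2] := tq.
apply: (@le_trans _ _ ((nm (f q.2 - f q.1) / (q.2 - q.1)) `^ p)).
  have q0 : 0 < q.2 - q.1 by lra.
  apply: ge0_ler_powR; rewrite ?nnegrE ?divr_ge0 ?nm_ge0 ?(ltW q0) ?(ltW p0)//.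
  by have := Hd q.1 q.2 q1t tq2; rewrite (grid_len qg) => /(_ k1); lra.
rewrite /chord_fun (big_rem q)//= indicE mem_set ?mulr1; last by rewrite /= in_itv.
by rewrite lerDl sumr_ge0// => r' _; rewrite mulr_ge0 ?powR_ge0.
Qed.

End Fatou.
End DerivativeNorm.

(** * The almost everywhere derivative is the weak derivative *)

Section WeakDerivative.
Variable R : realType.
Local Notation C := (Rcomplex R).
Implicit Types (a b c d x y t K M p : R) (f g : R -> C) (u v h : R -> R) (L Q : seq (R * R)).
Local Notation mu := (@lebesgue_measure R).
Local Notation I := (fun a b : R => `]a, b[%classic : set (measurableTypeR R)).

Lemma acont_within a b u : acont a b u -> {within `[a, b], continuous u}.
Proof.
move=> ua; apply/subspace_continuousP => x /= xab; apply/cvgrPdist_lt => e e0.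
move: xab; rewrite in_itv /= => xab; have [d d0 Hd] := acont_cont ua xab e0.
have N : \forall t \near nbhs x, `|x - t| < d.
  exact: (@cvgr_dist_lt _ _ _ (nbhs x) _ id x cvg_id _ d0).
rewrite /prop_near1 /within; apply: filterS N => t td tab.
by rewrite distrC; apply: Hd; [move: tab; rewrite /= in_itv|rewrite distrC].
Qed.

Lemma acont_bounded a b u : a < b -> acont a b u -> exists2 M, 0 <= M & forall t, a <= t <= b -> `|u t| <= M.
Proof.
move=> ab ua; have [K K0 HK] := ua 1 ltr01.
exists (`|u a| + (1 + K * (b - a))).
  by rewrite addr_ge0// addr_ge0// mulr_ge0// subr_ge0 ltW.
move=> t /andP[at_ tb]; have -> : u t = u a + (u t - u a) by ring.
apply: le_trans (ler_normD _ _) _; rewrite lerD2l.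
have [->|ta] := eqVneq t a; first by rewrite subrr normr0 addr_ge0// mulr_ge0// subr_ge0 ltW.
have at' : a < t by rewrite lt_neqAle eq_sym ta.
have := HK [:: (a, t)]; rewrite /= lexx at' tb => /(_ isT); rewrite /var !big_seq1 /= => /le_trans; apply.
by rewrite lerD2l ler_wpM2l//; lra.
Qed.

Lemma derivable_cont u : (forall t, derivable u t 1) -> continuous u.
Proof. by move=> ud t; apply: differentiable_continuous; apply/derivable1_diffP. Qed.

Lemma within_bounded_real a b u : a <= b -> {within `[a, b], continuous u} ->
  exists2 M, 0 <= M & forall t, a <= t <= b -> `|u t| <= M.
Proof.
move=> ab uc; have [M [_ HM]] := compact_bounded (continuous_compact uc (@segment_compact R a b)).
exists (`|M| + 1); first by rewrite addr_ge0.
move=> t tab; apply: (HM (`|M| + 1)); first by have := ler_norm M; lra.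
by exists t => //=; rewrite in_itv.
Qed.

Lemma bounded_on (A : set R) u M : (forall t, A t -> `|u t| <= M) -> [bounded u x | x in A].
Proof.
move=> uM; exists M; split; first exact: num_real.
by move=> x Mx t At; apply: le_trans (uM t At) (ltW Mx).
Qed.

(** phi v is absolutely continuous and vanishes at both ends, so its density k has integral 0; by
    the product rule k = phi' v + phi h almost everywhere. *)
Lemma weak_derivative_real alpha beta v h phi : alpha < beta -> acont alpha beta v ->
  mu.-integrable setT (EFin \o h) ->
  {ae mu, forall t, t \in `]alpha, beta[ -> is_derive t 1 v (h t)} ->
  test_function (I alpha beta) phi ->
  \int[mu]_(t in I alpha beta) (derive1 phi t * v t) = - \int[mu]_(t in I alpha beta) (phi t * h t).
Proof.
move=> ab va hi vh [pd [Kc [cK KA p0]]].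
have pder t : derivable phi t 1 by exact: (pd 0%N t).
have pc := derivable_cont pder.
have p'c : continuous (derive1 phi) by apply: derivable_cont => t; exact: (pd 1%N t).
have sub : I alpha beta `<=` `[alpha, beta] by apply: subset_itvW.
have [M1 M10 H1] := within_bounded_real (ltW ab) (continuous_subspaceT pc).
have [M2 M20 H2] := within_bounded_real (ltW ab) (continuous_subspaceT p'c).
have [M3 M30 H3] := acont_bounded ab va.
have plip x y : alpha <= x <= beta -> alpha <= y <= beta -> `|phi y - phi x| <= M2 * `|y - x|.
  wlog xy : x y / x <= y.
    move=> W xab yab; have [xy|/ltW yx] := leP x y; first exact: W.
    by rewrite distrC [`|y - x|]distrC; exact: W.
  move=> /andP[ax xb] /andP[ay yb]; move: xy; rewrite le_eqVlt => /orP[/eqP <-|xy].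
    by rewrite !subrr normr0 mulr0.
  have [t _||c cxy ->] := @MVT R phi (derive1 phi) x y xy.
  - by apply: DeriveDef; rewrite ?derive1E.
  - exact: continuous_subspaceT.
  rewrite normrM ler_wpM2r//; apply: H2; move: cxy; rewrite in_itv /= => /andP[? ?].
  by apply/andP; split; lra.
pose w t := phi t * v t.
have wa : acont alpha beta w.
  apply: (@acont_mul R alpha beta v phi (M1 + M3) M2) => //.
  - exact: addr_ge0.
  - by move=> t tab; have := H3 t tab; lra.
  - by move=> t tab; have := H1 t tab; lra.
have [k ki Hk] := acont_integral ab wa.
have wk := acont_derivable ab ki Hk.
have mI : measurable (I alpha beta) by exact: measurable_itv.
have muI : (mu (I alpha beta) < +oo)%E by rewrite lebesgue_measure_itv /= lte_fin ab -EFinB ltry.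
have sI (u : R -> R) : mu.-integrable setT (EFin \o u) -> mu.-integrable (I alpha beta) (EFin \o u).
  by apply: integrableS => //.
have int0 : (\int[mu]_(t in I alpha beta) (k t)%:E = 0)%E.
  rewrite integral_itv_bndo_bndc; last first.
    by apply: (measurable_int mu); exact: sI ki.
  rewrite Hk; last by rewrite lexx ltW.
  have nKa : ~ Kc alpha by move=> /KA /=; rewrite in_itv /= ltxx.
  have nKb : ~ Kc beta by move=> /KA /=; rewrite in_itv /= ltxx andbF.
  by rewrite /w (p0 _ nKa) (p0 _ nKb) !mul0r subrr.
have i1 : mu.-integrable (I alpha beta) (EFin \o (fun t => derive1 phi t * v t)).
  have mJ : measurable (`[alpha, beta]%classic : set (measurableTypeR R)) by exact: measurable_itv.
  apply: (integrableS mJ mI sub).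
  apply: continuous_compact_integrable; first exact: segment_compact.
  move=> x; apply: (@continuousM R (subspace `[alpha, beta])).
    exact: continuous_subspaceT.
  exact: acont_within.
have i2 : mu.-integrable (I alpha beta) (EFin \o (fun t => phi t * h t)).
  have -> : EFin \o (fun t => phi t * h t) = ((EFin \o phi) \* (EFin \o h))%E.
    by apply/funext => t /=; rewrite EFinM.
  apply: integrableMr => //; last exact: sI.
    apply: measurable_funTS; exact: continuous_measurable_fun.
  by apply: (@bounded_on _ _ M1) => t /sub /=; rewrite in_itv /=; exact: H1.
have E : (\int[mu]_(t in I alpha beta) (k t)%:E =
    \int[mu]_(t in I alpha beta) ((derive1 phi t * v t)%:E + (phi t * h t)%:E))%E.
  apply: ae_eq_integral => //.
  - by apply: (measurable_int mu); exact: sI ki.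
  - by apply: emeasurable_funD; apply: (measurable_int mu); [exact: i1|exact: i2].
  apply: (@filterS2 _ _ (ae_filter_ringOfSetsType mu) _ _ _ _ wk vh) => t wkt vht tI.
  have tab : t \in `]alpha, beta[ by exact: tI.
  have wd := wkt tab; have vd := vht tab.
  have pd' : is_derive t 1 phi (derive1 phi t) by apply: DeriveDef; rewrite ?derive1E.
  have := is_deriveM pd' vd => wd2.
  have := @derive_val _ _ _ _ _ _ _ wd; have := @derive_val _ _ _ _ _ _ _ wd2.
  rewrite (_ : phi * v = w)// => -> /= <-; rewrite -EFinD; congr EFin.
  by rewrite addrC [v t *: _]mulrC.
rewrite /Rintegral -fineN; congr fine.
move: E; rewrite int0 integralD_EFin// => /esym E.
have f1 := integral_fune_fin_num mI i1; have f2 := integral_fune_fin_num mI i2.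
move: E f1 f2; rewrite /comp; set X := (\int[mu]_(t in _) _)%E; set Y := (\int[mu]_(t in _) _)%E.
move=> E f1 f2; rewrite -(fineK f1) -(fineK f2) -EFinD in E *.
by case: E => /eqP; rewrite addr_eq0 => /eqP ->.
Qed.

Lemma is_derive_slope v t l : is_derive t 1 v l -> forall e, 0 < e -> exists2 d, 0 < d &
  forall s, `|s| < d -> `|v (s + t) - v t - s * l| <= e * `|s|.
Proof.
case=> vd <- e e0; rewrite /derivable in vd; have /cvgrPdist_lt/(_ _ e0)[d /= d0 Hd] := vd.
exists d => // s sd; have [->|s0] := eqVneq s 0.
  by rewrite add0r subrr mul0r subr0 normr0 mulr0.
have := Hd s; rewrite /= sub0r normrN => /(_ sd s0) /ltW.
rewrite [s%:A]mulr1 => H.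
have -> : v (s + t) - v t - s * 'D_1 v t = s * (s^-1 * (v (s + t) - v t) - 'D_1 v t).
  by rewrite mulrBr mulrA divff// mul1r.
by rewrite normrM mulrC ler_wpM2r// distrC.
Qed.

Lemma has_slope_parts alpha beta f v1 v2 t l1 l2 : alpha < t < beta ->
  (forall s, alpha < s < beta -> v1 s = complex.Re (f s)) ->
  (forall s, alpha < s < beta -> v2 s = complex.Im (f s)) ->
  is_derive t 1 v1 l1 -> is_derive t 1 v2 l2 -> has_slope f t (Complex l1 l2).
Proof.
move=> /andP[at_ tb] E1 E2 D1 D2 e e0; have e2 : 0 < e / 2 by rewrite divr_gt0.
have [d1 d10 H1] := is_derive_slope D1 e2; have [d2 d20 H2] := is_derive_slope D2 e2.
exists (Num.min (Num.min d1 d2) (Num.min (t - alpha) (beta - t))).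
  by rewrite !lt_min d10 d20 !subr_gt0 at_.
move=> s; rewrite !lt_min => /andP[/andP[s1 s2] /andP[s3 s4]].
have sab : alpha < s + t < beta by move: s3 s4; rewrite !ltr_norml; lra.
have tab : alpha < t < beta by rewrite at_.
apply: le_trans (nm_le_ReIm _) _.
have := H1 s s1; have := H2 s s2; rewrite !E1// !E2//.
have -> : complex.Re (f (s + t) - f t - cR s * Complex l1 l2) =
    complex.Re (f (s + t)) - complex.Re (f t) - s * l1.
  by case: (f (s + t)) (f t) => [x y] [x' y'] /=; rewrite mul0r subr0.
have -> : complex.Im (f (s + t) - f t - cR s * Complex l1 l2) =
    complex.Im (f (s + t)) - complex.Im (f t) - s * l2.
  by case: (f (s + t)) (f t) => [x y] [x' y'] /=; rewrite mul0r addr0.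
by move=> h2 h1; lra.
Qed.

(** g is set to 0 on the null set where one of the parts fails to have the expected derivative. Thus
    g is 0 or a slope at every point, and the norm bound needs no almost everywhere argument. *)
Lemma slope_exists alpha beta p V f : alpha < beta -> 1 < p -> 0 <= V ->
  (forall a b, alpha < a -> a < b -> b < beta -> VB p f a b V) ->
  exists g, [/\ measurable_fun (I alpha beta) (fun t => complex.Re (g t)),
    measurable_fun (I alpha beta) (fun t => complex.Im (g t)),
    (forall t, alpha < t < beta -> g t = 0 \/ has_slope f t (g t)),
    (exists2 M, 0 <= M & forall t, alpha < t < beta -> nm (f t) <= M)
    & weak_derivative (I alpha beta) f g].
Proof.
move=> ab p1 V0 fV.
have part (P : C -> R) : (forall z w, P (z - w) = P z - P w) -> (forall z, `|P z| <= nm z) ->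
    exists v h, [/\ acont alpha beta v, forall t, alpha < t < beta -> v t = P (f t),
      mu.-integrable setT (EFin \o h) &
      {ae mu, forall t, t \in `]alpha, beta[ -> is_derive t 1 v (h t)}].
  move=> PB Pn.
  have ui e : 0 < e -> exists2 K, 0 <= K & forall a b L, alpha < a -> b < beta -> chain a b L ->
      var (P \o f) L <= e + K * \sum_(q <- L) (q.2 - q.1).
    move=> e0; have [K K0 HK] := acont_VB f p1 V0 PB Pn e0; exists K => // a b L aa bb chL.
    have [abl|abl] := ltP a b; first by apply: HK chL; exact: fV.
    have ->: L = [::].
      case: L chL => // q L /= /and3P[h1 h2 /chain_le h3].
      by have := lt_le_trans (le_lt_trans h1 h2) h3; rewrite ltNge abl.
    by rewrite /var !big_nil mulr0 addr0 ltW.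
  have [v va vE] := acont_extension ab ui.
  have [h hi Hh] := acont_integral ab va.
  by exists v, h; split=> //; exact: acont_derivable Hh.
have ImB (z w : C) : complex.Im (z - w) = complex.Im z - complex.Im w by case: z w => [? ?] [? ?].
have [v1 [h1 [a1 E1 i1 D1]]] := part (@complex.Re R) (fun z w => etrans (ReD _ _) (congr1 _ (ReN _))) (@Re_le_nm R).
have [v2 [h2 [a2 E2 i2 D2]]] := part (@complex.Im R) ImB (@Im_le_nm R).
have [N1 [mN1 N10 HN1]] := D1; have [N2 [mN2 N20 HN2]] := D2.
pose N := N1 `|` N2; have mN : measurable N by exact: measurableU.
have muN : mu N = 0%E by rewrite null_set_setU.
pose k1 := h1 \_ (~` N); pose k2 := h2 \_ (~` N).
have nD t : t \in `]alpha, beta[ -> ~ N t -> is_derive t 1 v1 (h1 t) /\ is_derive t 1 v2 (h2 t).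
  move=> tab nN; split; apply: contrapT => nD; apply: nN; [left; apply: HN1|right; apply: HN2].
    by move=> H; apply: nD; exact: H.
  by move=> H; apply: nD; exact: H.
have kE t : ~ N t -> k1 t = h1 t /\ k2 t = h2 t.
  by move=> nN; rewrite /k1 /k2 !patchE !mem_set.
have k0 t : N t -> k1 t = 0 /\ k2 t = 0.
  by move=> nN; rewrite /k1 /k2 !patchE !memNset//= => /(_ nN).
have ki (h : R -> R) : mu.-integrable setT (EFin \o h) -> mu.-integrable setT (EFin \o (h \_ (~` N))).
  move=> hi; rewrite -restrict_EFin; apply/(integrable_restrict _ (measurableC mN)); rewrite ?setTI//.
  by apply: integrableS hi => //; exact: measurableC.
have mI : measurable (I alpha beta) by exact: measurable_itv.
have mk (h : R -> R) : mu.-integrable setT (EFin \o h) -> measurable_fun (I alpha beta) h.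
  by move=> /measurable_int /measurable_EFinP mh; exact: measurable_funTS.
have aek : {ae mu, forall t, t \in `]alpha, beta[ -> is_derive t 1 v1 (k1 t)} /\
    {ae mu, forall t, t \in `]alpha, beta[ -> is_derive t 1 v2 (k2 t)}.
  split; exists N; split=> // t /= nH; apply: contrapT => nN; apply: nH => tab;
  have [H1 H2] := nD t tab nN; have [e1 e2] := kE t nN.
    by rewrite e1.
  by rewrite e2.
have [Dk1 Dk2] := aek.
exists (fun t => Complex (k1 t) (k2 t)); split.
- exact: mk (ki _ i1).
- exact: mk (ki _ i2).
- move=> t tab; have [/k0[-> ->]|nN] := pselect (N t); [by left|right].
  have tI : t \in `]alpha, beta[ by rewrite in_itv.
  have [H1 H2] := nD t tI nN; have [-> ->] := kE t nN.
  exact: has_slope_parts tab E1 E2 H1 H2.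
- have [M1 M10 HM1] := acont_bounded ab a1; have [M2 M20 HM2] := acont_bounded ab a2.
  exists (M1 + M2); first exact: addr_ge0.
  move=> t tab; apply: le_trans (nm_le_ReIm _) _; rewrite -E1// -E2//.
  have tab' : alpha <= t <= beta by case/andP: tab => ? ?; rewrite !ltW.
  by apply: lerD; [exact: HM1|exact: HM2].
- move=> phi tphi; rewrite /Cintegral.
  have sRe (r : R) (z : C) : complex.Re (r *: z) = r * complex.Re z by case: z.
  have sIm (r : R) (z : C) : complex.Im (r *: z) = r * complex.Im z by case: z.
  have W1 := weak_derivative_real ab a1 (ki _ i1) Dk1 tphi.
  have W2 := weak_derivative_real ab a2 (ki _ i2) Dk2 tphi.
  have -> : \int[mu]_(t in I alpha beta) complex.Re (derive1 phi t *: f t) = \int[mu]_(t in I alpha beta) (derive1 phi t * v1 t).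
    by apply: eq_Rintegral => t; rewrite inE /= in_itv /= => tab; rewrite sRe E1.
  have -> : \int[mu]_(t in I alpha beta) complex.Im (derive1 phi t *: f t) = \int[mu]_(t in I alpha beta) (derive1 phi t * v2 t).
    by apply: eq_Rintegral => t; rewrite inE /= in_itv /= => tab; rewrite sIm E2.
  have -> : \int[mu]_(t in I alpha beta) complex.Re (phi t *: (Complex (k1 t) (k2 t) : C)) = \int[mu]_(t in I alpha beta) (phi t * k1 t) by [].
  have -> : \int[mu]_(t in I alpha beta) complex.Im (phi t *: (Complex (k1 t) (k2 t) : C)) = \int[mu]_(t in I alpha beta) (phi t * k2 t) by [].
  by rewrite W1 W2.
Qed.

End WeakDerivative.

(** * The norm estimate and the conclusion *)

Lemma lt_critical_exponent (R : realType) (n : nat) (p : R) : (0 < n)%N ->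
  (p%:E < critical_exponent R n)%E -> n.-1%:R * p < n%:R.
Proof.
rewrite /critical_exponent; case: n => // -[|n] _ /=; first by rewrite mul0r ltr01.
by rewrite lte_fin ltr_pdivlMr ?ltr0n// mulrC.
Qed.

Lemma powR_max_measure (R : realType) (p x : R) : 1 <= p -> 0 <= x ->
  (Num.max 1 x) `^ p^-1 <= Num.max 1 (x `^ p^-1).
Proof.
move=> p1 x0; have [x1|x1] := leP x 1.
  by rewrite powR1 le_max lexx.
by rewrite le_max lexx orbT.
Qed.

(** The slack e keeps the scale rho = M + e positive even if all norms vanish; it is sent to 0 at
    the end. *)
Lemma le_root_max (R : realType) (n : nat) (N : nat -> R) (e : R) : 0 < e ->
  (forall j, (1 <= j <= n)%N -> 0 <= N j) -> forall j, (1 <= j <= n)%N ->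
  N j <= (\big[Num.max/0]_(1 <= i < n.+1) (N i `^ i%:R^-1) + e) ^+ j.
Proof.
move=> e0 N0 j jn; have [j0 jn'] := andP jn.
set M := \big[Num.max/0]_(_ <= _ < _) _.
have jM : N j `^ j%:R^-1 <= M.
  have jI : j \in index_iota 1 n.+1 by rewrite mem_index_iota.
  exact: (@Order.TotalTheory.le_bigmax_seq _ R _ _ (0 : R) j xpredT (fun i => N i `^ i%:R^-1) jI).
have -> : N j = (N j `^ j%:R^-1) ^+ j.
  by rewrite -powR_mulrn ?powR_ge0// -powRrM mulVf ?pnatr_eq0 -?lt0n// powRr1// N0.
rewrite lerXn2r ?nnegrE ?powR_ge0//; last lra.
by apply: addr_ge0; [apply: le_trans jM; exact: powR_ge0|exact: ltW].
Qed.

Lemma continuous_part (R : realType) (P : Rcomplex R -> R) (f : R -> Rcomplex R) t :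
  (forall z w, P (z - w) = P z - P w) -> (forall z, `|P z| <= nm z) ->
  {for t, continuous f} -> {for t, continuous (P \o f)}.
Proof.
move=> PB Pn fc; apply/cvgrPdist_lt => e e0.
have /cvgrPdist_lt/(_ _ e0) := fc; apply: filterS => s /=.
by apply: le_lt_trans; rewrite -PB; exact: Pn.
Qed.

Theorem theorem1 (R : realType) :
  exists C : nat -> R -> R,
  forall (n : nat) (alpha beta : R) (a : nat -> R -> Rcomplex R)
         (lambda : R -> Rcomplex R),
    (1 <= n)%N -> alpha < beta ->
    (forall j, (1 <= j <= n)%N -> Ck1 n.-1 alpha beta (a j)) ->
    {in `]alpha, beta[, continuous lambda} ->
    (forall t, t \in `]alpha, beta[ -> root (monic_poly n a t) (lambda t)) ->
    abs_continuous `]alpha, beta[%classic lambda /\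
    forall p : R, 1 <= p -> (p%:E < critical_exponent R n)%E ->
      in_W1p p `]alpha, beta[%classic lambda /\
      (Lp_norm p `]alpha, beta[%classic (derive1 lambda) <=
        (C n p * Num.max 1 ((beta - alpha) `^ p^-1) *
         \big[Num.max/0]_(1 <= j < n.+1)
            (Ck1_norm n.-1 alpha beta (a j) `^ j%:R^-1))%:E)%E.
Proof.
have /choice[B HB] : forall np : nat * R, exists B : R, 0 <= B /\ ((0 < np.1)%N -> 1 <= np.2 ->
    np.1.-1%:R * np.2 < np.1%:R -> forall (alpha beta : R) (a : nat -> R -> Rcomplex R)
    (lambda : R -> Rcomplex R) rho a' b',
    alpha < beta -> (forall j, (1 <= j <= np.1)%N -> Ck1 np.1.-1 alpha beta (a j)) ->
    {in `]alpha, beta[, continuous lambda} ->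
    (forall t, t \in `]alpha, beta[ -> root (monic_poly np.1 a t) (lambda t)) ->
    0 < rho -> (forall j, (1 <= j <= np.1)%N -> Ck1_norm np.1.-1 alpha beta (a j) <= rho ^+ j) ->
    alpha < a' -> a' < b' -> b' < beta ->
    VB np.2 lambda a' b' (B * rho `^ np.2 * Num.max 1 (beta - alpha))).
  move=> [n p] /=; have [n0|n0] := ltnP 0 n; last by exists 0; split=> // /(leq_trans _)/(_ n0).
  have [p1|p1] := leP 1 p; last by exists 0; split=> // _; rewrite leNgt p1.
  have [np|np] := ltP (n.-1%:R * p) n%:R; last by exists 0; split=> // _ _; rewrite ltNge np.
  by have [B B0 H] := root_VB n0 p1 np; exists B.
exists (fun n p => B (n, p) `^ p^-1) => n alpha beta a lambda n0 ab aC lc lroot.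
set M := \big[Num.max/0]_(1 <= j < n.+1) _.
have M0 : 0 <= M by rewrite /M; elim/big_rec: _ => // i x _ x0; rewrite le_max x0 orbT.
have N0 j : (1 <= j <= n)%N -> 0 <= Ck1_norm n.-1 alpha beta (a j).
  move=> jn; have [H _] := Ck1_norm_bounds ab (aC j jn).
  have mab : alpha < (alpha + beta) / 2 < beta by apply/andP; split; lra.
  by apply: le_trans (H 0%N _ isT mab); exact: nm_ge0.
pose V p e := B (n, p) * (M + e) `^ p * Num.max 1 (beta - alpha).
have mx0 : 0 <= Num.max 1 (beta - alpha) by rewrite le_max ler01.
have B0 p : 0 <= B (n, p) by have [] := HB (n, p).
have V0 p e : 0 <= V p e by rewrite !mulr_ge0 ?powR_ge0.
have lV p e : 1 <= p -> n.-1%:R * p < n%:R -> 0 < e ->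
    forall a' b', alpha < a' -> a' < b' -> b' < beta -> VB p lambda a' b' (V p e).
  move=> p1 np e0 a' b' aa' a'b' b'b; have [_ H] := HB (n, p).
  apply: (H n0 p1 np alpha beta a) => //; first lra.
  exact: le_root_max.
(* A subcritical exponent above 1. Absolute continuity and the weak derivative are obtained from p0,
   because p may equal 1, where bounded p-variation does not give them. *)
pose p0 : R := 1 + (2 * n%:R)^-1.
have nR : 1 <= n%:R :> R by rewrite ler1n.
have n2 : 0 < 2 * n%:R :> R by rewrite mulr_gt0// ltr0n.
have p01 : 1 < p0 by rewrite ltrDl invr_gt0.
have np0 : n.-1%:R * p0 < n%:R.
  have nE : n%:R = n.-1%:R + 1 :> R by rewrite natr1 prednK.
  have : n.-1%:R * (2 * n%:R)^-1 < 1 :> R by rewrite ltr_pdivrMr// mul1r; lra.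
  by rewrite mulrDr mulr1; lra.
have lV0 := lV p0 1 (ltW p01) np0 ltr01.
split; first exact: abs_continuous_VB p01 (V0 p0 1) ab lV0.
move=> p p1 /(lt_critical_exponent n0) np.
have [g [gr gi gs [K K0 HK] wg]] := slope_exists ab p01 (V0 p0 1) lV0.
have p_gt0 : 0 < p by lra.
have mA : measurable (`]alpha, beta[%classic : set (measurableTypeR R)) by exact: measurable_itv.
(* Stated for any w that is 0 or a slope at each point, so that it serves both the weak derivative g
   and [derive1 lambda]. *)
have norm_le (w : R -> Rcomplex R) e : 0 < e ->
    (forall t, alpha < t < beta -> w t = 0 \/ has_slope lambda t (w t)) ->
    (Lp_norm p `]alpha, beta[%classic w <= (V p e `^ p^-1)%:E)%E.
  move=> e0 ws; apply: (Lp_norm_le_integral (l := slope_pow alpha beta p lambda)) => //.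
  - by move=> t _; exact: slope_pow_ge0.
  - move=> t; rewrite /= in_itv /= => tab; have [->|wt] := ws t tab.
      by rewrite nm0 powR0 ?gt_eqF// slope_pow_ge0.
    exact: slope_pow_le.
  - by apply: integral_slope_pow => //; exact: lV.
have lr : in_Lp p `]alpha, beta[%classic lambda.
  have ImB (z w : Rcomplex R) : complex.Im (z - w) = complex.Im z - complex.Im w by case: z w => [? ?] [? ?].
  split.
  - apply: open_continuous_measurable_fun; first exact: interval_open.
    move=> t; rewrite inE /= => tab; apply: (@continuous_part R (@complex.Re R)); last exact: lc.
      by move=> z w; rewrite ReD ReN.
    exact: Re_le_nm.
  - apply: open_continuous_measurable_fun; first exact: interval_open.
    move=> t; rewrite inE /= => tab; apply: (@continuous_part R (@complex.Im R)); last exact: lc.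
      exact: ImB.
    exact: Im_le_nm.
  - apply: le_lt_trans (ltry _).
    apply: (Lp_norm_le_integral (l := fun=> (K `^ p)%:E) (V := K `^ p * (beta - alpha))) => //.
    + by rewrite mulr_ge0 ?powR_ge0// subr_ge0 ltW.
    + by move=> t _; rewrite lee_fin powR_ge0.
    + move=> t; rewrite /= in_itv /= => tab; rewrite lee_fin.
      by apply: ge0_ler_powR; rewrite ?nnegrE ?nm_ge0 ?HK// ltW.
    + rewrite integral_cst// EFinM; apply: lee_wpmul2l; first by rewrite lee_fin powR_ge0.
      by rewrite [leLHS]lebesgue_measure_itv /= lte_fin ab -EFinB.
split.
  split=> //; exists g => //; split=> //.
  by apply: le_lt_trans (norm_le g 1 ltr01 gs) (ltry _).
apply/lee_addgt0Pr => e e0.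
set X := B (n, p) `^ p^-1 * Num.max 1 ((beta - alpha) `^ p^-1).
have X0 : 0 <= X by rewrite mulr_ge0 ?powR_ge0// le_max ler01.
pose e' := e / (X + 1); have X1 : 0 < X + 1 by lra.
have e'0 : 0 < e' by rewrite divr_gt0.
apply: le_trans (norm_le _ e' e'0 _) _.
  move=> t tab; have [ld|nld] := pselect (derivable lambda t 1); last first.
    (* Where the limit does not exist, [derive1] takes the default value 0. *)
    by left; rewrite derive1E /derive (dvgP nld).
  right=> e1 e10; have [d d0 Hd] := derivable_nm ld e10; exists d => // h hd.
  have [->|h0] := eqVneq h 0; first by rewrite add0r subrr rmorph0 mul0r subr0 nm0 normr0 mulr0.
  have := ltW (Hd h h0 hd).
  have -> : lambda (h + t) - lambda t - cR h * derive1 lambda t =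
      cR h * (cR h^-1 * (lambda (h + t) - lambda t) - derive1 lambda t).
    by rewrite mulrBr mulrA -rmorphM divff// rmorph1 mul1r.
  by move=> H; rewrite nmM nm_cR mulrC ler_wpM2r.
rewrite -EFinD lee_fin /V.
have Me : 0 <= M + e' by lra.
rewrite !powRM ?mulr_ge0 ?powR_ge0// -powRrM divff ?gt_eqF// powRr1//.
have mm := @powR_max_measure R p (beta - alpha) p1 (ltac:(by rewrite subr_ge0 ltW)).
apply: (@le_trans _ _ (X * (M + e'))).
  by rewrite mulrAC ler_wpM2r// ler_wpM2l ?powR_ge0.
rewrite mulrDr lerD2l /e' mulrA ler_pdivrMr// mulrC ler_wpM2l ?(ltW e0)//; lra.
Qed.
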